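(* Let $\mathrm{LG}(2)=(X,f_H)$ be the Landau--Ginzburg model consisting of the adjoint orbit $X=\mathcal O(H_0)\subset\mathfrak{sl}(2,\mathbb C)$ of $H_0=\begin{pmatrix}1&0\\ 0&-1\end{pmatrix}$, with the symplectic form $\Omega$, and the height function $f_H(A)=\operatorname{tr}(HA)$ with $H=H_0$. The Fukaya--Seidel category of $\mathrm{LG}(2)$ (the directed $A_\infty$-category of vanishing cycles, over $\mathbb Z$) is generated by two Lagrangians $L_0$ and $L_1$ with morphisms $$\operatorname{Hom}(L_i,L_j)\simeq\begin{cases}\mathbb Z\oplus\mathbb Z[-1] & i<j\\ \mathbb Z & i=j\\ 0 & i>j\end{cases}$$ where $\mathbb Z$ is regarded as a complex concentrated in degree $0$ and $\mathbb Z[-1]$ is its shift, concentrated in degree $1$, and the products $m_k$ all vanish except for $m_2(\,\cdot\,,\mathrm{id})$ and $m_2(\mathrm{id},\,\cdot\,)$.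
   Context: The orbit: $X=\{gH_0g^{-1}: g\in \mathrm{SL}(2,\mathbb C)\}$. Writing $A=\begin{pmatrix}x&y\\ z&-x\end{pmatrix}$, $X$ is the smooth affine surface $\{x^2+yz=1\}\subset\mathbb C^3$. The symplectic form $\Omega$ is the restriction to $X$ of the imaginary part of the Hermitian form $\mathcal H(A,B)=\operatorname{tr}(AB^* )$ on $\mathfrak{sl}(2,\mathbb C)$ (up to the positive constant relating the trace form and the Cartan--Killing form). The potential is $f_H\colon X\to\mathbb C$, $f_H(x,y,z)=2x$. With it $X$ is a symplectic Lefschetz fibration with exactly two critical points $(\pm1,0,0)$ and critical values $\pm2$. Thimbles: fix the regular value $0$ and the straight segments joining $-2$ to $0$ and $0$ to $2$. Over the point $2\lambda$, $\lambda\in[-1,1]$, consider the circle $\alpha_\lambda(t)=(\lambda,e^{it}\sqrt{1-\lambda^2},e^{-it}\sqrt{1-\lambda^2})$, $0\le t\le2\pi$, in the fibre $f_H^{-1}(2\lambda)$. The thimble associated to $-2$ is $\bigcup_{\lambda\in[-1,0]}\alpha_\lambda$ and the one associated to $2$ is $\bigcup_{\lambda\in[0,1]}\alpha_\lambda$. $L_0$ and $L_1$ denote these thimbles, and also, by abuse of notation, the corresponding vanishing cycles in the regular fibre $X_0=f_H^{-1}(0)=\{yz=1\}\cong\mathbb C^*\cong T^*S^1$; both vanishing cycles are the circle $\{(0,e^{it},e^{-it})\}$. Directed category of vanishing cycles of a Landau--Ginzburg model (over a coefficient ring $R$): the $A_\infty$-category whose objects $L_1,\dots,L_r$ correspond to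 the vanishing cycles (thimbles), ordered, with $\operatorname{Hom}(L_i,L_j)=CF^*(L_i,L_j)=R^{|L_i\cap L_j|}$ for $i<j$ (Lagrangian Floer complex in the regular fibre, after making the cycles transverse by a Hamiltonian perturbation), $\operatorname{Hom}(L_i,L_i)=R\cdot\mathrm{id}$ with $\mathrm{id}$ a strict unit, and $\operatorname{Hom}(L_i,L_j)=0$ for $i>j$; the differential $m_1$, composition $m_2$ and higher products $m_k$ are defined by Lagrangian Floer theory in the regular fibre. The Fukaya--Seidel category of $\mathrm{LG}(2)$ is this category with $R=\mathbb Z$. Here the two coinciding circles are made transverse by perturbing with a Morse function on $S^1$ having exactly two critical points, and gradings of the Lagrangians are chosen suitably. *)

(* Defs.v *)
From HB Require Import structures.
From mathcomp Require Import all_boot all_order all_algebra.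
From mathcomp Require Import finmap.
From mathcomp Require Import all_classical all_reals all_analysis.
From mathcomp Require Import complex.

Set Implicit Arguments.
Unset Strict Implicit.
Unset Printing Implicit Defensive.

Import Order.TTheory GRing.Theory Num.Theory numFieldNormedType.Exports.
Local Open Scope classical_set_scope.
Local Open Scope complex_scope.
Local Open Scope ring_scope.

(* The differential is indexed by both degrees, and is zero off k + 1 = l;
   this avoids transporting along equalities of degrees in shifts. *)
Record cochain := Cochain {
  cx : int -> zmodType;
  dif : forall k l, cx k -> cx l;
  dif_additive : forall k l (x y : cx k),
    @dif k l (x - y) = @dif k l x - @dif k l y;
  dif_shape : forall k l (x : cx k), l != k + 1 -> @dif k l x = 0;
  dif_dif : forall k l m (x : cx k), @dif l m (@dif k l x) = 0 }.

Definition zero_dif (V : int -> zmodType) (k l : int) (x : V k) : V l := 0.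

Fact zero_dif_additive (V : int -> zmodType) k l (x y : V k) :
  @zero_dif V k l (x - y) = @zero_dif V k l x - @zero_dif V k l y.
Proof. exact/esym/subr0. Qed.

Definition zero_dif_cochain (V : int -> zmodType) : cochain :=
  @Cochain V (@zero_dif V) (@zero_dif_additive V) (fun _ _ _ _ => erefl)
    (fun _ _ _ _ => erefl).

Definition cochain0 : cochain := zero_dif_cochain (fun=> 'rV[int]_0).

(* Z in degree 0: the group in degree k is Z^1 if k = 0 and Z^0 otherwise. *)
Definition cochainZ : cochain := zero_dif_cochain (fun k => 'rV[int]_(k == 0)).

Section Constructions.
Variables (A B : cochain).

Definition cshift_dif (a k l : int) (x : cx A (k + a)) : cx A (l + a) :=
  dif (l + a) x *~ (-1) ^ a.

Fact cshift_dif_additive a k l (x y : cx A (k + a)) :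
  cshift_dif l (x - y) = cshift_dif l x - cshift_dif l y.
Proof. by rewrite /cshift_dif dif_additive mulrzBl. Qed.

Fact cshift_dif_shape a k l (x : cx A (k + a)) :
  l != k + 1 -> cshift_dif l x = 0.
Proof.
move=> lk; rewrite /cshift_dif dif_shape ?mul0rz //; apply: contra lk => /eqP e.
by apply/eqP/(addIr a); rewrite e addrAC.
Qed.

Fact cshift_dif_dif a k l m (x : cx A (k + a)) :
  cshift_dif m (cshift_dif l x) = 0.
Proof.
rewrite /cshift_dif; set y := dif (l + a) x.
have dif0 : dif (m + a) (0 : cx A (l + a)) = 0.
  by rewrite -(subrr 0) dif_additive subrr.
have difN z : dif (m + a) (- z : cx A (l + a)) = - dif (m + a) z.
  by rewrite -[- z]add0r dif_additive dif0 add0r.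
have difMn n : dif (m + a) (y *+ n) = 0.
  elim: n => [|n IH]; first by rewrite mulr0n dif0.
  by rewrite mulrS -[_ *+ n]opprK dif_additive difN IH oppr0 subr0 dif_dif.
by case: ((-1) ^ a) => n; rewrite ?NegzE ?mulrNz -?pmulrn ?difN !difMn ?oppr0
  ?mul0rn ?oppr0.
Qed.

Definition cshift (a : int) : cochain :=
  @Cochain (fun k => cx A (k + a)) (@cshift_dif a) (@cshift_dif_additive a)
    (@cshift_dif_shape a) (@cshift_dif_dif a).

Definition cdsum_dif k l (x : cx A k * cx B k) : cx A l * cx B l :=
  (dif l x.1, dif l x.2).

Fact cdsum_dif_additive k l (x y : (cx A k * cx B k)%type) :
  cdsum_dif l (x - y) = cdsum_dif l x - cdsum_dif l y.
Proof. by rewrite /cdsum_dif /= !dif_additive. Qed.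

Fact cdsum_dif_shape k l (x : cx A k * cx B k) : l != k + 1 -> cdsum_dif l x = 0.
Proof. by move=> lk; rewrite /cdsum_dif !dif_shape. Qed.

Fact cdsum_dif_dif k l m (x : cx A k * cx B k) : cdsum_dif m (cdsum_dif l x) = 0.
Proof. by rewrite /cdsum_dif /= !dif_dif. Qed.

Definition cdsum : cochain :=
  @Cochain (fun k => (cx A k * cx B k)%type) cdsum_dif cdsum_dif_additive
    cdsum_dif_shape cdsum_dif_dif.

End Constructions.

Definition cochain_iso (A B : cochain) : Prop :=
  exists f : forall k, cx A k -> cx B k,
    [/\ forall k, bijective (f k),
        forall k x y, f k (x + y) = f k x + f k y
      & forall k l x, f l (dif l x) = dif l (f k x)].

(* Hom(i, j) is the free graded abelian group on the generators with source i
   and target j. For s = [:: b_1; ...; b_d], mu s c is the coefficient of c in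
   m_d(b_d, ..., b_1). *)
Record ainf_cat (I : eqType) := AinfCat {
  gen : finType;
  src : gen -> I;
  tgt : gen -> I;
  deg : gen -> int;
  mu : seq gen -> gen -> int;
  mu_path : forall s c, mu s c != 0 ->
    if s is b :: s' then
      [&& path (fun x y => tgt x == src y) b s', src c == src b
        & tgt c == tgt (last b s')]
    else false;
  mu_deg : forall s c, mu s c != 0 ->
    deg c = \sum_(b <- s) deg b + 2 - (size s)%:Z;
  mu_ainf : forall s c,
    \sum_(n < (size s).+1) \sum_(m < (size s).+1 | (0 < m)%N && (n + m <= size s)%N)
      \sum_(d : gen) (-1) ^ (\sum_(b <- take n s) (deg b - 1))
        * mu (take m (drop n s)) d
        * mu (take n s ++ d :: drop (n + m) s) c = 0 }.

Section AinfCat.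
Variables (I : eqType) (C : ainf_cat I).

Definition homgen (i j : I) (k : int) : finType :=
  {g : gen C | [&& src g == i, tgt g == j & deg g == k]}.

Definition hom_dif i j k l (f : {ffun homgen i j k -> int}) :
    {ffun homgen i j l -> int} :=
  [ffun y => \sum_x f x * mu [:: val x] (val y)].

Fact hom_dif_additive i j k l (f g : {ffun homgen i j k -> int}) :
  hom_dif l (f - g) = hom_dif l f - hom_dif l g.
Proof.
by apply/ffunP => y; rewrite !ffunE -sumrB; apply: eq_bigr => x _; rewrite !ffunE mulrBl.
Qed.

Fact hom_dif_shape i j k l (f : {ffun homgen i j k -> int}) :
  l != k + 1 -> hom_dif l f = 0.
Proof.
move=> lk; apply/ffunP => -[y /= yP]; rewrite !ffunE big1 // => -[x /= xP] _.
have [->|/mu_deg] := eqVneq (mu [:: x] y) 0; first by rewrite mulr0.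
rewrite big_seq1 => e; case/and3P: (xP) (yP) => _ _ /eqP xk /and3P[_ _ /eqP yl].
by case/eqP: lk; rewrite -yl e xk -addrA.
Qed.

Lemma mu1_mu1 (x z : gen C) : \sum_y mu [:: x] y * mu [:: y] z = 0 :> int.
Proof.
have := @mu_ainf _ C [:: x] z.
rewrite big_ord_recl big_ord_recl big_ord0 addr0 /= [X in _ + X]big_pred0; last first.
  by move=> m; rewrite /bump /= add1n ltnS; case: (val m).
rewrite addr0 big_mkcond !big_ord_recl big_ord0 /= add0r addr0 big_nil expr0z.
by under eq_bigr do rewrite mul1r.
Qed.

Fact hom_dif_dif i j k l m (f : {ffun homgen i j k -> int}) :
  hom_dif m (hom_dif l f) = 0.
Proof.
have [->|lk] := eqVneq l (k + 1); last first.
  rewrite (hom_dif_shape _ lk); apply/ffunP => z; rewrite !ffunE big1 // => y _.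
  by rewrite ffunE mul0r.
apply/ffunP => z; rewrite !ffunE.
under eq_bigr do rewrite ffunE mulr_suml.
rewrite exchange_big /= big1 // => -[x xP] _ /=.
under eq_bigr do rewrite -mulrA; rewrite -mulr_sumr.
suff -> : \sum_(y : homgen i j (k + 1)) mu [:: x] (val y) * mu [:: val y] (val z)
    = \sum_y mu [:: x] y * mu [:: y] (val z) by rewrite mu1_mu1 mulr0.
rewrite [RHS](bigID (fun y => [&& src y == i, tgt y == j & deg y == k + 1])) /=.
rewrite [X in _ = _ + X]big1 ?addr0; last first.
  move=> y yN; have [->|nz] := eqVneq (mu [:: x] y) 0; first by rewrite mul0r.
  case/negP: yN; have := mu_deg nz; have /and3P[_ /eqP-> /eqP->] := mu_path nz.
  case/and3P: xP => /eqP-> /eqP-> /eqP xk; rewrite big_seq1 xk => ->.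
  by rewrite !eqxx /= -addrA.
rewrite [RHS](reindex_omap val (fun y => insub y : option (homgen i j (k + 1)))) /=; last first.
  by move=> y yP; case: insubP => [u _ <-|] /=; rewrite ?yP.
by apply: eq_bigl => y; rewrite valK eqxx andbT (valP y).
Qed.

Definition hom_complex i j : cochain :=
  @Cochain (fun k => {ffun homgen i j k -> int} : zmodType) (@hom_dif i j)
    (@hom_dif_additive i j) (@hom_dif_shape i j) (@hom_dif_dif i j).

(* m_1(e) = 0, m_2(x, e) = x = (-1)^|x| m_2(e, x), and m_d vanishes on e for
   d > 2; the sign is forced by the signs of the A-infinity relations. *)
Definition strict_unit (i : I) (e : gen C) : Prop :=
  [/\ [/\ src e = i, tgt e = i & deg e = 0],
      forall c, mu [:: e] c = 0,
      forall x c, src x = i -> mu [:: e; x] c = (x == c)%:R,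
      forall x c, tgt x = i -> mu [:: x; e] c = (-1) ^ deg x * (x == c)%:R
    & forall s c, e \in s -> (2 < size s)%N -> mu s c = 0].

End AinfCat.

Section LG2.
Variable R : realType.

Definition cexp (t : R) : R[i] := cos t +i* sin t.

Definition sl2 (x y z : R[i]) : 'M[R[i]]_2 :=
  \matrix_(i, j) if i == 0 then (if j == 0 then x else y)
                 else (if j == 0 then z else - x).

Definition H0 : 'M[R[i]]_2 := sl2 1 0 0.

Definition orbit : set 'M[R[i]]_2 :=
  [set g *m H0 *m invmx g | g in [set g | \det g = 1]].

Definition hermitian (A B : 'M[R[i]]_2) : R[i] :=
  \tr (A *m (map_mx conjc B)^T).

Definition Omega (A B : 'M[R[i]]_2) : R := complex.Im (hermitian A B).

Definition height (A : 'M[R[i]]_2) : R[i] := \tr (H0 *m A).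

(* The tangent space of the orbit at A is {[B, A] | B in sl(2, C)}, and the
   height function is linear, hence equal to its own differential. *)
Definition critical_points : set 'M[R[i]]_2 :=
  [set A | orbit A /\ forall B, \tr B = 0 -> height (B *m A - A *m B) = 0].

(* Index 0 stands for the critical value -2 and index 1 for 2. *)
Definition apex (i : 'I_2) : 'M[R[i]]_2 := if i == 0 then - H0 else H0.

Definition alpha (l t : R) : 'M[R[i]]_2 :=
  sl2 l%:C ((Num.sqrt (1 - l ^+ 2))%:C * cexp t)
           ((Num.sqrt (1 - l ^+ 2))%:C * cexp (- t)).

Definition thimble (i : 'I_2) : set 'M[R[i]]_2 :=
  [set A | exists l t, A = alpha l t /\
     if i == 0 then -1 <= l <= 0 else 0 <= l <= 1].

Definition regular_fibre : set 'M[R[i]]_2 :=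
  orbit `&` [set A | height A = 0].

(* The coordinate w = y identifies the regular fibre with C \ {0}, see fibE;
   dfib w is the differential of fib at w. *)
Definition fib (w : R[i]) : 'M[R[i]]_2 := sl2 0 w w^-1.

Definition dfib (w v : R[i]) : 'M[R[i]]_2 := sl2 0 v (- (v / w ^+ 2)).

Definition omega (w v v' : R[i]) : R := Omega (dfib w v) (dfib w v').

Definition vanishing_cycle (i : 'I_2) : set R[i] :=
  [set w | w != 0 /\ (thimble i `&` regular_fibre) (fib w)].

Lemma det_mx2 (A : 'M[R[i]]_2) : \det A = A 0 0 * A 1 1 - A 0 1 * A 1 0.
Proof.
rewrite (expand_det_row _ 0) !big_ord_recl big_ord0 addr0 /cofactor !det_mx11 !mxE /=.
rewrite expr0 mul1r expr1 mulN1r mulrN.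
by congr (_ * A _ _ - A _ _ * A _ _); apply/val_inj.
Qed.

Lemma height_sl2 x y z : height (sl2 x y z) = x + x.
Proof.
by rewrite /height /mxtrace big_ord_recl big_ord1 !mxE !big_ord_recl !big_ord0
  !mxE /=; rewrite !mul0r !mul1r !addr0 !add0r mulN1r opprK.
Qed.

Lemma det_sl2 x y z : \det (sl2 x y z) = - x ^+ 2 - y * z.
Proof. by rewrite det_mx2 !mxE /= mulrN expr2. Qed.

Lemma sl2_of_trace0 (A : 'M[R[i]]_2) : \tr A = 0 ->
  A = sl2 (A 0 0) (A 0 1) (A 1 0).
Proof.
rewrite /mxtrace big_ord_recl big_ord1 => /eqP; rewrite addr_eq0 => /eqP A00.
apply/matrixP => i j; rewrite !mxE.
case: (unliftP 0 i) => [k|] ->; case: (unliftP 0 j) => [l|] -> /=;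
  rewrite ?ord1 //=; try by congr (A _ _); apply/val_inj.
by rewrite A00 opprK; congr (A _ _); apply/val_inj.
Qed.

Lemma fibE : regular_fibre = fib @` [set w | w != 0].
Proof.
apply/seteqP; split => [A [[g /= g1 AE] hA]|_ [w /= w0 <-]].
- have gu : g \in unitmx by rewrite unitmxE g1 unitr1.
  have trA : \tr A = 0.
    rewrite -AE mxtrace_mulC mulmxA mulVmx // mul1mx /mxtrace big_ord_recl big_ord1.
    by rewrite !mxE /= subrr.
  have AE' := sl2_of_trace0 trA; move: hA; rewrite /= AE' height_sl2 => /eqP.
  rewrite -mulr2n mulrn_eq0 /= => /eqP A0; rewrite A0 in AE' *.
  have : \det A = - 1.
    rewrite -AE !det_mulmx g1 mul1r det_inv g1 invr1 mulr1 det_sl2.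
    by rewrite expr1n mulr0 subr0.
  rewrite AE' det_sl2 !mxE /= expr0n oppr0 add0r => /eqP; rewrite eqr_opp => /eqP yz.
  have y0 : A 0 1 != 0 by apply/eqP => y0; move/eqP: yz; rewrite y0 mul0r eq_sym oner_eq0.
  by exists (A 0 1) => //; rewrite /fib; congr sl2; apply: (mulfI y0); rewrite mulfV.
- split; last by rewrite /= height_sl2 addr0.
  have two0 : (2 : R[i]) != 0 by rewrite pnatr_eq0.
  pose g : 'M[R[i]]_2 := \matrix_(i, j)
    if i == 0 then (if j == 0 then 2^-1 else - w)
    else (if j == 0 then (2 * w)^-1 else 1).
  have g1 : \det g = 1.
    rewrite det_mx2 !mxE /= mulr1 mulNr opprK invfM mulrCA mulfV // mulr1.
    by rewrite -mulr2n -[_ *+ 2]mulr_natr mulVf.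
  have gu : g \in unitmx by rewrite unitmxE g1 unitr1.
  exists g => //; apply: (can_inj (mulmxK gu)); rewrite mulmxKV //.
  apply/matrixP => i j; rewrite !mxE !big_ord_recl !big_ord0 !mxE /= !addr0.
  case: (unliftP 0 i) => [k|] ->; case: (unliftP 0 j) => [l|] -> /=;
    rewrite ?mulr0 ?mul0r ?mulr1 ?addr0 ?add0r ?oppr0 //.
  + by rewrite mul1r addr0 mulrN mulVf.
  + by rewrite mul0r addr0 invfM mulrC.
  + by rewrite mulrN1 opprK.
  + by rewrite invfM mulrCA mulfV // mulr1.
Qed.

Definition cderivable (V : normedModType R) (F : V -> R[i]) (p v : V) : Prop :=
  derivable (fun q => complex.Re (F q)) p v /\
  derivable (fun q => complex.Im (F q)) p v.

Definition cderive (V : normedModType R) (F : V -> R[i]) (p v : V) : R[i] :=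
  'D_v (fun q => complex.Re (F q)) p +i* 'D_v (fun q => complex.Im (F q)) p.

Fixpoint class_C (n : nat) (D : set (R * R)) (F : R * R -> R) : Prop :=
  match n with
  | 0 => forall p, D p -> {for p, continuous F}
  | n'.+1 =>
      [/\ forall p, D p -> derivable F p (1, 0) /\ derivable F p (0, 1),
          class_C n' D ('D_(1, 0) F) & class_C n' D ('D_(0, 1) F)]
  end.

Definition smooth (D : set (R * R)) (F : R * R -> R[i]) : Prop :=
  forall n, class_C n D (fun p => complex.Re (F p)) /\
            class_C n D (fun p => complex.Im (F p)).

(* Smooth functions on the circle are 2pi-periodic functions on the line. *)
Definition morse_two_crit (h : R -> R) : Prop :=
  [/\ forall n x, derivable (derive1n n h) x 1,
      forall x, h (x + pi *+ 2) = h x,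
      forall x, derive1n 1 h x = 0 -> derive1n 2 h x != 0
    & exists a b, a < b < a + pi *+ 2 /\
        forall x, a <= x < a + pi *+ 2 ->
          (derive1n 1 h x = 0 <-> x = a \/ x = b)].

(* Integral curves on [0, 1] of the Hamiltonian vector field, with respect to
   omega, of the function w |-> h (arg w) on C \ {0}, whose differential at w
   is v |-> h' (arg w) * Im (v / w). *)
Definition hamiltonian_orbit (h : R -> R) (c : R -> R[i]) : Prop :=
  forall t, 0 <= t <= 1 ->
    [/\ c t != 0, cderivable c t 1
      & forall th v, c t = (Normc.normc (c t))%:C * cexp th ->
          omega (c t) (cderive c t 1) v
            = derive1n 1 h th * complex.Im (v / c t)].

Definition hamiltonian_image (h : R -> R) (L : set R[i]) : set R[i] :=
  [set c 1 | c in [set c | L (c 0) /\ hamiltonian_orbit h c]].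

Definition perturbed_cycle (h : R -> R) (i : 'I_2) : set R[i] :=
  if i == 0 then vanishing_cycle 0 else hamiltonian_image h (vanishing_cycle 1).

Definition tangent (L : set R[i]) (w v : R[i]) : Prop :=
  exists c : R -> R[i],
    [/\ c 0 = w, forall t, L (c t), cderivable c 0 1 & cderive c 0 1 = v].

Definition transverse (L L' : set R[i]) : Prop :=
  forall w v, L w -> L' w -> tangent L w v -> tangent L' w v -> v = 0.

(* A grading is a continuous lift of the squared phase of L with respect to the
   holomorphic volume form dw / w of the fibre. *)
Definition grading (L : set R[i]) (ph : R[i] -> R) : Prop :=
  (forall w, L w -> forall e, 0 < e -> exists2 d, 0 < d &
     forall w', L w' -> Normc.normc (w' - w) < d -> `|ph w' - ph w| < e) /\
  (forall w v, L w -> tangent L w v -> v != 0 ->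
     exists2 r : R, 0 < r & (v / w) ^+ 2 = r%:C * cexp (pi *+ 2 * ph w)).

(* A grading orients L: the positive tangent vectors are those of phase ph. *)
Definition positively_oriented (ph : R[i] -> R) (w v : R[i]) : Prop :=
  exists2 r : R, 0 < r & v / w = r%:C * cexp (pi * ph w).

(* The circles carry the nontrivial (bounding) spin structure, which is
   trivialized away from a marked point. *)
Record brane := Brane {
  lag : set R[i];
  phase : R[i] -> R;
  mark : R[i];
  phase_grading : grading lag phase;
  mark_lag : lag mark }.

Definition floer_degree (L0 L1 : brane) (w : R[i]) : int :=
  Num.floor (phase L1 w - phase L0 w) + 1.

(* Almost complex structures on the fibre compatible with omega. Omega is the
   imaginary part of a form linear in its first argument, so Omega ('i v) v > 0,
   and compatibility is taken in the sense satisfied by multiplication by 'i.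
   On a surface omega (J v) (J v') = omega v v' follows from J ^ 2 = - 1. *)
Definition compatible_acs (J : R[i] -> R[i] -> R[i]) : Prop :=
  [/\ forall w (a : R) v v', w != 0 ->
        J w (a%:C * v + v') = a%:C * J w v + J w v',
      forall w v, w != 0 -> J w (J w v) = - v,
      forall w v, w != 0 -> v != 0 -> 0 < omega w (J w v) v
    & forall v, smooth [set p | p != 0] (fun p => J (p.1 +i* p.2) v)].

Variable J : R[i] -> R[i] -> R[i].

(* J-holomorphic maps u : R x [0, 1] -> C \ {0}, smooth up to the boundary, with
   boundary on L0 and L1, converging to y0 at -oo and to y1 at +oo. *)
Definition strip (L0 L1 : set R[i]) (y0 y1 : R[i]) (u : R * R -> R[i]) : Prop :=
  [/\ exists2 d : R, 0 < d & smooth [set p | - d < p.2 < 1 + d] u,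
      forall s t, 0 <= t <= 1 -> u (s, t) != 0 /\
        cderive u (s, t) (1, 0) + J (u (s, t)) (cderive u (s, t) (0, 1)) = 0,
      forall s, L0 (u (s, 0)) /\ L1 (u (s, 1)),
      forall e, 0 < e -> exists S, forall s t, 0 <= t <= 1 -> s < S ->
        Normc.normc (u (s, t) - y0) < e
    & forall e, 0 < e -> exists S, forall s t, 0 <= t <= 1 -> S < s ->
        Normc.normc (u (s, t) - y1) < e].

Definition translate_eq (u v : R * R -> R[i]) : Prop :=
  exists a, forall s t, 0 <= t <= 1 -> v (s, t) = u (s + a, t).

Definition crossings (c : R -> R[i]) (w : R[i]) : nat :=
  #|` fset_set [set s | c s = w] |%fset.

(* Seidel's sign rule for curves on surfaces, for a strip of index one: -1 if
   the orientation of L1 disagrees with the boundary orientation (on which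
   - d/ds is positive at t = 1), and -1 for each marked point met by the
   boundary; the orientation of L0 plays no role. *)
Definition strip_sign (L0 L1 : brane) (u : R * R -> R[i]) : int :=
  (if `[< forall s, positively_oriented (phase L1) (u (s, 1))
                      (- cderive u (s, 1) (1, 0)) >] then 1 else -1)
  * (-1) ^+ crossings (fun s => u (s, 0)) (mark L0)
  * (-1) ^+ crossings (fun s => u (s, 1)) (mark L1).

(* Finiteness of the set of strips up to translation is part of the assertion. *)
Definition strip_count (L0 L1 : brane) (y0 y1 : R[i]) (n : int) : Prop :=
  exists N (u : 'I_N -> R * R -> R[i]),
    [/\ forall k, strip (lag L0) (lag L1) y0 y1 (u k),
        forall k l, translate_eq (u k) (u l) -> k = l,
        forall v, strip (lag L0) (lag L1) y0 y1 v ->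
          exists k, translate_eq (u k) v
      & n = \sum_k strip_sign L0 L1 (u k)].

(* The generators of CF(L0, L1) between objects i and j of C, and m_1 on them.
   The output of m_1 is the limit at -oo, and the strips that are rigid up to
   translation are those that raise the degree by one. *)
Definition floer_hom (I : eqType) (C : ainf_cat I) (i j : I) (L0 L1 : brane) :
    Prop :=
  transverse (lag L0) (lag L1) /\
  exists pt : gen C -> R[i],
    [/\ {in [pred g | (src g == i) && (tgt g == j)] &, injective pt},
        pt @` [set g | src g = i /\ tgt g = j] = lag L0 `&` lag L1,
        forall g, src g = i -> tgt g = j ->
          deg g = floer_degree L0 L1 (pt g)
      & forall x y, src x = i -> tgt x = j -> src y = i -> tgt y = j ->
          if deg y == deg x + 1 then strip_count L0 L1 (pt y) (pt x) (mu [:: x] y)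
          else mu [:: x] y = 0].

(* With two objects, m_1 on Hom(L_0, L_1) is the only operation that is
   not prescribed by directedness and strict unitality. *)
Definition fukaya_seidel (L : 'I_2 -> brane) (C : ainf_cat 'I_2) : Prop :=
  [/\ injective apex /\ range apex = critical_points,
      forall i, thimble i (apex i),
      forall i, exists2 e, strict_unit i e &
        forall g : gen C, src g = i -> tgt g = i -> g = e,
      forall i j : 'I_2, (j < i)%N ->
        forall g : gen C, ~ (src g = i /\ tgt g = j)
    & forall i j : 'I_2, (i < j)%N -> floer_hom C i j (L i) (L j)].

End LG2.

(* Main.v *)
(* The perturbed cycle is the graph [sinh (2 log r) = D (arg w)], [D = - h'], over
   the unit circle. As the almost complex structure may be chosen, take the one
   for which [X + i Th] is a holomorphic coordinate, where [Th] is a new angle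
   vanishing at one critical point of [h] and equal to [pi] at the other, and
   [X] is such that the cycles become the curves [sinh X = - sin Th] and
   [sinh X = sin Th]. Composing a strip with [cosh (X + i Th)] gives a
   holomorphic function on [R x [0, 1]] whose boundary values lie on the two
   halves of the unit circle; by the maximum principle and Phragmen-Lindelof its
   Cayley transform has logarithm [pi (s + c) + i pi (t - 1 / 2)]. Hence there
   are exactly two strips up to translation, exchanged by
   [(Th, X) -> (- Th, - X)]. Together they sweep each cycle exactly once, away
   from the intersection points, and they run along the second cycle in opposite
   directions; so their signs are opposite wherever the marked points are, and
   m_1 = 0. A composable sequence of two or more generators contains a unit, so
   that no other operation is left free. *)

(* The Morse function is arbitrary, so the perturbed circle is a rather general graph, and J has to
   be adapted to it while staying smooth at the intersection points. This is possible because D and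
   sin Th have the same simple zeros and the same signs: al = 2 sin Th / D extends to a smooth
   positive function, and sinh X = al sinh (2 log r) - sin Th, which is increasing in r, equals -
   sin Th on the circle and sin Th on the graph. The function cosh is the quotient by the involution
   (Th, X) -> (- Th, - X), and its branch points are exactly the two intersection points, so it
   folds the two lenses between the cycles onto one unit disc; the boundary condition follows from
   |cosh (X + i Th)|^2 = sinh^2 X + cos^2 Th. Its differential vanishes at the branch points, and a
   Hopf-type estimate then forbids a strip to reach an intersection point at a finite boundary
   point. The angle along a strip is never lifted to the line: a point is carried by (cos Th, sin
   Th, sinh X), so that all functions stay single valued on the punctured plane. *)
Require Import Defs.
From HB Require Import structures.
From mathcomp Require Import all_boot all_order all_algebra.
From mathcomp Require Import finmap.
From mathcomp Require Import all_classical all_reals all_analysis.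
From mathcomp Require Import complex ring lra zify.

Set Implicit Arguments.
Unset Strict Implicit.
Unset Printing Implicit Defensive.

Import Order.TTheory GRing.Theory Num.Theory numFieldNormedType.Exports.
Local Open Scope classical_set_scope.
Local Open Scope complex_scope.
Local Open Scope ring_scope.

(** * Smooth functions of one and two variables *)

Section Derivatives.
Context {R : realType} {V : normedModType R}.
Implicit Types (f g : V -> R) (p v : V).

(** Directional derivatives reduce to one real variable, where the chain rule and the rule for
    inverses are available. *)
Lemma is_derive_line f p v (d : R) :
  is_derive p v f d <-> is_derive (0 : R) 1 (fun h : R => f (h *: v + p)) d.
Proof.
have E : 'D_v f p = 'D_1 (fun h : R => f (h *: v + p)) 0.
  rewrite /derive; set g := (X in lim (X @ _)); set g' := (X in _ = lim (X @ _)).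
  suff -> : g = g' by [].
  by apply/funext => h; rewrite /g /g' /= addr0 scale0r add0r [_%:A]mulr1.
split=> -[df <-]; apply: DeriveDef.
- exact: (derivable1P _ _ _).1 df.
- by rewrite E.
- exact: (derivable1P _ _ _).2 df.
- by rewrite E.
Qed.

Lemma is_deriveD_fun f g p v (a b : R) : is_derive p v f a -> is_derive p v g b ->
  is_derive p v (fun x => f x + g x) (a + b).
Proof. by move=> fa gb; exact: is_deriveD. Qed.

Lemma is_deriveN_fun f p v (a : R) : is_derive p v f a ->
  is_derive p v (fun x => - f x) (- a).
Proof. by move=> fa; exact: is_deriveN. Qed.

Lemma is_deriveM_fun f g p v (a b : R) : is_derive p v f a -> is_derive p v g b ->
  is_derive p v (fun x => f x * g x) (a * g p + f p * b).
Proof.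
move=> fa gb; have := is_deriveM fa gb.
by rewrite /GRing.scale /= addrC (mulrC (g p)).
Qed.

Lemma is_derive_compose (phi : R -> R) f p v (a b : R) :
  is_derive (f p) 1 phi a -> is_derive p v f b ->
  is_derive p v (fun x => phi (f x)) (a * b).
Proof.
move=> pa /is_derive_line fb; apply/is_derive_line.
by apply: (@is_derive1_comp _ phi (fun h => f (h *: v + p))); rewrite scale0r add0r.
Qed.

Lemma is_deriveV_fun f p v (a : R) : f p != 0 -> is_derive p v f a ->
  is_derive p v (fun x => (f x)^-1) (- a * (f p)^-1 ^+ 2).
Proof.
move=> fp /is_derive_line fa; apply/is_derive_line.
apply: is_derive_eq; first by apply: is_deriveV; rewrite ?scale0r ?add0r.
by rewrite /= scale0r add0r /GRing.scale /= exprVn; ring.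
Qed.

Lemma is_deriveX_fun n f p v (a : R) : is_derive p v f a ->
  is_derive p v (fun x => f x ^+ n) (n%:R * f p ^+ n.-1 * a).
Proof.
move=> fa; elim: n => [|n IH]; first by rewrite !mul0r; exact: is_derive_cst.
have := is_deriveM_fun fa IH; under eq_fun do rewrite -exprS.
by move/is_derive_eq; apply; case: n {IH} => [|n]; rewrite /= ?exprS; ring.
Qed.

Lemma is_derive_unique f p v (a b : R) :
  is_derive p v f a -> is_derive p v f b -> a = b.
Proof. by move=> [_ <-] [_ <-]. Qed.

Lemma is_derive_near f g p v (a : R) :
  (\forall x \near p, f x = g x) -> is_derive p v f a -> is_derive p v g a.
Proof. exact: near_eq_is_derive. Qed.

End Derivatives.

Lemma is_derive_slice1 {R : realType} (F : R * R -> R) (s t d : R) :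
  is_derive (s, t) (1, 0) F d <-> is_derive s 1 (fun x => F (x, t)) d.
Proof.
rewrite !(is_derive_line _ (s, t)) (is_derive_line _ s).
suff -> : (fun h : R => F (h *: (1, 0) + (s, t))) =
  (fun h : R => F (h *: (1 : R) + s, t)) by [].
by apply/funext => h; congr F; congr pair; rewrite /= scaler0 add0r.
Qed.

Lemma is_derive_slice2 {R : realType} (F : R * R -> R) (s t d : R) :
  is_derive (s, t) (0, 1) F d <-> is_derive t 1 (fun x => F (s, x)) d.
Proof.
rewrite !(is_derive_line _ (s, t)) (is_derive_line _ t).
suff -> : (fun h : R => F (h *: (0, 1) + (s, t))) =
  (fun h : R => F (s, h *: (1 : R) + t)) by [].
by apply/funext => h; congr F; congr pair; rewrite /= scaler0 add0r.
Qed.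

Section Smoothness.
Context {R : realType}.
Implicit Types (D : set (R * R)) (F G : R * R -> R) (U : set R) (f g : R -> R).

(* The partial derivatives are prescribed on [D] only; unlike [class_C], this is
   stable under algebraic operations even when [D] is not open. *)
Fixpoint pderiv n D F : Prop :=
  (forall p, D p -> {for p, continuous F}) /\
  if n is n'.+1 then exists F1 F2, [/\ forall p, D p ->
      is_derive p (1, 0) F (F1 p) /\ is_derive p (0, 1) F (F2 p),
      pderiv n' D F1 & pderiv n' D F2]
  else True.

(** In one variable derivability already gives continuity, which is why order 0 asks for nothing;
    partial derivatives do not give it, hence the continuity clause in [pderiv]. *)
Fixpoint nderiv n U f : Prop :=
  if n is n'.+1 then
    exists2 f', forall x, U x -> is_derive x 1 f (f' x) & nderiv n' U f'
  else True.

Lemma pderiv_continuous n D F : pderiv n D F ->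
  forall p, D p -> {for p, continuous F}.
Proof. by case: n => [|n] []. Qed.

Lemma pderivS n D F : pderiv n.+1 D F -> pderiv n D F.
Proof.
elim: n F => [|n IH] F [cF [F1 [F2 [dF F1n F2n]]]]; first by split; [exact: cF|].
split; first exact: cF.
by exists F1, F2; split; [exact: dF|exact: IH|exact: IH].
Qed.

Lemma pderiv_sub n D D' F : D' `<=` D -> pderiv n D F -> pderiv n D' F.
Proof.
move=> sD; elim: n F => [|n IH] F [cF dF]; (split; first by move=> p /sD; exact: cF).
  by [].
case: dF => F1 [F2 [dF F1n F2n]]; exists F1, F2.
by split; [move=> p /sD /dF|exact: IH|exact: IH].
Qed.

Lemma pderiv_cst n D a : pderiv n D (fun=> a).
Proof.
elim: n a => [|n IH] a; (split; first by move=> p _; exact: cst_continuous).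
  by [].
by exists (fun=> 0), (fun=> 0); split=> [p _||//]; [split; exact: is_derive_cst|].
Qed.

Lemma pderiv_fst n D : pderiv n D fst.
Proof.
case: n => [|n]; (split; first by move=> p _; exact: cvg_fst); first by [].
exists (fun=> 1), (fun=> 0); split; [|exact: pderiv_cst..].
move=> [s t] _; split.
  by apply/is_derive_slice1; exact: is_derive_id.
by apply/is_derive_slice2; exact: is_derive_cst.
Qed.

Lemma pderiv_snd n D : pderiv n D snd.
Proof.
case: n => [|n]; (split; first by move=> p _; exact: cvg_snd); first by [].
exists (fun=> 0), (fun=> 1); split; [|exact: pderiv_cst..].
move=> [s t] _; split.
  by apply/is_derive_slice1; exact: is_derive_cst.
by apply/is_derive_slice2; exact: is_derive_id.
Qed.

Lemma pderivD n D F G : pderiv n D F -> pderiv n D G ->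
  pderiv n D (fun p => F p + G p).
Proof.
elim: n F G => [|n IH] F G [cF dF] [cG dG];
  (split; first by move=> p Dp; apply: continuousD; [exact: cF|exact: cG]).
  by [].
case: dF dG => F1 [F2 [dF F1n F2n]] [G1 [G2 [dG G1n G2n]]].
exists (fun p => F1 p + G1 p), (fun p => F2 p + G2 p).
split; [|exact: IH|exact: IH] => p Dp.
have [[? ?] [? ?]] := (dF _ Dp, dG _ Dp).
by split; exact: is_deriveD_fun.
Qed.

Lemma pderivM n D F G : pderiv n D F -> pderiv n D G ->
  pderiv n D (fun p => F p * G p).
Proof.
elim: n F G => [|n IH] F G Fn Gn; (split; first by move=> p Dp; apply: continuousM;
  [exact: (pderiv_continuous Fn Dp)|exact: (pderiv_continuous Gn Dp)]).
  by [].
case: (Fn) (Gn) => _ [F1 [F2 [dF F1n F2n]]] [_ [G1 [G2 [dG G1n G2n]]]].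
exists (fun p => F1 p * G p + F p * G1 p), (fun p => F2 p * G p + F p * G2 p).
move/pderivS in Fn; move/pderivS in Gn.
split; [|by apply: pderivD; exact: IH..] => p Dp.
have [[? ?] [? ?]] := (dF _ Dp, dG _ Dp).
by split; exact: is_deriveM_fun.
Qed.

Lemma pderivN n D F : pderiv n D F -> pderiv n D (fun p => - F p).
Proof.
move=> Fn; under eq_fun do rewrite -mulN1r.
by apply: pderivM => //; exact: pderiv_cst.
Qed.

Lemma pderivB n D F G : pderiv n D F -> pderiv n D G ->
  pderiv n D (fun p => F p - G p).
Proof. by move=> Fn Gn; apply: pderivD => //; exact: pderivN. Qed.

Lemma pderivX n D F k : pderiv n D F -> pderiv n D (fun p => F p ^+ k).
Proof.
move=> Fn; elim: k => [|k IH]; first exact: pderiv_cst.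
by under eq_fun do rewrite exprS; exact: pderivM.
Qed.

Lemma pderivV n D F : (forall p, D p -> F p != 0) -> pderiv n D F ->
  pderiv n D (fun p => (F p)^-1).
Proof.
move=> F0; elim: n => [|n IH] Fn; (split; first by move=> p Dp; apply: continuousV;
  [exact: F0|exact: (pderiv_continuous Fn Dp)]).
  by [].
case: (Fn) => _ [F1 [F2 [dF F1n F2n]]].
exists (fun p => - F1 p * (F p)^-1 ^+ 2), (fun p => - F2 p * (F p)^-1 ^+ 2).
split; [|by apply: pderivM; [exact: pderivN|apply: pderivX; apply: IH; exact: pderivS]..].
by move=> p Dp; have [? ?] := dF _ Dp; split; apply: is_deriveV_fun => //; exact: F0.
Qed.

Lemma nderiv_derivable n U f : nderiv n.+1 U f ->
  forall x, U x -> derivable f x 1.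
Proof. by case=> f' df _ x /df []. Qed.

Lemma pderiv_comp n D f F : (forall k, nderiv k setT f) -> pderiv n D F ->
  pderiv n D (fun p => f (F p)).
Proof.
have cont (g : R -> R) p : nderiv 1 setT g -> {for p, continuous F} ->
    {for p, continuous (fun x => g (F x))}.
  move=> g1 cF; apply: continuous_comp => //.
  exact/differentiable_continuous/derivable1_diffP/(nderiv_derivable g1 I).
(* One derivative of [f] more than of [F] is carried along: [nderiv] yields continuity only through
   the next derivative. *)
move=> fk Fn; have := fk n.+1; elim: n f {fk} Fn => [|n IH] f Fn fn.
  by split=> [p Dp|//]; apply: cont => //; exact: (pderiv_continuous Fn Dp).
split=> [p Dp|].
  apply: cont; last exact: (pderiv_continuous Fn Dp).
  by case: fn => f' df _; exists f'.
case: fn => f' df f'n; case: (Fn) => _ [F1 [F2 [dF F1n F2n]]].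
have f'F := IH f' (pderivS Fn) f'n.
exists (fun p => f' (F p) * F1 p), (fun p => f' (F p) * F2 p).
split; [|exact: pderivM..] => p Dp; have [? ?] := dF _ Dp.
by split; apply: is_derive_compose => //; exact: df.
Qed.

Lemma pderiv_sqrt n D F : (forall p, D p -> 0 < F p) -> pderiv n D F ->
  pderiv n D (fun p => Num.sqrt (F p)).
Proof.
move=> F0; have c0 p : D p -> {for p, continuous F} ->
    {for p, continuous (fun p => Num.sqrt (F p))}.
  by move=> Dp cF; apply: continuous_comp => //; exact: sqrt_continuous.
elim: n => [|n IH] Fn;
  (split; first by move=> p Dp; apply: c0 => //; exact: (pderiv_continuous Fn Dp)).
  by [].
case: (Fn) => _ [F1 [F2 [dF F1n F2n]]].
exists (fun p => (2 * Num.sqrt (F p))^-1 * F1 p), (fun p => (2 * Num.sqrt (F p))^-1 * F2 p).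
split.
- move=> p Dp; have [? ?] := dF _ Dp.
  by split; apply: is_derive_compose => //; apply: is_derive1_sqrt; exact: F0.
- apply: pderivM => //; apply: pderivV => [p Dp|].
    by rewrite mulf_neq0// sqrtr_eq0 -ltNge F0.
  by apply: pderivM; [exact: pderiv_cst|apply: IH; exact: pderivS].
- apply: pderivM => //; apply: pderivV => [p Dp|].
    by rewrite mulf_neq0// sqrtr_eq0 -ltNge F0.
  by apply: pderivM; [exact: pderiv_cst|apply: IH; exact: pderivS].
Qed.

Lemma pderiv_ln n D F : (forall p, D p -> 0 < F p) -> pderiv n D F ->
  pderiv n D (fun p => ln (F p)).
Proof.
move=> F0 Fn; have c0 p : D p -> {for p, continuous (fun p => ln (F p))}.
  move=> Dp; apply: continuous_comp; first exact: (pderiv_continuous Fn Dp).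
  by apply: continuous_ln; exact: F0.
case: n Fn => [|n] Fn; (split; first exact: c0); first by [].
case: (Fn) => _ [F1 [F2 [dF F1n F2n]]].
have VF : pderiv n D (fun p => (F p)^-1).
  by apply: pderivV => [p /F0 /lt0r_neq0//|]; exact: pderivS.
exists (fun p => (F p)^-1 * F1 p), (fun p => (F p)^-1 * F2 p).
split; [|exact: pderivM..] => p Dp; have [? ?] := dF _ Dp.
by split; apply: is_derive_compose => //; apply: is_derive1_ln; exact: F0.
Qed.

Lemma pderiv_atan n D F : pderiv n D F -> pderiv n D (fun p => atan (F p)).
Proof.
move=> Fn; have c0 p : D p -> {for p, continuous (fun p => atan (F p))}.
  move=> Dp; apply: continuous_comp; first exact: (pderiv_continuous Fn Dp).
  exact: continuous_atan.
case: n Fn => [|n] Fn; (split; first exact: c0); first by [].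
case: (Fn) => _ [F1 [F2 [dF F1n F2n]]].
have VF : pderiv n D (fun p => (1 + F p ^+ 2)^-1).
  apply: pderivV => [p Dp|]; first by rewrite gt_eqF// ltr_wpDr// sqr_ge0.
  apply: pderivD; first exact: pderiv_cst.
  by apply: pderivX; exact: pderivS.
exists (fun p => (1 + F p ^+ 2)^-1 * F1 p), (fun p => (1 + F p ^+ 2)^-1 * F2 p).
split; [|exact: pderivM..] => p Dp; have [? ?] := dF _ Dp.
by split; apply: is_derive_compose => //; exact: is_derive1_atan.
Qed.

Lemma class_C_eq n D F G : open D -> {in D, F =1 G} -> class_C n D F -> class_C n D G.
Proof.
have FGn (H K : R * R -> R) : open D -> {in D, H =1 K} -> forall p, D p ->
    \forall x \near p, H x = K x.
  move=> oD HK p Dp; apply: filterS (open_nbhs_nbhs (conj oD Dp)) => x Dx.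
  by apply: HK; rewrite inE.
move=> oD; elim: n F G => [|n IH] F G FG /= Fn.
  move=> p Dp; have := Fn _ Dp; rewrite /prop_for /continuous_at => cF.
  rewrite -(FG p) ?inE//; apply: cvg_trans cF; apply: near_eq_cvg.
  exact: FGn.
case: Fn => dF F1 F2; split.
- move=> p Dp; have [d1 d2] := dF _ Dp.
  by split; [apply: near_eq_derivable d1|apply: near_eq_derivable d2]; exact: FGn.
- apply: IH F1 => p; rewrite inE => Dp; apply: near_eq_derive; exact: FGn.
- apply: IH F2 => p; rewrite inE => Dp; apply: near_eq_derive; exact: FGn.
Qed.

Lemma pderiv_class_C n D F : open D -> pderiv n D F -> class_C n D F.
Proof.
move=> oD; elim: n F => [|n IH] F [cF dF]; first exact: cF.
case: dF => F1 [F2 [dF F1n F2n]]; split.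
- by move=> p /dF [[? _] [? _]].
- apply: (class_C_eq oD _ (IH _ F1n)) => p; rewrite inE => /dF [[_ +] _].
  by move=> ->.
- apply: (class_C_eq oD _ (IH _ F2n)) => p; rewrite inE => /dF [_ [_ +]].
  by move=> ->.
Qed.

(** [class_C] at a positive order does not state continuity of the function itself, so all orders
    are taken at once and continuity comes from order 0. *)
Lemma class_C_pderiv D F : (forall n, class_C n D F) -> forall n, pderiv n D F.
Proof.
move=> Fn n; elim: n F Fn => [|n IH] F Fn; first by split=> //; exact: (Fn 0%N).
split; first exact: (Fn 0%N).
exists ('D_(1, 0) F), ('D_(0, 1) F); split.
- move=> p Dp; have [/(_ _ Dp)[d1 d2] _ _] := Fn 1%N.
  by split; exact: derivableP.
- by apply: IH => k; have [] := Fn k.+1.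
- by apply: IH => k; have [] := Fn k.+1.
Qed.

End Smoothness.

Section IsDeriveEps.
Context {R : realType}.
Implicit Types (f : R -> R) (x d : R).

(** The estimate without division also covers [h = 0] and can be multiplied by powers of the
    increment, as the Hadamard quotient requires. *)
Lemma is_derive_eps f x d :
  (forall e, 0 < e -> exists2 r, 0 < r & forall h, `|h| < r ->
     `|f (x + h) - f x - h * d| <= e * `|h|) -> is_derive x 1 f d.
Proof.
move=> H; suff cv : (h^-1 *: (f (h *: 1 + x) - f x) @[h --> 0^']) --> d.
  by apply: DeriveDef; [apply/cvg_ex; exists d|exact/cvg_lim].
apply/cvgrPdist_le => e e0; have [r r0 Hr] := H _ e0.
exists r => //= h /=; rewrite sub0r normrN => hr h0.
have := Hr _ hr; rewrite -ler_pdivrMr ?normr_gt0// -normf_div.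
rewrite distrC [_%:A]mulr1 (addrC h) /GRing.scale /=.
suff -> : (f (x + h) - f x - h * d) / h = h^-1 * (f (x + h) - f x) - d by [].
by field.
Qed.

Lemma eps_is_derive f x d : is_derive x 1 f d ->
  forall e, 0 < e -> exists2 r, 0 < r & forall h, `|h| < r ->
     `|f (x + h) - f x - h * d| <= e * `|h|.
Proof.
move=> [df <-] e e0; have /cvgrPdist_le /(_ _ e0) [r /= r0 Hr] := df.
exists r => // h hr; have [->|h0] := eqVneq h 0.
  by rewrite addr0 subrr mul0r subrr normr0 mulr0.
have := Hr h; rewrite /= sub0r normrN => /(_ hr h0).
rewrite distrC [_%:A]mulr1 (addrC h) /GRing.scale /=.
rewrite -ler_pdivrMr ?normr_gt0// -normf_div; congr (`|_| <= _).
by rewrite /derive /=; field.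
Qed.

End IsDeriveEps.

Section SmoothnessOnTheLine.
Context {R : realType}.
Implicit Types (U : set R) (f g : R -> R).

Lemma nderivS n U f : nderiv n.+1 U f -> nderiv n U f.
Proof. by elim: n f => //= n IH f [f' df /IH f'n]; exists f'. Qed.

Lemma nderiv_sub n U U' f : U' `<=` U -> nderiv n U f -> nderiv n U' f.
Proof.
move=> sU; elim: n f => //= n IH f [f' df /IH f'n].
by exists f' => // x /sU /df.
Qed.

Lemma nderiv_cst n U a : nderiv n U (fun=> a).
Proof. by elim: n a => //= n IH a; exists (fun=> 0) => // x _; exact: is_derive_cst. Qed.

Lemma nderivD n U f g : nderiv n U f -> nderiv n U g -> nderiv n U (fun x => f x + g x).
Proof.
elim: n f g => //= n IH f g [f' df f'n] [g' dg g'n].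
exists (fun x => f' x + g' x); last exact: IH.
by move=> x Ux; apply: is_deriveD_fun; [exact: df|exact: dg].
Qed.

Lemma nderivM n U f g : nderiv n U f -> nderiv n U g -> nderiv n U (fun x => f x * g x).
Proof.
elim: n f g => //= n IH f g fn gn; case: (fn) (gn) => f' df f'n [g' dg g'n].
exists (fun x => f' x * g x + f x * g' x).
  by move=> x Ux; apply: is_deriveM_fun; [exact: df|exact: dg].
by apply: nderivD; apply: IH => //; exact: nderivS.
Qed.

Lemma nderivN n U f : nderiv n U f -> nderiv n U (fun x => - f x).
Proof.
move=> fn; under eq_fun do rewrite -mulN1r.
by apply: nderivM => //; exact: nderiv_cst.
Qed.

Lemma nderivB n U f g : nderiv n U f -> nderiv n U g -> nderiv n U (fun x => f x - g x).
Proof. by move=> fn gn; apply: nderivD => //; exact: nderivN. Qed.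

Lemma nderivX n U f k : nderiv n U f -> nderiv n U (fun x => f x ^+ k).
Proof.
move=> fn; elim: k => [|k IH]; first exact: nderiv_cst.
by under eq_fun do rewrite exprS; exact: nderivM.
Qed.

Lemma nderivV n U f : (forall x, U x -> f x != 0) -> nderiv n U f ->
  nderiv n U (fun x => (f x)^-1).
Proof.
move=> f0; elim: n => //= n IH fn; case: (fn) => f' df f'n.
exists (fun x => - f' x * (f x)^-1 ^+ 2).
  by move=> x Ux; apply: is_deriveV_fun; [exact: f0|exact: df].
by apply: nderivM; [exact: nderivN|apply: nderivX; apply: IH; exact: (nderivS fn)].
Qed.

Lemma is_derive_affine (a b x : R) : is_derive x (1 : R) (fun t => a * t + b) a.
Proof.
have := is_deriveD_fun (is_deriveM_fun (is_derive_cst a x 1) (is_derive_id x 1))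
  (is_derive_cst b x 1).
by rewrite mul0r add0r mulr1 addr0.
Qed.

Lemma nderiv_sin_cos n U (a b : R) :
  nderiv n U (fun t => sin (a * t + b)) /\ nderiv n U (fun t => cos (a * t + b)).
Proof.
elim: n => //= n [IHs IHc]; split.
- exists (fun t => cos (a * t + b) * a); last by apply: nderivM => //; exact: nderiv_cst.
  by move=> x _; exact: is_derive_compose (is_derive_sin _) (is_derive_affine _ _ _).
- exists (fun t => - sin (a * t + b) * a); last first.
    by apply: nderivM; [exact: nderivN|exact: nderiv_cst].
  by move=> x _; exact: is_derive_compose (is_derive_cos _) (is_derive_affine _ _ _).
Qed.

Lemma nderiv_eq n U f g : open U -> {in U, f =1 g} -> nderiv n U f -> nderiv n U g.
Proof.
move=> oU fg; case: n => //= n [f' df f'n]; exists f' => // x Ux.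
apply: is_derive_near (df _ Ux); apply: filterS (open_nbhs_nbhs (conj oU Ux)) => y Uy.
by apply: fg; rewrite inE.
Qed.

Lemma nderiv_derive1 n U f : open U -> nderiv n.+1 U f -> nderiv n U (derive1 f).
Proof.
move=> oU [f' df]; apply: nderiv_eq => // x; rewrite inE => /df [_ <-].
by rewrite derive1E.
Qed.

Lemma nderiv_is_derive n f (x : R) : nderiv n.+1 setT f -> is_derive x 1 f ((derive1 f) x).
Proof. by case=> f' df _; rewrite derive1E; apply: derivableP; case: (df x I). Qed.

Lemma derivable_derive1n n U f (x : R) : open U -> U x -> nderiv n.+1 U f ->
  derivable (derive1n n f) x 1.
Proof.
move=> oU; elim: n f x => [|n IH] f x Ux fn.
  by case: fn => f' /(_ _ Ux) [].
by rewrite derive1Sn; apply: IH => //; exact: nderiv_derive1.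
Qed.

Lemma derive1n_nderiv f : (forall n x, derivable (derive1n n f) x 1) ->
  forall n, nderiv n setT f.
Proof.
move=> df n; rewrite -[f]derive1n0; move: 0%N => k; elim: n k => //= n IH k.
exists (derive1n k.+1 f); last exact: IH.
by move=> x _; rewrite derive1nS derive1E; exact/derivableP/df.
Qed.

(** Derivatives chosen on different neighbourhoods need no gluing, because each of them agrees with
    [derive1n]. *)
Lemma nderiv_local f :
  (forall x, exists U, [/\ open U, U x & forall n, nderiv n U f]) ->
  forall n, nderiv n setT f.
Proof.
move=> loc; apply: derive1n_nderiv => n x; have [U [oU Ux fU]] := loc x.
exact: derivable_derive1n (fU _).
Qed.

Lemma mvt_le f f' (x h M : R) : (forall y : R, is_derive y 1 f (f' y)) ->
  (forall y, `|y - x| <= `|h| -> `|f' y| <= M) -> `|f (x + h) - f x| <= M * `|h|.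
Proof.
move=> df bf; have cf a b : {within `[a, b], continuous f}.
  apply: continuous_subspaceT => y; apply/differentiable_continuous/derivable1_diffP.
  by case: (df y).
have [h0|h0] := leP 0 h.
  have [|c] := MVT_segment _ (fun y _ => df y) (cf x (x + h)); first by rewrite lerDl.
  rewrite in_itv /= => /andP[c1 c2]; have -> : x + h - x = h by ring.
  move=> ->; rewrite normrM ler_wpM2r// bf// !ger0_norm// ?subr_ge0//.
  by rewrite lerBlDl.
have [|c] := MVT_segment _ (fun y _ => df y) (cf (x + h) x); first by rewrite gerDl ltW.
rewrite in_itv /= => /andP[c1 c2]; have -> : x - (x + h) = - h by ring.
move=> e.
rewrite distrC e normrM normrN ler_wpM2r// bf//.
rewrite ler0_norm ?subr_le0// ltr0_norm// opprB lerBlDl -lerBlDr opprK; exact: c1.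
Qed.

End SmoothnessOnTheLine.

(** * Dividing a smooth function by x - z at a zero z *)

Section HadamardQuotient.
Context {R : realType}.
Variables (g : R -> R) (z : R).
Hypotheses (g_smooth : forall n, nderiv n setT g) (gz : g z = 0).

Let dg k (x : R) : is_derive x 1 (derive1n k g) ((derive1n k.+1 g) x).
Proof.
rewrite derive1nS derive1E; apply: derivableP.
by apply: (derivable_derive1n openT) => //; exact: g_smooth.
Qed.

(* (x - z)^(n+1) times the n-th derivative of g x / (x - z). *)
Fixpoint quot_num n (x : R) : R :=
  if n is n'.+1 then (x - z) ^+ n * (derive1n n g) x - n%:R * quot_num n' x else g x.

(** The value at [z] is that of the n-th derivative of the integral of g' (z + u (x - z)) over u in
    [0, 1], namely the integral of u^n times g^(n+1) (z). *)
Definition quot_deriv n (x : R) : R :=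
  if x == z then (derive1n n.+1 g) z / n.+1%:R else quot_num n x / (x - z) ^+ n.+1.

Let dX n (x : R) : is_derive x 1 (fun x : R => (x - z) ^+ n) (n%:R * (x - z) ^+ n.-1).
Proof.
have := is_deriveX_fun n (is_deriveD_fun (is_derive_id x 1) (is_derive_cst (- z) x 1)).
by rewrite addr0 mulr1.
Qed.

(** The lower derivatives of [g] cancel telescopically, so the derivative of the numerator is a
    single term vanishing at [z] to order at least n. *)
Let dnum n (x : R) : is_derive x 1 (quot_num n) ((x - z) ^+ n * (derive1n n.+1 g) x).
Proof.
elim: n => [|n IH] /=; first by rewrite expr0 mul1r; exact: (dg 0).
have e1 := is_deriveM_fun (dX n.+1 x) (dg n.+1 x).
have e2 := is_deriveM_fun (is_derive_cst (n.+1%:R : R) x 1) IH.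
have := is_deriveD_fun e1 (is_deriveN_fun e2).
by move/is_derive_eq; apply; rewrite /=; ring.
Qed.

Let numz n : quot_num n z = 0.
Proof. by elim: n => [|n IH] //=; rewrite IH subrr expr0n mul0r mulr0 subr0. Qed.

Let dquot n (x : R) : is_derive x 1 (quot_deriv n) (quot_deriv n.+1 x).
Proof.
have [->|xz] := eqVneq x z; last first.
  have x0 : x - z != 0 by rewrite subr_eq0.
  rewrite {2}/quot_deriv (negbTE xz).
  apply: (@is_derive_near _ _ (fun x => quot_num n x * ((x - z) ^+ n.+1)^-1)).
    exists `|x - z|; rewrite /= ?normr_gt0// => y /= xy.
    by rewrite /quot_deriv; case: eqP => // yz; move: xy; rewrite yz ltxx.
  apply: is_derive_eq.
    apply: is_deriveM_fun (dnum n x) _; apply: is_deriveV_fun (dX n.+1 x).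
    by rewrite expf_neq0.
  by rewrite /= !exprS; field; rewrite x0 expf_neq0.
apply: is_derive_eps => e e0.
have [r r0 Hr] := eps_is_derive (dg n.+1 z) e0.
exists r => // h hr; have [->|h0] := eqVneq h 0.
  by rewrite addr0 subrr mul0r subrr normr0 mulr0.
pose a := (derive1n n.+1 g) z; pose b := (derive1n n.+2 g) z.
(* [rem] is the numerator minus its Taylor polynomial of degree n + 2 at [z]. Its derivative is (x -
   z)^n times the first-order error of g^(n+1), so the mean value inequality gives |rem| <= e
   |h|^(n+2), and division by |h|^(n+1) leaves the claim. *)
pose rem (x : R) := quot_num n x - (a / n.+1%:R * (x - z) ^+ n.+1
                            + b / n.+2%:R * (x - z) ^+ n.+2).
pose rem' (x : R) := (x - z) ^+ n * ((derive1n n.+1 g) x - a - (x - z) * b).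
have drem (y : R) : is_derive y 1 rem (rem' y).
  have e1 := is_deriveM_fun (is_derive_cst (a / n.+1%:R : R) y 1) (dX n.+1 y).
  have e2 := is_deriveM_fun (is_derive_cst (b / n.+2%:R : R) y 1) (dX n.+2 y).
  have := is_deriveD_fun (dnum n y) (is_deriveN_fun (is_deriveD_fun e1 e2)).
  move/is_derive_eq; apply; rewrite /rem' /= !exprS; field.
  by rewrite -!natr1; apply/andP; split; rewrite gt_eqF// ?addr_gt0.
have rem'le y : `|y - z| <= `|h| -> `|rem' y| <= e * `|h| ^+ n.+1.
  move=> yh; have := Hr (y - z); have -> : z + (y - z) = y by ring.
  move=> /(_ (le_lt_trans yh hr)) H.
  rewrite /rem' normrM normrX exprSr mulrCA.
  apply: ler_pM => //; first by rewrite lerXn2r ?nnegrE.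
  by apply: (le_trans H); rewrite ler_wpM2l// ltW.
have := mvt_le drem rem'le; rewrite {2}/rem subrr !expr0n numz !mulr0 addr0 !subr0.
have zh : z + h - z = h by ring.
have zhz : (z + h == z) = false by rewrite -subr_eq0 zh; exact: negbTE.
rewrite /rem zh /quot_deriv eqxx zhz zh => H.
rewrite -(@ler_pM2r _ (`|h| ^+ n.+1)) ?exprn_gt0 ?normr_gt0//.
rewrite -normrX -normrM; move: H; rewrite -!normrX -mulrA -(mulrC `|h|) mulrA.
rewrite -/a -/b; have -> : `|h| * (e * `|h ^+ n.+1|) = e * `|h| * `|h ^+ n.+1| by ring.
congr (`|_| <= _).
rewrite !exprS; field.
by rewrite h0 expf_neq0//= -!natr1; apply/andP; split; rewrite gt_eqF// ?addr_gt0.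
Qed.

Lemma hadamard_quotient : exists q : R -> R,
  [/\ forall n, nderiv n setT q, q z = (derive1 g) z & forall x, g x = (x - z) * q x].
Proof.
exists (quot_deriv 0); split.
- move=> n; move: 0%N => k; elim: n k => //= n IH k.
  by exists (quot_deriv k.+1); [move=> x _; exact: dquot|exact: IH].
- by rewrite /quot_deriv eqxx derive1n1 divr1.
- move=> x; rewrite /quot_deriv /=; case: eqVneq => [->|xz]; first by rewrite gz subrr mul0r.
  by rewrite expr1 mulrC divfK// subr_eq0.
Qed.

End HadamardQuotient.

(** * Holomorphic functions on the strip *)

Section MaximumPrinciple.
Context {R : realType}.
Implicit Types (F G : R * R -> R).

Lemma is_derive_continuous (f : R -> R) (x d : R) :
  is_derive x 1 f d -> {for x, continuous f}.
Proof.
by case=> df _; exact/differentiable_continuous/derivable1_diffP.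
Qed.

(** A positive [d] would make [f'] positive just to the right of [c], and the mean value theorem
    would push [f] above its maximum. *)
Lemma second_derive_max (f f' : R -> R) (a b c d : R) : a < c < b ->
  (forall x : R, a < x < b -> is_derive x 1 f (f' x)) -> is_derive c 1 f' d ->
  (forall x, a < x < b -> f x <= f c) -> d <= 0.
Proof.
move=> /andP[ac cb] df d2f fmax; have cab : a < c < b by rewrite ac.
have f'c : f' c = 0.
  apply: is_derive_unique (df c cab) _; apply: (@derive1_at_max _ f a b c).
  - exact: ltW (lt_trans ac cb).
  - by move=> t; rewrite in_itv /= => /df [].
  - by rewrite in_itv.
  - by move=> t; rewrite in_itv /= => /fmax.
rewrite leNgt; apply/negP => d0.
have d20 : 0 < d / 2 by rewrite divr_gt0.
have [r r0 Hr] := eps_is_derive d2f d20.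
pose h := Num.min (r / 2) ((b - c) / 2).
have h0 : 0 < h by rewrite lt_min !divr_gt0// subr_gt0.
have hr : h < r by rewrite gt_min; apply/orP; left; lra.
have hb : c + h < b.
  have : h <= (b - c) / 2 by rewrite ge_min lexx orbT.
  by move: cb; lra.
have cch : c < c + h by rewrite ltrDl.
have [||x] := MVT cch (f := f) (df := f').
- move=> x; rewrite in_itv /= => /andP[cx xh].
  by apply: df; rewrite (lt_trans ac cx) (lt_trans xh hb).
- apply: continuous_in_subspaceT => x; rewrite inE /= in_itv /= => /andP[cx xh].
  apply: is_derive_continuous (df x _).
  by rewrite (lt_le_trans ac cx) (le_lt_trans xh hb).
rewrite in_itv /= => /andP[cx xh] e.
have : f (c + h) <= f c by apply: fmax; rewrite (lt_trans ac cch).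
rewrite -subr_le0 e pmulr_lle0; last by move: cch; lra.
have := Hr (x - c); rewrite f'c subr0 (_ : c + (x - c) = x); last by ring.
have xc0 : 0 < x - c by rewrite subr_gt0.
rewrite (gtr0_norm xc0) => /(_ _)/wrap[]; first by move: xh hr; lra.
by rewrite ler_norml => /andP[+ _] ?; nra.
Qed.

Definition has_laplacian (W : set (R * R)) F (L : R * R -> R) : Prop :=
  exists F1 F2 F11 F22, forall p, W p ->
    [/\ is_derive p (1, 0) F (F1 p), is_derive p (0, 1) F (F2 p),
        is_derive p (1, 0) F1 (F11 p), is_derive p (0, 1) F2 (F22 p)
      & F11 p + F22 p = L p].

Lemma has_laplacian_eq W F L L' : {in W, L =1 L'} ->
  has_laplacian W F L -> has_laplacian W F L'.
Proof.
move=> LL' [F1 [F2 [F11 [F22 H]]]]; exists F1, F2, F11, F22 => p Wp.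
by have [? ? ? ? e] := H p Wp; split => //; rewrite e; apply: LL'; rewrite inE.
Qed.

Lemma has_laplacianD W F G L M : has_laplacian W F L -> has_laplacian W G M ->
  has_laplacian W (fun p => F p + G p) (fun p => L p + M p).
Proof.
move=> [F1 [F2 [F11 [F22 HF]]]] [G1 [G2 [G11 [G22 HG]]]].
exists (fun p => F1 p + G1 p), (fun p => F2 p + G2 p),
  (fun p => F11 p + G11 p), (fun p => F22 p + G22 p) => p Wp.
have [? ? ? ? <-] := HF p Wp; have [? ? ? ? <-] := HG p Wp.
by split; [exact: is_deriveD_fun..|rewrite addrACA].
Qed.

Lemma has_laplacian_cst W a : has_laplacian W (fun=> a) (fun=> 0).
Proof.
exists (fun=> 0), (fun=> 0), (fun=> 0), (fun=> 0) => p Wp.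
by split; [exact: is_derive_cst..|rewrite addr0].
Qed.

Lemma has_laplacianZ W a F L : has_laplacian W F L ->
  has_laplacian W (fun p => a * F p) (fun p => a * L p).
Proof.
move=> [F1 [F2 [F11 [F22 HF]]]].
have Z p v G b : is_derive p v G b -> is_derive p v (fun p => a * G p : R) (a * b).
  move=> dG; have := is_deriveM_fun (is_derive_cst a p v) dG.
  by rewrite mul0r add0r.
exists (fun p => a * F1 p), (fun p => a * F2 p),
  (fun p => a * F11 p), (fun p => a * F22 p) => p Wp.
have [? ? ? ? <-] := HF p Wp.
by split; [exact: Z..|rewrite mulrDr].
Qed.

(** The Laplacian of F^2 is twice the squared gradient, so the squared modulus of a holomorphic
    function is subharmonic. *)
Lemma has_laplacian_sqr W F : has_laplacian W F (fun=> 0) ->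
  exists2 L, has_laplacian W (fun p => F p ^+ 2) L & forall p, 0 <= L p.
Proof.
move=> [F1 [F2 [F11 [F22 HF]]]].
exists (fun p => 2 * (F1 p ^+ 2 + F2 p ^+ 2)); last first.
  by move=> p; rewrite mulr_ge0// addr_ge0// sqr_ge0.
exists (fun p => 2%:R * F p ^+ 1 * F1 p), (fun p => 2%:R * F p ^+ 1 * F2 p),
  (fun p => (0 * F p ^+ 1 + 2%:R * (1%:R * F p ^+ 0 * F1 p)) * F1 p
           + 2%:R * F p ^+ 1 * F11 p),
  (fun p => (0 * F p ^+ 1 + 2%:R * (1%:R * F p ^+ 0 * F2 p)) * F2 p
           + 2%:R * F p ^+ 1 * F22 p) => p Wp.
have [dF1 dF2 dF11 dF22 e] := HF p Wp.
split; [exact: is_deriveX_fun..| | |].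
- exact: is_deriveM_fun (is_deriveM_fun (is_derive_cst _ _ _) (is_deriveX_fun 1 dF1)) dF11.
- exact: is_deriveM_fun (is_deriveM_fun (is_derive_cst _ _ _) (is_deriveX_fun 1 dF2)) dF22.
- have -> : F22 p = - F11 p by apply: (addrI (F11 p)); rewrite e subrr.
  by ring.
Qed.

(** With a^2 = b^2 these functions are harmonic and serve as barriers on the strip. *)
Lemma has_laplacian_expR_cos W (a b c : R) :
  has_laplacian W (fun p => expR (a * p.1) * cos (b * p.2 + c))
    (fun p => (a ^+ 2 - b ^+ 2) * (expR (a * p.1) * cos (b * p.2 + c))).
Proof.
have dE (s : R) : is_derive s 1 (fun s => expR (a * s)) (a * expR (a * s)).
  have := is_derive_compose (is_derive_expR _) (is_derive_affine a 0 s).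
  by under eq_fun do rewrite addr0; rewrite addr0 mulrC.
have dC (t : R) : is_derive t 1 (fun t => cos (b * t + c)) (- b * sin (b * t + c)).
  have := is_derive_compose (is_derive_cos _) (is_derive_affine b c t).
  by move/is_derive_eq; apply; ring.
have dS (t : R) : is_derive t 1 (fun t => sin (b * t + c)) (b * cos (b * t + c)).
  have := is_derive_compose (is_derive_sin _) (is_derive_affine b c t).
  by move/is_derive_eq; apply; ring.
have cM (k f f' x : R) (g : R -> R) : is_derive x 1 g f -> f' = k * f ->
    is_derive x 1 (fun x => k * g x) f'.
  move=> dg ->; have := is_deriveM_fun (is_derive_cst k x 1) dg.
  by rewrite mul0r add0r.
exists (fun p => a * (cos (b * p.2 + c) * expR (a * p.1))),
  (fun p => (- b * expR (a * p.1)) * sin (b * p.2 + c)),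
  (fun p => a * (cos (b * p.2 + c) * (a * expR (a * p.1)))),
  (fun p => (- b * expR (a * p.1)) * (b * cos (b * p.2 + c))) => -[s t] _ /=.
split.
- apply/is_derive_slice1 => /=; under eq_fun do rewrite mulrC.
  by apply: (cM _ _) (dE s) _; ring.
- apply/is_derive_slice2 => /=.
  by apply: (cM _ _) (dC t) _; ring.
- apply/is_derive_slice1 => /=; under eq_fun do rewrite mulrA.
  by apply: (cM _ _) (dE s) _; ring.
- apply/is_derive_slice2 => /=.
  by apply: (cM _ _) (dS t) _; ring.
- by ring.
Qed.

Lemma rectangle_max F L (s1 s2 t1 t2 : R) :
  has_laplacian [set p | s1 < p.1 < s2 /\ t1 < p.2 < t2] F L ->
  (forall p, s1 < p.1 < s2 /\ t1 < p.2 < t2 -> 0 <= L p) ->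
  (forall s t, s1 <= s <= s2 -> t1 <= t <= t2 -> {for (s, t), continuous F}) ->
  (forall s t, s1 <= s <= s2 -> t1 <= t <= t2 ->
     [\/ s = s1, s = s2, t = t1 | t = t2] -> F (s, t) <= 0) ->
  forall s t, s1 <= s <= s2 -> t1 <= t <= t2 -> F (s, t) <= 0.
Proof.
move=> [F1 [F2 [F11 [F22 HF]]]] L0 cF bF s0 t0 hs0 ht0.
rewrite leNgt; apply/negP => F0.
(* Adding [e * (t - t1)^2] raises the Laplacian by 2 e > 0, so an interior maximum contradicts the
   second derivative test; [M] makes [e] so small that on the boundary the sum stays below F (s0,
   t0). *)
pose M := 1 + (t2 - t1) ^+ 2.
have M0 : 0 < M by rewrite ltr_pwDl// sqr_ge0.
pose e := F (s0, t0) / M; have e0 : 0 < e by rewrite divr_gt0.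
have eM : e * (t2 - t1) ^+ 2 < F (s0, t0).
  by rewrite -[ltRHS](divfK (lt0r_neq0 M0)) ltr_pM2l// /M; lra.
pose G (p : R * R) := F p + e * (p.2 - t1) ^+ 2.
have cG s t : s1 <= s <= s2 -> t1 <= t <= t2 -> {for (s, t), continuous G}.
  move=> hs ht; apply: continuousD; first exact: cF.
  apply: continuousM; first exact: cst_continuous.
  apply: (@continuous_comp _ _ _ (fun p : R * R => p.2 - t1) (fun x => x ^+ 2)).
    by apply: continuousB; [exact: cvg_snd|exact: cst_continuous].
  exact: exprn_continuous.
pose A := `[s1, s2]%classic `*` `[t1, t2]%classic.
have A0 : A (s0, t0) by split; rewrite /= in_itv.
have cA : compact A by apply: compact_setX; exact: segment_compact.
have cGA : {within A, continuous G}.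
  apply: continuous_in_subspaceT => -[s t]; rewrite inE => -[].
  by rewrite /= !in_itv; exact: cG.
have [[s t] ] := compact_EVT_max (ex_intro _ _ A0) cA cGA.
rewrite inE => -[]; rewrite /= !in_itv => /= hs ht Gmax.
have Gle x y : s1 <= x <= s2 -> t1 <= y <= t2 -> G (x, y) <= G (s, t).
  by move=> hx hy; apply: Gmax; rewrite inE; split; rewrite /= in_itv.
have G0 : F (s0, t0) <= G (s, t).
  apply: le_trans (Gle _ _ hs0 ht0).
  by rewrite /G lerDl mulr_ge0// ?sqr_ge0// ltW.
have Gb : [\/ s = s1, s = s2, t = t1 | t = t2] -> False.
  move=> /(bF s t hs ht) Fb; have : G (s, t) <= e * (t2 - t1) ^+ 2.
    rewrite /G /= -[leRHS]add0r lerD// ler_pM2l// lerXn2r ?nnegrE//; lra.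
  by move: G0 eM; lra.
have s1s : s1 < s by rewrite lt_neqAle (andP hs).1 andbT; apply/eqP => e1; apply: Gb; constructor 1.
have ss2 : s < s2 by rewrite lt_neqAle (andP hs).2 andbT; apply/eqP => e1; apply: Gb; constructor 2.
have t1t : t1 < t by rewrite lt_neqAle (andP ht).1 andbT; apply/eqP => e1; apply: Gb; constructor 3.
have tt2 : t < t2 by rewrite lt_neqAle (andP ht).2 andbT; apply/eqP => e1; apply: Gb; constructor 4.
have inW x y : s1 < x < s2 -> t1 < y < t2 ->
  [set p | s1 < p.1 < s2 /\ t1 < p.2 < t2] (x, y) by [].
have hs' : s1 < s < s2 by rewrite s1s.
have ht' : t1 < t < t2 by rewrite t1t.
have [_ _ d11 d22 e2] := HF (s, t) (inW _ _ hs' ht').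
have n11 : F11 (s, t) <= 0.
  apply: (@second_derive_max (fun x => F (x, t)) (fun x => F1 (x, t)) s1 s2 s) => //.
  - by move=> x hx; apply/is_derive_slice1; have [] := HF (x, t) (inW _ _ hx ht').
  - exact/is_derive_slice1.
  - move=> x /andP[x1 x2]; have := Gle x t; rewrite (ltW x1) (ltW x2) (andP ht).1 (andP ht).2 => /(_ isT isT).
    by rewrite /G /= lerD2r.
have n22 : F22 (s, t) + e * 2 <= 0.
  apply: (@second_derive_max (fun y => G (s, y))
    (fun y => F2 (s, y) + (0 * (y - t1) ^+ 2 + e * (2%:R * (y - t1) ^+ 1 * (1 + 0)))) t1 t2 t) => //.
  - move=> y hy; have [_ /is_derive_slice2 d2 _ _ _] := HF (s, y) (inW _ _ hs' hy).
    apply: is_deriveD_fun d2 _; apply: is_deriveM_fun (is_derive_cst _ _ _) _.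
    exact: is_deriveX_fun (is_deriveD_fun (is_derive_id _ _) (is_derive_cst _ _ _)).
  - move/is_derive_slice2: d22 => d22; apply: is_deriveD_fun d22 _.
    have := is_derive_affine (e * 2) (- (e * 2 * t1)) t.
    apply: is_derive_near; exists 1 => //= y _; ring.
  - by move=> x /andP[x1 x2]; apply: Gle => //; rewrite (ltW x1) (ltW x2).
have := L0 (s, t) (inW _ _ hs' ht'); rewrite -e2; lra.
Qed.

End MaximumPrinciple.

(** * Harmonic and holomorphic functions on the closed strip *)

Section HolomorphicOnStrip.
Context {R : realType}.
Implicit Types (F G V : R * R -> R).

Definition cstrip : set (R * R) := [set p | 0 <= p.2 <= 1].
Definition ostrip : set (R * R) := [set p | 0 < p.2 < 1].

Lemma ostrip_cstrip p : ostrip p -> cstrip p.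
Proof. by move=> /andP[a b]; rewrite /cstrip /= (ltW a) (ltW b). Qed.

Lemma open_strip (a b : R) : open [set p : R * R | a < p.2 < b].
Proof.
rewrite (_ : mkset _ = [set p | a < p.2] `&` [set p | p.2 < b]); last first.
  by apply/seteqP; split => p /= => /andP.
apply: openI.
  apply: (@open_comp _ _ (snd : R * R -> R) [set x | a < x]); last exact: open_gt.
  by move=> x _; exact: cvg_snd.
apply: (@open_comp _ _ (snd : R * R -> R) [set x | x < b]); last exact: open_lt.
by move=> x _; exact: cvg_snd.
Qed.

Lemma mean_value_step (f f' : R -> R) (a h : R) : 0 < h ->
  (forall x : R, a <= x <= a + h -> is_derive x 1 f (f' x)) ->
  exists2 c, a < c < a + h & f (a + h) - f a = h * f' c.
Proof.
move=> h0 df; have ah : a < a + h by rewrite ltrDl.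
have [||c] := MVT ah (f := f) (df := f').
- by move=> x; rewrite in_itv /= => /andP[x1 x2]; apply: df; rewrite !ltW.
- apply: continuous_in_subspaceT => x; rewrite inE /= in_itv /= => hx.
  exact: is_derive_continuous (df x hx).
rewrite in_itv /= => hc e; exists c => //.
by rewrite e mulrC; congr (_ * _); ring.
Qed.

(** By the mean value theorem in the two orders, the second difference over a small square of side h
    equals h^2 times [F12] at one point of the square and h^2 times [F21] at another. *)
Lemma mixed_partials F F1 F2 F12 F21 (s t r : R) : 0 < r ->
  (forall x y, s - r < x < s + r -> t - r < y < t + r ->
    [/\ is_derive (x, y) (1, 0) F (F1 (x, y)), is_derive (x, y) (0, 1) F (F2 (x, y)),
        is_derive (x, y) (0, 1) F1 (F12 (x, y))
      & is_derive (x, y) (1, 0) F2 (F21 (x, y))]) ->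
  {for (s, t), continuous F12} -> {for (s, t), continuous F21} ->
  F12 (s, t) = F21 (s, t).
Proof.
move=> r0 dF c12 c21; apply/eqP; apply: contraT => ne.
pose e := `|F12 (s, t) - F21 (s, t)| / 2.
have e0 : 0 < e by rewrite divr_gt0// normr_gt0 subr_eq0.
have /cvgrPdist_lt /(_ _ e0) /nbhs_ballP[d1 /= d10 H1] := c12.
have /cvgrPdist_lt /(_ _ e0) /nbhs_ballP[d2 /= d20 H2] := c21.
pose h := Num.min (r / 2) (Num.min (d1 / 2) (d2 / 2)).
have h0 : 0 < h by rewrite !lt_min !divr_gt0.
have hr : h <= r / 2 by rewrite /h ge_min lexx.
have hd1 : h <= d1 / 2 by rewrite /h !ge_min lexx orbT.
have hd2 : h <= d2 / 2 by rewrite /h !ge_min lexx !orbT.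
have in_s x : s <= x <= s + h -> s - r < x < s + r by move=> /andP[]; lra.
have in_t y : t <= y <= t + h -> t - r < y < t + r by move=> /andP[]; lra.
have te : t <= t + h <= t + h by rewrite lexx lerDl ltW.
have se : s <= s + h <= s + h by rewrite lexx lerDl ltW.
have tt : t <= t <= t + h by rewrite lexx lerDl ltW.
have ss : s <= s <= s + h by rewrite lexx lerDl ltW.
have [x1 hx1 e1] := @mean_value_step (fun x => F (x, t + h) - F (x, t))
  (fun x => F1 (x, t + h) - F1 (x, t)) s h h0 (fun x hx =>
    let: And4 a _ _ _ := dF x (t + h) (in_s x hx) (in_t _ te) in
    let: And4 b _ _ _ := dF x t (in_s x hx) (in_t _ tt) in
    is_deriveD_fun ((is_derive_slice1 _ _ _ _).1 a)
      (is_deriveN_fun ((is_derive_slice1 _ _ _ _).1 b))).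
have hx1' : s <= x1 <= s + h by case/andP: hx1 => /ltW-> /ltW->.
have [y1 hy1 e2] := @mean_value_step (fun y => F1 (x1, y))
  (fun y => F12 (x1, y)) t h h0 (fun y hy =>
    let: And4 _ _ a _ := dF x1 y (in_s _ hx1') (in_t y hy) in
    (is_derive_slice2 _ _ _ _).1 a).
have [y2 hy2 e3] := @mean_value_step (fun y => F (s + h, y) - F (s, y))
  (fun y => F2 (s + h, y) - F2 (s, y)) t h h0 (fun y hy =>
    let: And4 _ a _ _ := dF (s + h) y (in_s _ se) (in_t y hy) in
    let: And4 _ b _ _ := dF s y (in_s _ ss) (in_t y hy) in
    is_deriveD_fun ((is_derive_slice2 _ _ _ _).1 a)
      (is_deriveN_fun ((is_derive_slice2 _ _ _ _).1 b))).
have hy2' : t <= y2 <= t + h by case/andP: hy2 => /ltW-> /ltW->.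
have [x2 hx2 e4] := @mean_value_step (fun x => F2 (x, y2))
  (fun x => F21 (x, y2)) s h h0 (fun x hx =>
    let: And4 _ _ _ a := dF x y2 (in_s _ hx) (in_t _ hy2') in
    (is_derive_slice1 _ _ _ _).1 a).
have E : F12 (x1, y1) = F21 (x2, y2).
  apply: (mulfI (lt0r_neq0 h0)); apply: (mulfI (lt0r_neq0 h0)).
  by rewrite -e2 -e4 -e1 -e3; ring.
have near x y d : s < x < s + h -> t < y < t + h -> h <= d / 2 -> ball (s, t) d (x, y).
  move=> /andP[xa xb] /andP[ya yb] hd.
  by clear - xa xb ya yb hd; split; rewrite /= -ball_normE /= ltr_norml; apply/andP; split; lra.
have := H1 _ (near _ _ _ hx1 hy1 hd1); have := H2 _ (near _ _ _ hx2 hy2 hd2).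
rewrite /= -E => a b; have : `|F12 (s, t) - F21 (s, t)| < e + e.
  have -> : F12 (s, t) - F21 (s, t) =
    (F12 (s, t) - F12 (x1, y1)) - (F21 (s, t) - F12 (x1, y1)) by ring.
  by apply: le_lt_trans (ler_normB _ _) _; exact: ltrD.
by rewrite /e; lra.
Qed.

Definition holomorphic F G : Prop :=
  [/\ pderiv 2 cstrip F, pderiv 2 cstrip G & forall p, cstrip p ->
     'D_(1, 0) F p = 'D_(0, 1) G p /\ 'D_(0, 1) F p = - 'D_(1, 0) G p].

(** Multiplication by - i; it transfers results about the real part to the imaginary part. *)
Lemma holomorphicN F G : holomorphic F G -> holomorphic G (fun p => - F p).
Proof.
move=> [pF pG CR]; split => //; first exact: pderivN.
move=> p cp; have [e1 e2] := CR p cp; have [_ [F1 [F2 [dF _ _]]]] := pF.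
have [d1 d2] := dF p cp.
have [_ ->] := is_deriveN_fun d1; have [_ ->] := is_deriveN_fun d2.
by case: d1 d2 => _ <- [_ <-]; rewrite e1 e2 !opprK.
Qed.

Lemma holomorphic_laplacian F G : holomorphic F G ->
  has_laplacian ostrip F (fun=> 0).
Proof.
move=> [[_ [F1 [F2 [dF [_ [F11 [F12 [dF1 _ _]]]] [_ [F21 [F22 [dF2 _ _]]]]]]]]
  [_ [G1 [G2 [dG [_ [G11 [G12 [dG1 _ pG12]]]] [_ [G21 [G22 [dG2 pG21 _]]]]]]]] CR].
exists F1, F2, F11, F22 => -[s t] st.
have cst := ostrip_cstrip st.
have [d1 d2] := dF _ cst; have [d11 _] := dF1 _ cst; have [_ d22] := dF2 _ cst.
split => //.
have nst : \forall p \near (s, t), ostrip p.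
  by apply: open_nbhs_nbhs; split; [exact: open_strip|exact: st].
have e1 : F11 (s, t) = G21 (s, t).
  apply: is_derive_unique (d11) _; have [dG21 _] := dG2 _ cst.
  apply: is_derive_near dG21; apply: filterS nst => p /ostrip_cstrip cp.
  have [[[_ a] _] [_ [_ b]]] := (dF _ cp, dG _ cp).
  by rewrite -a -b; case: (CR p cp).
have e2 : F22 (s, t) = - G12 (s, t).
  apply: is_derive_unique (d22) _; have [_ dG12] := dG1 _ cst.
  apply: is_derive_near (is_deriveN_fun dG12).
  apply: filterS nst => p /ostrip_cstrip cp.
  have [[_ [_ a]] [[_ b] _]] := (dF _ cp, dG _ cp).
  by rewrite -a -b; case: (CR p cp).
rewrite e1 e2; suff -> : G12 (s, t) = G21 (s, t) by rewrite subrr.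
pose r := Num.min t (1 - t).
have r0 : 0 < r by case/andP: st => a b; rewrite lt_min subr_gt0 a.
have rt : r <= t by rewrite ge_min lexx.
have rt1 : r <= 1 - t by rewrite ge_min lexx orbT.
apply: (@mixed_partials G G1 G2 _ _ s t r r0); last 2 first.
- exact: pG12.1.
- exact: pG21.1.
move=> x y _ /andP[y1 y2]; have cxy : cstrip (x, y) by rewrite /cstrip /=; lra.
by have [[? ?] [_ ?] [? _]] := And3 (dG _ cxy) (dG1 _ cxy) (dG2 _ cxy).
Qed.

Lemma phragmen_lindelof F (M : R) : has_laplacian ostrip F (fun=> 0) ->
  (forall p, cstrip p -> {for p, continuous F}) ->
  (forall p, cstrip p -> F p <= M) ->
  (forall s, F (s, 0) <= 0 /\ F (s, 1) <= 0) ->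
  forall p, cstrip p -> F p <= 0.
Proof.
move=> lF cF bF F0 [s t] st; apply/ler_addgt0Pr => e e0; rewrite add0r.
have c0 : 0 < cos (2^-1 : R).
  by apply: cos_gt0_pihalf; have := pihalf_ge1 R; lra.
(* [B] is 2 cosh s cos (t - 1/2): harmonic, positive on the closed strip because 1/2 < pi / 2, and
   unbounded at both ends. The factor [k] normalises [k * B] to [e] at the given point, and for |s|
   = [S] it is at least the bound [M]. *)
pose B (p : R * R) := expR (1 * p.1) * cos (1 * p.2 + - 2^-1)
                      + expR (-1 * p.1) * cos (1 * p.2 + - 2^-1).
pose k := e / B (s, t).
have cosp y : 0 <= y <= 1 -> cos (2^-1 : R) <= cos (1 * y - 2^-1).
  move=> /andP[y0 y1].
  have [h|h] := leP 2^-1 y.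
    rewrite leNgt ltr_cos ?in_itv /= -?leNgt; have := pihalf_ge1 R; lra.
  rewrite -(cosN (1 * y - _)) leNgt ltr_cos ?in_itv /= -?leNgt; have := pihalf_ge1 R; lra.
have Bge x y : 0 <= y <= 1 -> (expR x + expR (- x)) * cos 2^-1 <= B (x, y).
  by move=> hy; rewrite /B /= mulN1r mul1r -mulrDl ler_wpM2l ?cosp//.
have ex x : 0 < expR x + expR (- x) :> R by rewrite addr_gt0 ?expR_gt0.
have B0 x y : 0 <= y <= 1 -> 0 < B (x, y).
  by move=> hy; apply: lt_le_trans (Bge _ _ hy); rewrite mulr_gt0.
have k0 : 0 < k by rewrite divr_gt0 ?B0.
have kc0 : 0 < k * cos 2^-1 by exact: mulr_gt0.
pose S := Num.max `|s| (`|M| / (k * cos 2^-1)).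
have sS : `|s| <= S by rewrite le_max lexx.
have MS x : `|x| = S -> M <= k * ((expR x + expR (- x)) * cos 2^-1).
  move=> xS; have : `|M| / (k * cos 2^-1) <= `|x| by rewrite xS le_max lexx orbT.
  rewrite ler_pdivrMr// => H; apply: le_trans (ler_norm _) _.
  apply: le_trans H _; rewrite (mulrC `|x|).
  rewrite (_ : k * (_ * _) = k * cos 2^-1 * (expR x + expR (- x))); last by ring.
  rewrite ler_pM2l//.
  have := expR_ge1Dx x; have := expR_ge1Dx (- x); have := expR_gt0 x.
  have := expR_gt0 (- x); case: (ger0P x) => _; lra.
have H : F (s, t) + (- k) * B (s, t) <= 0; last first.
  by move: H; rewrite mulNr subr_le0 /k divfK// gt_eqF ?B0.
have S0 : 0 <= S by apply: le_trans sS; exact: normr_ge0.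
apply: (@rectangle_max _ (fun p => F p + (- k) * B p) (fun=> 0) (- S) S 0 1); last 2 first.
- by rewrite -ler_norml.
- exact: st.
- have lB : has_laplacian ostrip B (fun=> 0).
    apply: has_laplacian_eq; last by apply: has_laplacianD; exact: has_laplacian_expR_cos.
    by move=> p _ /=; ring.
  have := has_laplacianD lF (has_laplacianZ (- k) lB).
  move=> [F1 [F2 [F11 [F22 HF]]]]; exists F1, F2, F11, F22 => p [_ /HF[? ? ? ? e1]].
  by split => //; rewrite e1 mulr0 addr0.
- by [].
- move=> x y _ hy; apply: continuousD; first exact: cF.
  apply: continuousM; first exact: cst_continuous.
  have cA (a b : R) : {for (x, y), continuous (fun p : R * R => expR (a * p.1) * cos (1 * p.2 + b))}.
    apply: continuousM.
      apply: continuous_comp; last exact: continuous_expR.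
      by apply: continuousM; [exact: cst_continuous|exact: cvg_fst].
    apply: continuous_comp; last exact: continuous_cos.
    apply: continuousD; last exact: cst_continuous.
    by apply: continuousM; [exact: cst_continuous|exact: cvg_snd].
  by apply: continuousD; exact: cA.
- move=> x y hx hy; rewrite mulNr subr_le0.
  case=> e1.
  + apply: le_trans (bF (x, y) hy) _; apply: le_trans (MS x _) _.
      by rewrite e1 normrN ger0_norm.
    by rewrite ler_pM2l// Bge.
  + apply: le_trans (bF (x, y) hy) _; apply: le_trans (MS x _) _.
      by rewrite e1 ger0_norm.
    by rewrite ler_pM2l// Bge.
  + by rewrite e1; apply: le_trans (F0 x).1 _; rewrite mulr_ge0 ?ltW// B0// lexx ler01.
  + by rewrite e1; apply: le_trans (F0 x).2 _; rewrite mulr_ge0 ?ltW// B0// lexx ler01.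
Qed.

Lemma has_laplacian_affine W (a b : R) :
  has_laplacian W (fun p => a * p.2 + b) (fun=> 0).
Proof.
exists (fun=> 0), (fun=> a), (fun=> 0), (fun=> 0) => -[s t] _.
split; [| |exact: is_derive_cst..|by rewrite addr0].
  by apply/is_derive_slice1 => /=; exact: is_derive_cst.
by apply/is_derive_slice2 => /=; exact: is_derive_affine.
Qed.

(* Comparison with [exp (- sg pi s) sin (pi t)], the slowest decaying positive
   harmonic function vanishing on the boundary; at boundary points it plays the
   role of Hopf's lemma. *)
Lemma positive_harmonic_lower_bound V (sg S c : R) : sg = 1 \/ sg = -1 -> 0 < c ->
  has_laplacian ostrip V (fun=> 0) ->
  (forall p, cstrip p -> {for p, continuous V}) ->
  (forall p, cstrip p -> 0 <= V p) ->
  (forall s t, 0 <= t <= 1 -> sg * s <= S -> c <= V (s, t)) ->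
  forall s, exists2 a, 0 < a & forall t, 0 <= t <= 1 -> a * sin (pi * t) <= V (s, t).
Proof.
move=> sgP c0 lV cV V0 Vc s.
have [sS|Ss] := leP (sg * s) S.
  exists c => // t ht; apply: le_trans (Vc _ _ ht sS).
  by rewrite -[leRHS]mulr1 ler_pM2l// sin_le1.
(* The shifted cosine is sin (pi t); [k] makes [k * B] equal to c sin (pi t) where [sg * s = S]. *)
pose B (p : R * R) := expR (- sg * pi * p.1) * cos (pi * p.2 + - (pi / 2)).
pose k := c * expR (pi * S).
have k0 : 0 < k by rewrite mulr_gt0// expR_gt0.
have kB x t : k * B (x, t) = c * expR (- pi * (sg * x - S)) * sin (pi * t).
  rewrite /k /B /= cosBpihalf; transitivity (c * (expR (pi * S) *
    expR (- sg * pi * x)) * sin (pi * t)); first by ring.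
  by rewrite -expRD; congr (c * expR _ * _); ring.
have singe0 t : 0 <= t <= 1 -> 0 <= sin (pi * t) :> R.
  move=> /andP[t0 t1]; apply: sin_ge0_pi; have pi0 := pi_gt0 R; nra.
exists (c * expR (- pi * (sg * s - S))); first by rewrite mulr_gt0// expR_gt0.
move=> t ht; rewrite -kB; apply/ler_addgt0Pr => e e0.
(* At [sg * x = S'] the comparison function is at most [e], because exp (pi y) >= 1 + pi y;
   subtracting [e] settles this far end of the rectangle using only V >= 0 there. *)
pose S' := Num.max (sg * s) (S + c / e / pi).
have pi0 := pi_gt0 R.
have smallS' x : sg * x = S' -> c * expR (- pi * (sg * x - S)) <= e.
  move=> ->; have : c / e / pi <= S' - S.
    by rewrite lerBrDl le_max lexx orbT.
  rewrite ler_pdivrMr// => H; rewrite mulNr expRN ler_pdivrMr ?expR_gt0//.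
  have := expR_ge1Dx (pi * (S' - S)); rewrite -(ler_pM2l e0) => H2.
  apply: le_trans H2; move: H; rewrite ler_pdivrMr//; nra.
have key s1 s2 : (forall x, x = s1 \/ x = s2 -> sg * x = S \/ sg * x = S') ->
    s1 <= s <= s2 -> k * B (s, t) + (- 1 * V (s, t) + - e) <= 0.
  move=> sP hs; apply: (@rectangle_max _ (fun p => k * B p + (-1 * V p + - e))
    (fun=> 0) s1 s2 0 1) => //.
  - have lB : has_laplacian ostrip B (fun=> 0).
      apply: has_laplacian_eq; last exact: has_laplacian_expR_cos.
      move=> p _ /=; case: sgP => ->; ring.
    have := has_laplacianD (has_laplacianZ k lB)
      (has_laplacianD (has_laplacianZ (-1) lV) (has_laplacian_cst ostrip (- e))).
    move=> [F1 [F2 [F11 [F22 HF]]]]; exists F1, F2, F11, F22 => p [_ /HF[? ? ? ? e1]].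
    by split => //; rewrite e1 !mulr0 !addr0.
  - move=> x y _ hy.
    have cM (a : R) (f : R * R -> R) : {for (x, y), continuous f} ->
        {for (x, y), continuous (fun p => a * f p)}.
      by move=> cf; apply: continuousM => //; exact: cst_continuous.
    apply: continuousD.
      apply: (cM _ _); apply: continuousM.
        apply: continuous_comp; last exact: continuous_expR.
        by apply: (cM _ _); exact: cvg_fst.
      apply: continuous_comp; last exact: continuous_cos.
      apply: continuousD; last exact: cst_continuous.
      by apply: (cM _ _); exact: cvg_snd.
    by apply: continuousD; [apply: (cM _ _); exact: cV|exact: cst_continuous].
  - move=> x y hx hy bxy; rewrite kB.
    have Vxy := V0 (x, y) hy; have sy0 := singe0 _ hy; have sy1 := sin_le1 (pi * y).
    have side : x = s1 \/ x = s2 ->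
        c * expR (- pi * (sg * x - S)) * sin (pi * y) + (-1 * V (x, y) + - e) <= 0.
      move=> /sP[e1|/smallS' e1].
        have := Vc x y hy; rewrite e1 lexx => /(_ isT).
        by rewrite subrr mulr0 expR0; nra.
      have e2 : 0 <= c * expR (- pi * (sg * x - S)).
        by rewrite mulr_ge0 ?expR_ge0// ltW.
      by nra.
    case: bxy => e1; [by apply: side; left|by apply: side; right| |].
      by rewrite e1 mulr0 sin0; move: Vxy; rewrite e1; lra.
    by rewrite e1 mulr1 sinpi mulr0; move: Vxy; rewrite e1; lra.
suff : k * B (s, t) + (- 1 * V (s, t) + - e) <= 0 by lra.
have sS' : sg * s <= S' by rewrite le_max lexx.
case: sgP => sg1; rewrite sg1 in key sS' Ss.
- by apply: (key S S') => [x []->|]; [left|right|]; move: sS' Ss; lra.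
- by apply: (key (- S') (- S)) => [x []->|]; [right|left|]; move: sS' Ss; lra.
Qed.

(** The lower bound has inward slope [a * pi > 0] at the boundary, whereas a function vanishing
    there together with its normal derivative would fall below it. *)
Lemma positive_harmonic_boundary V (a s t : R) : 0 < a ->
  (forall t, 0 <= t <= 1 -> a * sin (pi * t) <= V (s, t)) ->
  t = 0 \/ t = 1 -> V (s, t) = 0 -> is_derive (s, t) (0, 1) V 0 -> False.
Proof.
move=> a0 aV t01 V0 /is_derive_slice2 dV.
have pi0 := pi_gt0 R.
pose f x := V (s, x) - a * sin (pi * x + 0).
have f0 x : 0 <= x <= 1 -> 0 <= f x by move=> /aV; rewrite /f addr0 subr_ge0.
have df : is_derive t 1 f (0 - a * (cos (pi * t + 0) * pi)).
  apply: is_deriveD_fun dV _; apply: is_deriveN_fun.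
  have := is_deriveM_fun (is_derive_cst a t 1)
    (is_derive_compose (is_derive_sin _) (is_derive_affine pi 0 t)).
  by rewrite mul0r add0r.
have ap : 0 < a * pi / 2 by rewrite divr_gt0// mulr_gt0.
have [r r0 Hr] := eps_is_derive df ap.
pose h := Num.min (r / 2) 2^-1.
have h0 : 0 < h by rewrite lt_min divr_gt0//=.
have hr : h <= r / 2 by rewrite ge_min lexx.
have h2 : h <= 2^-1 by rewrite ge_min lexx orbT.
have ft : f t = 0 by rewrite /f V0 addr0; case: t01 => ->; rewrite ?mulr0 ?mulr1 ?sin0 ?sinpi; ring.
case: t01 => e1; rewrite e1 in df Hr ft.
- have := Hr h; rewrite gtr0_norm// ft mulr0 addr0 cos0 add0r => /(_ _)/wrap[]; first by lra.
  have := f0 h; rewrite ler_norml => /(_ _)/wrap[]; first by lra.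
  by move=> fh /andP[_]; nra.
- have := Hr (- h); rewrite normrN gtr0_norm// ft mulr1 addr0 cospi => /(_ _)/wrap[]; first by lra.
  have := f0 (1 - h); rewrite ler_norml => /(_ _)/wrap[]; first by lra.
  by move=> fh /andP[_]; nra.
Qed.

(** On the unit circle K2 / (1 + K1) and K2 / (1 - K1) are inverse to each other, so this gives the
    boundary values of [cayley_arg]. *)
Lemma atan_hyperbola (x y : R) : x * y = 1 ->
  atan x + atan y = Num.sg x * (pi / 2).
Proof.
wlog x0 : x y / 0 < x => [H|] xy1.
  have [x0|x0|x0] := ltgtP x 0; last by move: xy1; rewrite x0 mul0r; lra.
  - have := H (- x) (- y); rewrite mulrNN oppr_gt0 !atanN sgrN => /(_ x0 xy1).
    by lra.
  - exact: H.
have y0 : 0 < y by rewrite -(pmulr_rgt0 _ x0) xy1.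
rewrite gtr0_sg// mul1r; apply: cos_inj.
- rewrite in_itv /=.
  have := lt_atan x0; have := lt_atan y0; rewrite atan0.
  by have := atan_ltpi2 x; have := atan_ltpi2 y; lra.
- by rewrite in_itv /=; have := pi_gt0 R; lra.
- have tanE z : sin (atan z) = z * cos (atan z).
    rewrite -{2}(atanK z) /tan divfK// cos_atan invr_eq0 sqrtr_eq0 -ltNge.
    by rewrite ltr_pwDl// sqr_ge0.
  by rewrite cosD cos_pihalf !tanE; rewrite mulrACA xy1; ring.
Qed.

(** * The logarithm of the Cayley transform *)

Section CayleyTransform.
Variables K1 K2 : R * R -> R.
Hypothesis holK : holomorphic K1 K2.
Hypothesis K1lt : forall p, cstrip p -> -1 < K1 p < 1.

Let Np p := (1 + K1 p) ^+ 2 + K2 p ^+ 2.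
Let Nm p := (1 - K1 p) ^+ 2 + K2 p ^+ 2.

(** Together with [cayley_arg], the logarithm of (1 + K) / (1 - K) for K = K1 + i K2. Both 1 + K and
    1 - K lie in the right half plane, so arctangents give their arguments without a choice of
    branch. *)
Definition cayley_log p := 2^-1 * (ln (Np p) - ln (Nm p)).
Definition cayley_arg p := atan (K2 p / (1 + K1 p)) + atan (K2 p / (1 - K1 p)).

Let K1p p : cstrip p -> 0 < 1 + K1 p. Proof. by move=> /K1lt; lra. Qed.
Let K1m p : cstrip p -> 0 < 1 - K1 p. Proof. by move=> /K1lt; lra. Qed.
Let Np0 p : cstrip p -> 0 < Np p.
Proof. by move=> /K1p h; rewrite ltr_wpDr ?sqr_ge0// exprn_gt0. Qed.
Let Nm0 p : cstrip p -> 0 < Nm p.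
Proof. by move=> /K1m h; rewrite ltr_wpDr ?sqr_ge0// exprn_gt0. Qed.

Lemma is_derive_cayley_log p v (a b : R) : cstrip p ->
  is_derive p v K1 a -> is_derive p v K2 b ->
  is_derive p v cayley_log (((1 + K1 p) * a + K2 p * b) / Np p
                            + ((1 - K1 p) * a - K2 p * b) / Nm p).
Proof.
move=> cp d1 d2.
have dp := is_deriveD_fun (is_derive_cst (1 : R) p v) d1.
have dm := is_deriveD_fun (is_derive_cst (1 : R) p v) (is_deriveN_fun d1).
have dNp := is_deriveD_fun (is_deriveX_fun 2 dp) (is_deriveX_fun 2 d2).
have dNm := is_deriveD_fun (is_deriveX_fun 2 dm) (is_deriveX_fun 2 d2).
have lp := is_derive_compose (is_derive1_ln (Np0 cp)) dNp.
have lm := is_derive_compose (is_derive1_ln (Nm0 cp)) dNm.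
have := is_deriveM_fun (is_derive_cst (2^-1 : R) p v) (is_deriveD_fun lp (is_deriveN_fun lm)).
move/is_derive_eq; apply; rewrite /= !expr1.
by field; rewrite !lt0r_neq0 ?Np0 ?Nm0.
Qed.

Lemma is_derive_cayley_arg p v (a b : R) : cstrip p ->
  is_derive p v K1 a -> is_derive p v K2 b ->
  is_derive p v cayley_arg ((b * (1 + K1 p) - K2 p * a) / Np p
                            + (b * (1 - K1 p) + K2 p * a) / Nm p).
Proof.
move=> cp d1 d2.
have dp := is_deriveD_fun (is_derive_cst (1 : R) p v) d1.
have dm := is_deriveD_fun (is_derive_cst (1 : R) p v) (is_deriveN_fun d1).
have qp := is_deriveM_fun d2 (@is_deriveV_fun _ _ (fun x => 1 + K1 x) p v _ (lt0r_neq0 (K1p cp)) dp).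
have qm := is_deriveM_fun d2 (@is_deriveV_fun _ _ (fun x => 1 - K1 x) p v _ (lt0r_neq0 (K1m cp)) dm).
have := is_deriveD_fun (is_derive_compose (is_derive1_atan _) qp)
  (is_derive_compose (is_derive1_atan _) qm).
move/is_derive_eq; apply.
have e1 : (1 + (K2 p / (1 + K1 p)) ^+ 2)^-1 = (1 + K1 p) ^+ 2 / Np p.
  by rewrite /Np; field; rewrite !lt0r_neq0 ?K1p//; exact: Np0.
have e2 : (1 + (K2 p / (1 - K1 p)) ^+ 2)^-1 = (1 - K1 p) ^+ 2 / Nm p.
  by rewrite /Nm; field; rewrite !lt0r_neq0 ?K1m//; exact: Nm0.
rewrite e1 e2; field.
by rewrite !lt0r_neq0 ?Np0 ?Nm0 ?K1p ?K1m.
Qed.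

Lemma holomorphic_cayley : holomorphic cayley_log cayley_arg.
Proof.
case: holK => pK1 pK2 CR; split.
- apply: pderivM; first exact: pderiv_cst.
  apply: pderivB; apply: pderiv_ln => //; apply: pderivD; apply: pderivX => //.
    by apply: pderivD => //; exact: pderiv_cst.
  by apply: pderivB => //; exact: pderiv_cst.
- apply: pderivD; apply: pderiv_atan; apply: pderivM => //; apply: pderivV.
  + by move=> p /K1p /lt0r_neq0.
  + by apply: pderivD => //; exact: pderiv_cst.
  + by move=> p /K1m /lt0r_neq0.
  + by apply: pderivB => //; exact: pderiv_cst.
- move=> p cp; case: pK1 pK2 => _ [F1 [F2 [dF _ _]]] [_ [G1 [G2 [dG _ _]]]].
  have [[f1 f2] [g1 g2]] := (dF p cp, dG p cp).
  have [_ ->] := is_derive_cayley_log cp f1 g1.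
  have [_ ->] := is_derive_cayley_log cp f2 g2.
  have [_ ->] := is_derive_cayley_arg cp f1 g1.
  have [_ ->] := is_derive_cayley_arg cp f2 g2.
  case: (CR p cp); case: f1 f2 g1 g2 => _ -> [_ ->] [_ ->] [_ ->] -> ->.
  by split; field; rewrite !lt0r_neq0 ?Np0 ?Nm0.
Qed.

(** K = (z - 1) / (z + 1) for z = E exp (i q), and [M] is |z + 1|^2. *)
Lemma cayleyK p : cstrip p ->
  let E := expR (cayley_log p) in let q := cayley_arg p in
  let M := E ^+ 2 + 2 * E * cos q + 1 in
  [/\ 0 < M, K1 p = (E ^+ 2 - 1) / M & K2 p = 2 * E * sin q / M].
Proof.
move=> cp E q M; have a0 := K1p cp; have b0 := K1m cp.
pose r := Num.sqrt (Np p); pose s := Num.sqrt (Nm p).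
have r0 : 0 < r by rewrite sqrtr_gt0 Np0.
have s0 : 0 < s by rewrite sqrtr_gt0 Nm0.
have r2 : r ^+ 2 = Np p by rewrite sqr_sqrtr// ltW// Np0.
have s2 : s ^+ 2 = Nm p by rewrite sqr_sqrtr// ltW// Nm0.
have EE : E = r / s.
  rewrite /E /cayley_log -r2 -s2 !lnXn// -mulrnBl -ln_div ?posrE//.
  rewrite (_ : 2^-1 * (ln (r / s) *+ 2) = ln (r / s)); last by field.
  by rewrite lnK// posrE divr_gt0.
have cs (x d n : R) : 0 < d -> 0 < n -> d ^+ 2 + x ^+ 2 = n ^+ 2 ->
    cos (atan (x / d)) = d / n /\ sin (atan (x / d)) = x / n.
  move=> d0 n0 e; have -> : cos (atan (x / d)) = d / n.
    rewrite cos_atan; have -> : 1 + (x / d) ^+ 2 = (n / d) ^+ 2.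
      by rewrite [RHS]expr_div_n -e; field; exact: lt0r_neq0.
    by rewrite sqrtr_sqr ger0_norm ?divr_ge0 ?ltW// invf_div.
  split=> //; have := atanK (x / d); rewrite /tan => H.
  have c0 : cos (atan (x / d)) != 0.
    by apply: lt0r_neq0; apply: cos_gt0_pihalf; rewrite atan_gtNpi2 atan_ltpi2.
  have -> : sin (atan (x / d)) = x / d * cos (atan (x / d)).
    by rewrite -[LHS](divfK c0) H.
  rewrite cos_atan; have -> : 1 + (x / d) ^+ 2 = (n / d) ^+ 2.
    by rewrite [RHS]expr_div_n -e; field; exact: lt0r_neq0.
  rewrite sqrtr_sqr ger0_norm ?divr_ge0 ?ltW// invf_div.
  by field; rewrite !lt0r_neq0.
have [c1 s1] := cs (K2 p) _ _ a0 r0 (esym r2).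
have [c2 s2'] := cs (K2 p) _ _ b0 s0 (esym s2).
have cq : cos q = (1 - K1 p ^+ 2 - K2 p ^+ 2) / (r * s).
  by rewrite /q cosD c1 c2 s1 s2'; field; rewrite !lt0r_neq0.
have sq : sin q = 2 * K2 p / (r * s).
  by rewrite /q sinD c1 c2 s1 s2'; field; rewrite !lt0r_neq0.
have ME : M = 4 / s ^+ 2.
  have -> : M = (r ^+ 2 + 2 * (1 - K1 p ^+ 2 - K2 p ^+ 2) + s ^+ 2) / s ^+ 2.
    by rewrite /M EE cq; field; rewrite !lt0r_neq0.
  by congr (_ / _); rewrite r2 s2 /Np /Nm; ring.
split.
- by rewrite ME divr_gt0// exprn_gt0.
- rewrite ME EE; have -> : (r / s) ^+ 2 - 1 = (r ^+ 2 - s ^+ 2) / s ^+ 2.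
    by field; rewrite lt0r_neq0.
  by rewrite r2 /Np {1}s2 /Nm; field; rewrite lt0r_neq0.
- by rewrite ME EE sq; field; rewrite !lt0r_neq0.
Qed.

End CayleyTransform.

Lemma strip_rigidity (K1 K2 : R * R -> R) : holomorphic K1 K2 ->
  (forall s, K1 (s, 0) ^+ 2 + K2 (s, 0) ^+ 2 = 1 /\ K2 (s, 0) <= 0) ->
  (forall s, K1 (s, 1) ^+ 2 + K2 (s, 1) ^+ 2 = 1 /\ 0 <= K2 (s, 1)) ->
  (forall s t, t = 0 \/ t = 1 -> K1 (s, t) = 1 \/ K1 (s, t) = -1 ->
     is_derive (s, t) (0, 1) K1 0) ->
  (forall e, 0 < e -> exists S, forall s t, 0 <= t <= 1 -> s < S ->
     `|K1 (s, t) + 1| < e /\ `|K2 (s, t)| < e) ->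
  (forall e, 0 < e -> exists S, forall s t, 0 <= t <= 1 -> S < s ->
     `|K1 (s, t) - 1| < e /\ `|K2 (s, t)| < e) ->
  exists c, forall s t, 0 <= t <= 1 ->
    let E := expR (pi * (s + c)) in let M := E ^+ 2 + 2 * E * sin (pi * t) + 1 in
    [/\ 0 < M, K1 (s, t) = (E ^+ 2 - 1) / M & K2 (s, t) = - (2 * E * cos (pi * t)) / M].
Proof.
move=> holK bK0 bK1 dK0 limN limP.
have cK1 p : cstrip p -> {for p, continuous K1}.
  by case: holK => pK1 _ _; exact: (pderiv_continuous pK1).
have cK2 p : cstrip p -> {for p, continuous K2}.
  by case: holK => _ pK2 _; exact: (pderiv_continuous pK2).
have lK1 := holomorphic_laplacian holK.
have lK2 := holomorphic_laplacian (holomorphicN holK).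
have in0 s : cstrip (s, 0) by rewrite /cstrip /= lexx ler01.
have in1 s : cstrip (s, 1) by rewrite /cstrip /= lexx ler01.
(* Maximum principle for the squared modulus: it is 1 on the two boundary lines and at most 1 + e on
   vertical segments far out, where K is close to -1 or 1. *)
have Kle1 p : cstrip p -> K1 p ^+ 2 + K2 p ^+ 2 <= 1.
  case: p => s t st; apply/ler_addgt0Pr => e e0.
  have e40 : 0 < Num.min (e / 4) 1 by rewrite lt_min divr_gt0//=.
  have [S1 HS1] := limN _ e40; have [S2 HS2] := limP _ e40.
  pose s1 := Num.min s (S1 - 1); pose s2 := Num.max s (S2 + 1).
  have s1s : s1 <= s by rewrite ge_min lexx.
  have ss2 : s <= s2 by rewrite le_max lexx.
  have s1S : s1 < S1 by rewrite gt_min; apply/orP; right; lra.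
  have s2S : S2 < s2 by rewrite lt_max; apply/orP; right; lra.
  have bnd a b : `|a| < Num.min (e / 4) 1 -> `|b| < Num.min (e / 4) 1 ->
      (1 + a) ^+ 2 + b ^+ 2 <= 1 + e.
    by rewrite !lt_min !ltr_norml => /andP[/andP[a1 a2] /andP[a3 a4]]
      /andP[/andP[b1 b2] /andP[b3 b4]]; nra.
  have [L1 lL1 L10] := has_laplacian_sqr lK1; have [L2 lL2 L20] := has_laplacian_sqr lK2.
  suff : K1 (s, t) ^+ 2 + K2 (s, t) ^+ 2 + - (1 + e) <= 0 by lra.
  apply: (@rectangle_max _ (fun p => K1 p ^+ 2 + K2 p ^+ 2 + - (1 + e))
    (fun p => L1 p + L2 p) s1 s2 0 1); last 2 first.
  - by rewrite s1s.
  - exact: st.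
  - have := has_laplacianD (has_laplacianD lL1 lL2) (has_laplacian_cst ostrip (- (1 + e))).
    move=> [F1 [F2 [F11 [F22 HF]]]]; exists F1, F2, F11, F22 => p [_ /HF[? ? ? ? e1]].
    by split => //; rewrite e1 addr0.
  - by move=> p _; rewrite addr_ge0.
  - move=> x y _ hy.
    have cX (f : R * R -> R) : {for (x, y), continuous f} ->
        {for (x, y), continuous (fun p => f p ^+ 2)}.
      move=> cf; apply: (@continuous_comp _ _ _ f (fun x : R => x ^+ 2)) => //.
      exact: exprn_continuous.
    apply: continuousD; last exact: cst_continuous.
    by apply: continuousD; apply: (cX _ _); [exact: cK1|exact: cK2].
  - move=> x y hx hy [] ->.
    + have [h1 h2] := HS1 s1 y hy s1S; rewrite subr_le0.
      have -> : K1 (s1, y) ^+ 2 = (1 + - (K1 (s1, y) + 1)) ^+ 2 by ring.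
      by apply: bnd; rewrite ?normrN.
    + have [h1 h2] := HS2 s2 y hy s2S; rewrite subr_le0.
      have -> : K1 (s2, y) ^+ 2 = (1 + (K1 (s2, y) - 1)) ^+ 2 by ring.
      exact: bnd.
    + by have [-> _] := bK0 x; lra.
    + by have [-> _] := bK1 x; lra.
have K1le p : cstrip p -> -1 <= K1 p <= 1 by move=> /Kle1; nra.
(* Strictness up to the boundary keeps the Cayley transform smooth on the closed strip. At a
   boundary point with K1 = 1 or K1 = -1 the normal derivative vanishes by hypothesis, against the
   positive slope of the lower bound for 1 - K1 or 1 + K1. *)
have K1lt p : cstrip p -> -1 < K1 p < 1.
  move=> cp; have lVm : has_laplacian ostrip (fun p => 1 + -1 * K1 p) (fun=> 0).
    apply: has_laplacian_eq (has_laplacianD (has_laplacian_cst ostrip 1) (has_laplacianZ (-1) lK1)).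
    by move=> q _; rewrite mulr0 addr0.
  have lVp : has_laplacian ostrip (fun p => 1 + K1 p) (fun=> 0).
    apply: has_laplacian_eq (has_laplacianD (has_laplacian_cst ostrip 1) lK1).
    by move=> q _; rewrite addr0.
  have strict (V : R * R -> R) (a : R) : 0 < a ->
      (forall t, 0 <= t <= 1 -> a * sin (pi * t) <= V (p.1, t)) ->
      (p.2 = 0 \/ p.2 = 1 -> V p = 0 -> is_derive p (0, 1) V 0) -> 0 <= V p -> 0 < V p.
    case: p cp => s t /= st a0 aV dV V0.
    have [t0|t0] := eqVneq t 0.
      rewrite lt0r V0 andbT; apply/eqP => Vp.
      by apply: (positive_harmonic_boundary a0 aV (or_introl t0) Vp); apply: dV => //; left.
    have [t1|t1] := eqVneq t 1.
      rewrite lt0r V0 andbT; apply/eqP => Vp.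
      by apply: (positive_harmonic_boundary a0 aV (or_intror t1) Vp); apply: dV => //; right.
    apply: lt_le_trans (aV t st); rewrite mulr_gt0//; apply: sin_gt0_pi.
    move: st; rewrite /cstrip /= => /andP[h0 h1].
    have h0' : 0 < t by rewrite lt_neqAle eq_sym t0.
    have h1' : t < 1 by rewrite lt_neqAle t1.
    by have := pi_gt0 R; nra.
  have [S1 HS1] := limN _ ltr01; have [S2 HS2] := limP _ ltr01.
  have cVm q : cstrip q -> {for q, continuous (fun p => 1 + -1 * K1 p)}.
    move=> cq; apply: continuousD; first exact: cst_continuous.
    by apply: continuousM; [exact: cst_continuous|exact: cK1].
  have cVp q : cstrip q -> {for q, continuous (fun p => 1 + K1 p)}.
    by move=> cq; apply: continuousD; [exact: cst_continuous|exact: cK1].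
  have [||a a0 aV] := @positive_harmonic_lower_bound _ 1 (S1 - 1) 1 (or_introl erefl)
    ltr01 lVm cVm _ _ p.1.
  - by move=> q /K1le; lra.
  - move=> s t ht; rewrite mul1r => hs; have [|+ _] := HS1 s t ht; first by lra.
    by rewrite ltr_norml; lra.
  have [||b b0 bV] := @positive_harmonic_lower_bound _ (-1) (- S2 - 1) 1 (or_intror erefl)
    ltr01 lVp cVp _ _ p.1.
  - by move=> q /K1le; lra.
  - move=> s t ht; rewrite mulN1r => hs; have [|+ _] := HS2 s t ht; first by lra.
    by rewrite ltr_norml; lra.
  have hm := K1le p cp.
  have V1 : 0 < 1 + -1 * K1 p.
    apply: (strict (fun p => 1 + -1 * K1 p) a) => //; last by lra.
    move=> hp V0; have K11 : K1 p = 1 by lra.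
    have dK : is_derive p (0, 1) K1 0.
      by move: hp K11; case: (p) => x y; move=> hp K11; apply: dK0 => //; left.
    have := is_deriveD_fun (is_derive_cst (1 : R) p (0, 1))
      (is_deriveM_fun (is_derive_cst (-1 : R) p (0, 1)) dK).
    by rewrite mul0r mulr0 !addr0.
  have V2 : 0 < 1 + K1 p.
    apply: (strict (fun p => 1 + K1 p) b) => //; last by lra.
    move=> hp V0; have K11 : K1 p = -1 by lra.
    have dK : is_derive p (0, 1) K1 0.
      by move: hp K11; case: (p) => x y; move=> hp K11; apply: dK0 => //; right.
    have := is_deriveD_fun (is_derive_cst (1 : R) p (0, 1)) dK.
    by rewrite !addr0.
  lra.
have holPQ := holomorphic_cayley holK K1lt.
set P := cayley_log K1 K2 in holPQ; set Q := cayley_arg K1 K2 in holPQ.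
have lQ := holomorphic_laplacian (holomorphicN holPQ).
have cQ p : cstrip p -> {for p, continuous Q}.
  by case: holPQ => _ pQ _; exact: (pderiv_continuous pQ).
have Qb p : -pi < Q p < pi.
  rewrite /Q /cayley_arg; set x := _ / _; set y := _ / _.
  have := atan_gtNpi2 x; have := atan_gtNpi2 y; have := atan_ltpi2 x; have := atan_ltpi2 y; lra.
have Q0 s t : t = 0 \/ t = 1 -> Q (s, t) = pi * t - pi / 2.
  move=> t01; have cst : cstrip (s, t) by case: t01 => ->.
  have n1 : K1 (s, t) ^+ 2 + K2 (s, t) ^+ 2 = 1.
    by case: t01 => ->; [case: (bK0 s)|case: (bK1 s)].
  have /andP[ha hb] := K1lt _ cst.
  have hp : 0 < 1 + K1 (s, t) by lra.
  have hm : 0 < 1 - K1 (s, t) by lra.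
  have K20 : K2 (s, t) != 0 by apply/eqP => e; move: n1; rewrite e; nra.
  rewrite /Q /cayley_arg atan_hyperbola; last first.
    have -> : K2 (s, t) / (1 + K1 (s, t)) * (K2 (s, t) / (1 - K1 (s, t))) =
      K2 (s, t) ^+ 2 / (1 - K1 (s, t) ^+ 2).
      by field; rewrite !lt0r_neq0//; nra.
    have -> : K2 (s, t) ^+ 2 = 1 - K1 (s, t) ^+ 2 by lra.
    by rewrite mulfV// lt0r_neq0//; nra.
  rewrite sgrM sgrV (gtr0_sg hp) mulr1; case: t01 => e; rewrite e in K20 *.
    have [_ hK] := bK0 s; rewrite ltr0_sg; first by lra.
    by rewrite lt_neqAle K20.
  have [_ hK] := bK1 s; rewrite gtr0_sg; first by lra.
  by rewrite lt_neqAle eq_sym K20.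
(* [Q] minus the affine function with the same boundary values is harmonic, bounded by 3 pi and zero
   on the boundary; Phragmen-Lindelof for both signs makes it vanish. *)
have QE p : cstrip p -> Q p = pi * p.2 - pi / 2.
  move=> cp; have pi0 := pi_gt0 R.
  have lF := has_laplacianD lQ (has_laplacian_affine ostrip (- pi) (pi / 2)).
  have lG := has_laplacianD (has_laplacianZ (-1) lQ) (has_laplacian_affine ostrip pi (- (pi / 2))).
  have e00 : {in ostrip, (fun=> 0 + 0) =1 (fun=> 0 : R)} by move=> q _ /=; rewrite addr0.
  have e01 : {in ostrip, (fun=> -1 * 0 + 0) =1 (fun=> 0 : R)}.
    by move=> q _ /=; rewrite mulr0 addr0.
  have caff (a b : R) (q : R * R) : {for q, continuous (fun p : R * R => a * p.2 + b)}.
    apply: continuousD; last exact: cst_continuous.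
    by apply: continuousM; [exact: cst_continuous|exact: cvg_snd].
  have h1 := @phragmen_lindelof _ (3 * pi) (has_laplacian_eq e00 lF) _ _ _ p cp.
  have h2 := @phragmen_lindelof _ (3 * pi) (has_laplacian_eq e01 lG) _ _ _ p cp.
  apply/eqP; rewrite eq_le; apply/andP; split.
    suff : Q p + (- pi * p.2 + pi / 2) <= 0 by lra.
    apply: h1.
    - by move=> q cq; apply: continuousD; [exact: cQ|exact: caff].
    - move=> q /andP[q0 q1]; have /andP[q2 q3] := Qb q.
      have : 0 <= pi * q.2 by rewrite mulr_ge0// ltW.
      by have : pi * q.2 <= pi; [rewrite ler_piMr// ltW|lra].
    - by move=> s; rewrite !Q0/=; [lra|right|left].
  suff : -1 * Q p + (pi * p.2 - pi / 2) <= 0 by lra.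
  apply: h2.
  - move=> q cq; apply: continuousD; last exact: caff.
    by apply: continuousM; [exact: cst_continuous|exact: cQ].
  - move=> q /andP[q0 q1]; have /andP[q2 q3] := Qb q.
    have : 0 <= pi * q.2 by rewrite mulr_ge0// ltW.
    by have : pi * q.2 <= pi; [rewrite ler_piMr// ltW|lra].
  - by move=> s; rewrite !Q0/=; [lra|right|left].
have [pP pQ CR] := holPQ; have [_ [P1 [P2 [dP _ _]]]] := pP.
have [_ [Q1 [Q2 [dQ _ _]]]] := pQ.
have P20 p : cstrip p -> P2 p = 0.
  move=> cp; have [[_ dP2] [dQ1 _]] := (dP p cp, dQ p cp).
  have [_ e] := CR p cp; case: dP2 dQ1 => _ <- [dd1 dd2]; rewrite e.
  have -> : 'D_(1, 0) Q p = 0; last by rewrite oppr0.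
  move: cp dd1 dd2 {e}; case: p => s t cp dd1 dd2.
  suff [] : is_derive (s, t) (1, 0) Q 0 by [].
  apply/is_derive_slice1; have := is_derive_cst (pi * t - pi / 2) s (1 : R).
  by apply: is_derive_near; exists 1 => //= x _; rewrite QE.
have P1pi s t : ostrip (s, t) -> P1 (s, t) = pi.
  move=> st; have cst := ostrip_cstrip st.
  have [[dP1 _] [_ dQ2]] := (dP _ cst, dQ _ cst).
  have [e _] := CR _ cst; case: dP1 => _ <-; rewrite e.
  suff [] : is_derive (s, t) (0, 1) Q pi by [].
  apply/is_derive_slice2; have := is_derive_affine pi (- (pi / 2)) t.
  apply: is_derive_near.
  have t01 : t \in `]0, 1[ by rewrite in_itv.
  by apply: filterS (near_in_itvoo t01) => y; rewrite in_itv /= => y01; rewrite QE//;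
    exact: ostrip_cstrip.
(* The s-derivative of [P] is known only inside the strip, so [P] is integrated along the middle
   line t = 1/2 and then across the strip, where its t-derivative vanishes up to the boundary. *)
pose g s := P (s, 2^-1) - (pi * s + 0).
have half s : ostrip (s, 2^-1) by rewrite /ostrip /=; lra.
have dg (x : R) : is_derive x 1 g 0.
  have [d1 _] := dP _ (ostrip_cstrip (half x)).
  have := is_deriveD_fun ((is_derive_slice1 _ _ _ _).1 d1)
    (is_deriveN_fun (is_derive_affine pi 0 x)).
  by rewrite P1pi// subrr.
have gE s : P (s, 2^-1) = pi * s + P (0, 2^-1).
  have := is_derive_0_is_cst s 0 dg; rewrite /g; lra.
have PE s t : cstrip (s, t) -> P (s, t) = pi * s + P (0, 2^-1).
  move=> cst; rewrite -gE.
  have dPt (y : R) : 0 <= y <= 1 -> is_derive y 1 (fun y => P (s, y)) 0.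
    move=> hy; have [_ d2] := dP (s, y) hy; apply/is_derive_slice2.
    by have := d2; rewrite (P20 (s, y) hy).
  have cst2 (a b : R) : 0 <= a -> b <= 1 -> a <= b -> P (s, b) = P (s, a).
    move=> a0 b1 ab; apply/eqP; rewrite -subr_eq0.
    have [||x _ ->] := @MVT_segment _ (fun y => P (s, y)) (fun=> 0) a b ab.
    - move=> x; rewrite in_itv /= => /andP[x1 x2]; apply: dPt; lra.
    - apply: continuous_in_subspaceT => x; rewrite inE /= in_itv /= => /andP[x1 x2].
      by apply: (is_derive_continuous (dPt x _)); lra.
    - by rewrite mul0r.
  move: cst; rewrite /cstrip /= => /andP[t0 t1].
  have [h|h] := leP t 2^-1; first by apply/esym/cst2 => //; lra.
  by apply: cst2 => //; lra.
exists (P (0, 2^-1) / pi) => s t ht.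
have -> : pi * (s + P (0, 2^-1) / pi) = P (s, t).
  rewrite (PE s t ht); have pi0 := lt0r_neq0 (pi_gt0 R).
  by rewrite mulrDr (mulrC pi (_ / _)) divfK.
have cst : cstrip (s, t) by [].
have := cayleyK K2 K1lt cst; rewrite -/P -/Q QE//= cosBpihalf sinBpihalf.
by rewrite mulrN.
Qed.

End HolomorphicOnStrip.

(** * Functions on the circle *)

Section PeriodicFunctions.
Context {R : realType}.
Implicit Types (f g : R -> R) (x z : R).

Definition periodic2pi f := forall x, f (x + pi *+ 2) = f x.

Lemma periodic2pi_int f (k : int) x : periodic2pi f -> f (x + (pi *+ 2) *~ k) = f x.
Proof.
move=> pf; have pn n y : f (y + (pi *+ 2) *+ n) = f y.
  by elim: n y => [|n IH] y; [rewrite mulr0n addr0|rewrite mulrS addrA IH pf].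
case: k => n; first exact: pn.
rewrite NegzE mulrNz -pmulrn -(pn n.+1 (x - _)).
by rewrite subrK.
Qed.

(** One representative serves all periodic functions simultaneously, so that relations between
    several of them can be checked on a single period. *)
Lemma periodic2pi_reduce z x : exists2 x0, z <= x0 < z + pi *+ 2 &
  forall f, periodic2pi f -> f x = f x0.
Proof.
have p0 : 0 < pi *+ 2 :> R by rewrite mulrn_wgt0 ?pi_gt0.
pose k := Num.floor ((x - z) / (pi *+ 2)).
exists (x + (pi *+ 2) *~ (- k)); last by move=> f pf; rewrite periodic2pi_int.
have := Num.Theory.floor_itv ((x - z) / (pi *+ 2)); rewrite -/k.
rewrite ler_pdivlMr// ltr_pdivrMr// intrD1 mulrDl mul1r mulrNz.
by rewrite -[_ *~ k]mulrzl => /andP[]; lra.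
Qed.

Lemma cos_sin_periodic f (s t : R) : periodic2pi f ->
  cos s = cos t -> sin s = sin t -> f s = f t.
Proof.
move=> pf cst sst; have [x0 hx0 red] := periodic2pi_reduce 0 (s - t).
have c1 : cos x0 = 1.
  by rewrite -(red cos (@cosD2pi R)) cosB cst sst -!expr2 cos2Dsin2.
suff x00 : x0 = 0.
  have := red (fun x => f (x + t)); rewrite subrK x00 add0r; apply => x.
  by rewrite addrAC pf.
move: hx0; rewrite add0r => /andP[x00 x02].
have [h|h] := leP x0 pi.
  by apply: cos_inj; rewrite ?in_itv /= ?lexx ?h ?x00 ?pi_ge0// cos0.
have : pi *+ 2 - x0 = 0.
  apply: cos_inj; rewrite ?in_itv /= ?lexx ?pi_ge0//.
    by move: x02 h; rewrite !mulr2n => ? ?; apply/andP; split; lra.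
  by rewrite cos0 cosB cos2pi sin2pi c1; ring.
by move: x02; lra.
Qed.

Lemma cos_sin_exists (a b : R) : a ^+ 2 + b ^+ 2 = 1 ->
  exists t, cos t = a /\ sin t = b.
Proof.
move=> ab; have a1 : -1 <= a <= 1 by nra.
have sb : Num.sqrt (1 - a ^+ 2) = `|b|.
  by rewrite -ab addrAC subrr add0r sqrtr_sqr.
have [b0|b0] := leP 0 b.
  by exists (acos a); rewrite acosK ?in_itv// sin_acos// sb ger0_norm.
by exists (- acos a); rewrite cosN sinN acosK ?in_itv// sin_acos// sb ltr0_norm// opprK.
Qed.

Lemma derive1_periodic f : periodic2pi f -> periodic2pi (derive1 f).
Proof.
move=> pf x; rewrite /derive1; congr (lim _).
suff -> : (fun h => h^-1 *: (f (h + (x + pi *+ 2)) - f (x + pi *+ 2))) =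
  (fun h => h^-1 *: (f (h + x) - f x)) by [].
by apply/funext => h; rewrite addrA !pf.
Qed.

End PeriodicFunctions.

(** * Smooth quotients across simple zeros of the denominator *)

Section SmoothQuotient.
Context {R : realType}.
Variables (f g : R -> R).
Hypotheses (fs : forall n, nderiv n setT f) (gs : forall n, nderiv n setT g).
Hypothesis fg0 : forall x, g x = 0 -> f x = 0 /\ derive1 g x != 0.

Definition squot x := if g x == 0 then derive1 f x / derive1 g x else f x / g x.

Let open_neq0 (k : R -> R) : (forall n, nderiv n setT k) -> open [set x | k x != 0].
Proof.
move=> ks; apply: (@open_comp _ _ k [set x | x != 0]); last exact: open_neq.
move=> x _; apply/differentiable_continuous/derivable1_diffP.
exact: (nderiv_derivable (ks 1%N)).
Qed.

Lemma squotK x : squot x * g x = f x.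
Proof.
rewrite /squot; have [gx|gx] := eqVneq (g x) 0; last by rewrite divfK.
by rewrite gx mulr0; case: (fg0 gx) => ->.
Qed.

(** Near a zero of [g] both functions are divided by the distance to it with [hadamard_quotient]; at
    the zero the quotient of [g] is its nonzero derivative, so it stays invertible nearby. *)
Lemma nderiv_squot n : nderiv n setT squot.
Proof.
apply: nderiv_local => x; have [gx|gx] := eqVneq (g x) 0; last first.
  exists [set x | g x != 0]; split => //; first exact: open_neq0.
  move=> k; apply: (@nderiv_eq _ _ _ (fun x => f x * (g x)^-1)).
  - exact: open_neq0.
  - by move=> y; rewrite inE /= /squot => /negbTE ->.
  - by apply: nderivM; [|apply: nderivV => //]; apply: nderiv_sub (@subsetT _ _) _.
have [fx g'x] := fg0 gx.
have [q1 [q1s q1x q1E]] := hadamard_quotient fs fx.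
have [q2 [q2s q2x q2E]] := hadamard_quotient gs gx.
exists [set x | q2 x != 0]; split; [exact: open_neq0|by rewrite /= q2x|].
move=> k; apply: (@nderiv_eq _ _ _ (fun x => q1 x * (q2 x)^-1)).
- exact: open_neq0.
- move=> y; rewrite inE /= /squot => q2y.
  have [->|yx] := eqVneq y x; first by rewrite gx eqxx q1x q2x.
  have yx0 : y - x != 0 by rewrite subr_eq0.
  by rewrite q1E q2E mulf_eq0 (negbTE yx0) (negbTE q2y)/=; field; rewrite yx0 q2y.
- by apply: nderivM; [|apply: nderivV => //]; apply: nderiv_sub (@subsetT _ _) _.
Qed.

End SmoothQuotient.

(** * Morse functions on the circle with two critical points *)

Section MorseFunction.
Context {R : realType}.
Implicit Types (f h : R -> R).

Lemma sign_right f (x0 x1 d : R) : (forall x, {for x, continuous f}) ->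
  f x0 = 0 -> is_derive x0 1 f d -> 0 < d ->
  (forall x, x0 < x < x1 -> f x != 0) -> forall x, x0 < x < x1 -> 0 < f x.
Proof.
move=> cf f0 df d0 fn0 x /andP[hx0 hx1]; rewrite ltNge; apply/negP => fx.
have d20 : 0 < d / 2 by rewrite divr_gt0.
have [r r0 Hr] := eps_is_derive df d20.
pose e := Num.min (r / 2) (x - x0).
have e0 : 0 < e by rewrite lt_min divr_gt0// subr_gt0.
have er : e <= r / 2 by rewrite ge_min lexx.
have ex : e <= x - x0 by rewrite ge_min lexx orbT.
have fe : 0 < f (x0 + e).
  have := Hr e; rewrite gtr0_norm// f0 subr0 => /(_ _)/wrap[]; first by lra.
  by rewrite ler_norml => /andP[+ _]; nra.
have ex' : x0 + e <= x by lra.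
have [|c] := IVT ex' (continuous_subspaceT cf) (v := 0).
  by rewrite ge_min fx orbT le_max ltW.
rewrite in_itv /= => /andP[c1 c2] fc0.
by have := fn0 c; rewrite fc0 eqxx => /(_ _)/wrap[]; lra.
Qed.

Lemma derive_le0_left f (x0 x1 d : R) : x0 < x1 -> f x1 = 0 -> is_derive x1 1 f d ->
  (forall x, x0 < x < x1 -> 0 < f x) -> d <= 0.
Proof.
move=> x01 f0 df fp; rewrite leNgt; apply/negP => d0.
have d20 : 0 < d / 2 by rewrite divr_gt0.
have [r r0 Hr] := eps_is_derive df d20.
pose e := Num.min (r / 2) ((x1 - x0) / 2).
have e0 : 0 < e by rewrite lt_min !divr_gt0// subr_gt0.
have er : e <= r / 2 by rewrite ge_min lexx.
have ex : e <= (x1 - x0) / 2 by rewrite ge_min lexx orbT.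
have := Hr (- e); rewrite normrN gtr0_norm// f0 subr0 => /(_ _)/wrap[]; first by lra.
have := fp (x1 - e) => /(_ _)/wrap[]; first by lra.
by rewrite ler_norml => ? /andP[_]; nra.
Qed.

(** Since [D = - h'], the point [m] is the maximum of [h] and [n] the minimum. A nondegenerate zero
    of [D] is a sign change, and consecutive zeros change sign in opposite directions. *)
Lemma morse_min_max h : morse_two_crit h ->
  let D (x : R) : R := - derive1 h x in
  exists m n, [/\ m < n < m + pi *+ 2,
    [/\ forall k, nderiv k setT D, periodic2pi D,
        forall x, D x = 0 -> derive1 D x != 0 & D m = 0 /\ D n = 0],
    0 < derive1 D m /\ derive1 D n < 0,
    forall x, m < x < n -> 0 < D x
  & forall x, n < x < m + pi *+ 2 -> D x < 0].
Proof.
move=> [sh ph nd [a [b [/andP[ab ba] crit]]]] D.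
have hs k : nderiv k setT h by apply: derive1n_nderiv.
have Ds k : nderiv k setT D by apply: nderivN; apply: nderiv_derive1 => //; exact: openT.
have DpD : periodic2pi D by move=> x; rewrite /D derive1_periodic.
have [D' D'E] : exists D' : R -> R, derive1 D = D' by exists (derive1 D).
have D'p : periodic2pi D' by rewrite -D'E; exact: derive1_periodic.
have dD (x : R) : is_derive x 1 D (D' x) by rewrite -D'E; exact: nderiv_is_derive (Ds 1%N).
have cD x : {for x, continuous D}.
  by apply/differentiable_continuous/derivable1_diffP; case: (dD x).
have DE : D' = fun x => - derive1n 2 h x.
  apply/funext => x; have := is_deriveN_fun (nderiv_is_derive x (nderiv_derive1 openT (hs 2%N))).
  by rewrite -D'E derive1nS derive1n1 [in LHS]derive1E => -[].
have D'0 x : D x = 0 -> D' x != 0.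
  move=> /eqP; rewrite oppr_eq0 => /eqP Dx; rewrite DE oppr_eq0.
  by apply: nd; rewrite derive1n1.
rewrite D'E; have zero x : a <= x < a + pi *+ 2 -> (D x = 0 <-> x = a \/ x = b).
  move=> hx; rewrite -(crit x hx) derive1n1 /D.
  by split=> [/eqP|->]; rewrite ?oppr_eq0 ?oppr0// => /eqP.
have pi20 : 0 < pi *+ 2 :> R by rewrite mulrn_wgt0 ?pi_gt0.
have Da : D a = 0 by apply/zero; [rewrite lexx ltrDl|left].
have Db : D b = 0 by apply/zero; [rewrite ltW|right].
have n1 x : a < x < b -> D x != 0.
  move=> /andP[ax xb]; apply/eqP => /zero[]; last by move=> e; move: ax xb; rewrite e => ?; rewrite ltxx.
    by rewrite ltW//=; exact: lt_trans xb ba.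
  by move=> e; move: ax; rewrite e ltxx.
have n2 x : b < x < a + pi *+ 2 -> D x != 0.
  move=> /andP[ax xb]; apply/eqP => /zero[]; last by move=> e; move: ax; rewrite e ltxx.
    by rewrite xb andbT ltW// (lt_trans ab ax).
  by move=> e; move: ax ab; rewrite e => ? ?; lra.
have Dpi : D (a + pi *+ 2) = 0 by rewrite DpD.
have cND x : {for x, continuous (fun x => - D x)} by apply: continuousN; exact: cD.
have dND (x : R) : is_derive x 1 (fun x => - D x) (- D' x) by exact: is_deriveN_fun.
(* If [a] is the minimum of [h], the period window is moved to start at [b]. *)
have := D'0 a Da; rewrite neq_lt => /orP[D'a|D'a].
- exists b, (a + pi *+ 2).
  have neg1 x : a < x < b -> 0 < - D x.
    apply: (sign_right cND _ (dND a)); rewrite ?Da ?oppr0 ?oppr_gt0// => y.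
    by rewrite oppr_eq0; exact: n1.
  have D'b : 0 < D' b.
    have := derive_le0_left ab _ (dND b) neg1; rewrite Db oppr0 => /(_ erefl).
    by rewrite oppr_le0 le_eqVlt eq_sym (negbTE (D'0 b Db)).
  split; [by rewrite ba/= ltrD2r|split => //|..].
  + by rewrite (D'p).
  + exact: (sign_right cD Db (dD b) D'b n2).
  + move=> x hx; rewrite -oppr_gt0; have := neg1 (x - pi *+ 2).
    by rewrite -(DpD (x - _)) subrK; apply; move: hx; lra.
- exists a, b.
  have pos1 x : a < x < b -> 0 < D x by exact: (sign_right cD Da (dD a) D'a n1).
  have D'b : D' b < 0.
    have := derive_le0_left ab Db (dD b) pos1.
    by rewrite le_eqVlt (negbTE (D'0 b Db)).
  split; [by rewrite ab|split => //|..] => //.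
  move=> x hx; rewrite -oppr_gt0; move: x hx; apply: (sign_right cND _ (dND b)).
  + by rewrite Db oppr0.
  + by rewrite oppr_gt0.
  + by move=> y; rewrite oppr_eq0; exact: n2.
Qed.

End MorseFunction.

(** * The angle Th on the circle and its inverse *)

Section CircleModel.
Context {R : realType}.
Variables (D : R -> R) (m n : R).
Hypotheses (mn : m < n < m + pi *+ 2)
  (Ds : forall k, nderiv k setT D) (Dp : periodic2pi D)
  (D'0 : forall x, D x = 0 -> derive1 D x != 0) (Dm : D m = 0) (Dn : D n = 0)
  (D'm : 0 < derive1 D m) (D'n : derive1 D n < 0)
  (Dpos : forall x, m < x < n -> 0 < D x)
  (Dneg : forall x, n < x < m + pi *+ 2 -> D x < 0).

Definition half_width : R := (n - m) / 2.
Local Notation nu := half_width.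

Let A x : R := sin (2^-1 * x + - (m / 2)).
Let B x : R := sin (- 2^-1 * x + n / 2).
Let N x := A x ^+ 2 + B x ^+ 2.

(* [ccos = cos Th] and [csin = sin Th] for the circle diffeomorphism given by
   [tan (Th / 2) = sin ((x - m) / 2) / sin ((n - x) / 2)], which sends [m] to
   [0] and [n] to [pi]; [cspeed] is its derivative. *)
Definition ccos x := (B x ^+ 2 - A x ^+ 2) * (N x)^-1.
Definition csin x := 2 * (A x * B x) * (N x)^-1.
Definition cspeed x := sin nu * (N x)^-1.
(** This is 2 sin Th / D with the singularities at the zeros of [D] removed; the positive factor 1 /
    N is kept outside [squot]. *)
Definition cscale x := 4 * squot (fun x => A x * B x) D x * (N x)^-1.

Lemma half_width_itv : 0 < nu < pi.
Proof.
by move: mn; rewrite /nu => /andP[? h]; apply/andP; split; [|move: h; rewrite mulr2n]; lra.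
Qed.

Lemma sin_half_width : 0 < sin nu.
Proof. exact/sin_gt0_pi/half_width_itv. Qed.

Let cosA x : R := cos (2^-1 * x + - (m / 2)).
Let cosB x : R := cos (- 2^-1 * x + n / 2).

Let BE x : B x = sin nu * cosA x - cos nu * A x.
Proof.
rewrite /B /cosA /A (_ : - 2^-1 * x + n / 2 = nu - (2^-1 * x + - (m / 2))) ?sinB//.
by rewrite /nu; field.
Qed.

Let cA1 x : cosA x ^+ 2 + A x ^+ 2 = 1. Proof. exact: cos2Dsin2. Qed.
Let cN1 : cos nu ^+ 2 + sin nu ^+ 2 = 1. Proof. exact: cos2Dsin2. Qed.

Let N_gt0 x : 0 < N x.
Proof.
rewrite /N lt0r addr_ge0 ?sqr_ge0// andbT paddr_eq0 ?sqr_ge0// !sqrf_eq0.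
apply/negP => /andP[/eqP a0 /eqP]; rewrite BE a0 mulr0 subr0 => /eqP.
rewrite mulf_eq0 (gt_eqF sin_half_width)/= => /eqP c0.
by have := cA1 x; rewrite a0 c0; lra.
Qed.

Let N_neq0 x : N x != 0. Proof. exact: lt0r_neq0. Qed.

Lemma ccos2Dcsin2 x : ccos x ^+ 2 + csin x ^+ 2 = 1.
Proof. by have := N_neq0 x; rewrite /ccos /csin /N => h; field. Qed.

Lemma cspeed_gt0 x : 0 < cspeed x.
Proof. by rewrite mulr_gt0 ?invr_gt0// sin_half_width. Qed.

Let dA (x : R) : is_derive x 1 A (cosA x * 2^-1).
Proof. exact: is_derive_compose (is_derive_sin _) (is_derive_affine _ _ _). Qed.

Let dB (x : R) : is_derive x 1 B (cosB x * - 2^-1).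
Proof. exact: is_derive_compose (is_derive_sin _) (is_derive_affine _ _ _). Qed.

(** Half of this constant is the Wronskian A' B - A B'; it makes the derivative of Th = 2 atan (A /
    B) equal to [sin nu / N]. *)
Let wronskian x : sin nu = cosA x * B x + A x * cosB x.
Proof.
rewrite /cosA /cosB /A /B; have := sinD (2^-1 * x + - (m / 2)) (- 2^-1 * x + n / 2).
rewrite (_ : 2^-1 * x + - (m / 2) + (- 2^-1 * x + n / 2) = nu); last by rewrite /nu; field.
by move=> ->; ring.
Qed.

Let dN (x : R) : is_derive x 1 N (cosA x * A x - cosB x * B x).
Proof.
have := is_deriveD_fun (is_deriveX_fun 2 (dA x)) (is_deriveX_fun 2 (dB x)).
by move/is_derive_eq; apply; rewrite /= !expr1; field.
Qed.

Let dNV (x : R) : is_derive x 1 (fun x => (N x)^-1)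
  (- (cosA x * A x - cosB x * B x) * (N x)^-1 ^+ 2).
Proof. exact: is_deriveV_fun. Qed.

Lemma is_derive_ccos (x : R) : is_derive x 1 ccos (- (cspeed x * csin x)).
Proof.
have dnum := is_deriveD_fun (is_deriveX_fun 2 (dB x)) (is_deriveN_fun (is_deriveX_fun 2 (dA x))).
have := is_deriveM_fun dnum (dNV x); move/is_derive_eq; apply.
rewrite /cspeed /csin (wronskian x) /= !expr1.
by have := N_neq0 x; rewrite /N => h; field.
Qed.

Lemma is_derive_csin (x : R) : is_derive x 1 csin (cspeed x * ccos x).
Proof.
have dnum := is_deriveM_fun (is_derive_cst (2 : R) x 1) (is_deriveM_fun (dA x) (dB x)).
have := is_deriveM_fun dnum (dNV x); move/is_derive_eq; apply.
rewrite /cspeed /ccos (wronskian x) /=.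
by have := N_neq0 x; rewrite /N => h; field.
Qed.

Let As k : nderiv k setT A. Proof. exact: (nderiv_sin_cos _ _ _ _).1. Qed.
Let Bs k : nderiv k setT B. Proof. exact: (nderiv_sin_cos _ _ _ _).1. Qed.
Let NVs k : nderiv k setT (fun x => (N x)^-1).
Proof. by apply: nderivV => //; apply: nderivD; exact: nderivX. Qed.
Let ABs k : nderiv k setT (fun x => A x * B x). Proof. exact: nderivM. Qed.

Lemma nderiv_ccos k : nderiv k setT ccos.
Proof. by apply: nderivM => //; apply: nderivB; exact: nderivX. Qed.

Lemma nderiv_csin k : nderiv k setT csin.
Proof. by apply: nderivM => //; apply: nderivM => //; exact: nderiv_cst. Qed.

Lemma nderiv_cspeed k : nderiv k setT cspeed.
Proof. by apply: nderivM => //; exact: nderiv_cst. Qed.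

Let Ap x : A (x + pi *+ 2) = - A x.
Proof.
by rewrite /A -sinDpi; congr sin; rewrite mulrDr mulr2n; field.
Qed.

Let Bp x : B (x + pi *+ 2) = - B x.
Proof.
rewrite /B (_ : _ + _ = - 2^-1 * x + n / 2 - pi); last by rewrite mulr2n; field.
by rewrite sinB cospi sinpi; ring.
Qed.

Let Np x : N (x + pi *+ 2) = N x. Proof. by rewrite /N Ap Bp !sqrrN. Qed.

Lemma periodic_ccos : periodic2pi ccos.
Proof. by move=> x; rewrite /ccos Np Ap Bp !sqrrN. Qed.

Lemma periodic_csin : periodic2pi csin.
Proof. by move=> x; rewrite /csin Np Ap Bp mulrNN. Qed.

Lemma periodic_cspeed : periodic2pi cspeed.
Proof. by move=> x; rewrite /cspeed Np. Qed.

Let ABp : periodic2pi (fun x => A x * B x).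
Proof. by move=> x; rewrite Ap Bp mulrNN. Qed.

Lemma periodic_cscale : periodic2pi cscale.
Proof.
move=> x; rewrite /cscale Np /squot Dp ABp (derive1_periodic Dp).
by rewrite (derive1_periodic ABp).
Qed.

Let Am : A m = 0. Proof. by rewrite /A (_ : _ + _ = 0) ?sin0//; field. Qed.
Let Bn : B n = 0. Proof. by rewrite /B (_ : _ + _ = 0) ?sin0//; field. Qed.
Let Bm : B m = sin nu. Proof. by rewrite /B /nu; congr sin; field. Qed.
Let An : A n = sin nu. Proof. by rewrite /A /nu; congr sin; field. Qed.

Let A_gt0 x : m < x < m + pi *+ 2 -> 0 < A x.
Proof.
move=> /andP[a b]; apply: sin_gt0_pi; rewrite mulr2n in b.
by apply/andP; split; lra.
Qed.

Let B_gt0 x : m < x < n -> 0 < B x.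
Proof.
move=> /andP[a b]; apply: sin_gt0_pi; have := half_width_itv; rewrite /nu => /andP[_ c].
by apply/andP; split; lra.
Qed.

Let B_lt0 x : n < x < m + pi *+ 2 -> B x < 0.
Proof.
move=> /andP[a b]; rewrite -oppr_gt0 /B -sinN; apply: sin_gt0_pi.
by rewrite mulr2n in b; move: mn => /andP[c _]; apply/andP; split; lra.
Qed.

Lemma ccosm : ccos m = 1 /\ csin m = 0.
Proof.
split; last by rewrite /csin Am mul0r mulr0 mul0r.
by rewrite /ccos /N Am expr0n /= subr0 add0r mulfV// sqrf_eq0 Bm gt_eqF// sin_half_width.
Qed.

Lemma ccosn : ccos n = -1 /\ csin n = 0.
Proof.
split; last by rewrite /csin Bn !mulr0 mul0r.
by rewrite /ccos /N Bn expr0n /= add0r addr0 mulNr mulfV// sqrf_eq0 An gt_eqF// sin_half_width.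
Qed.

Let zeroD x0 : m <= x0 < m + pi *+ 2 -> D x0 = 0 -> x0 = m \/ x0 = n.
Proof.
move=> /andP[a b] Dx; have [xm|xm] := eqVneq x0 m; first by left.
right; have [xn|xn|//] := ltgtP x0 n.
- by have := @Dpos x0; rewrite xn lt_neqAle eq_sym xm a Dx ltxx => /(_ isT).
- by have := @Dneg x0; rewrite xn b Dx ltxx => /(_ isT).
Qed.

Let dAB (x : R) : derive1 (fun x => A x * B x) x =
  cosA x * 2^-1 * B x + A x * (cosB x * - 2^-1).
Proof. by rewrite derive1E; case: (is_deriveM_fun (dA x) (dB x)). Qed.

Let AB0 x : D x = 0 -> A x * B x = 0 /\ derive1 D x != 0.
Proof.
move=> Dx; split; last exact: D'0.
have [x0 hx0 red] := periodic2pi_reduce m x.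
rewrite (red _ ABp); rewrite (red _ Dp) in Dx.
by case: (zeroD hx0 Dx) => ->; rewrite ?Am ?Bn ?mul0r ?mulr0.
Qed.

Lemma nderiv_cscale k : nderiv k setT cscale.
Proof.
apply: nderivM => //; apply: nderivM; first exact: nderiv_cst.
exact: nderiv_squot.
Qed.

Lemma cscaleD x : cscale x * D x = 2 * csin x.
Proof.
rewrite /cscale /csin -(squotK AB0 x); ring.
Qed.

(** [A * B] and [D] have the same sign on each of the two arcs; at the endpoints the quotient is
    that of their derivatives, both positive at [m] and both negative at [n]. *)
Lemma cscale_gt0 x : 0 < cscale x.
Proof.
have [x0 hx0 red] := periodic2pi_reduce m x; rewrite (red _ periodic_cscale).
rewrite /cscale !mulr_gt0 ?invr_gt0// /squot; have [D0|D0] := eqVneq (D x0) 0.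
- have snu := sin_half_width; case: (zeroD hx0 D0) => ->; rewrite dAB.
    have := wronskian m; rewrite Am Bm mul0r addr0 => e.
    by rewrite mul0r addr0 divr_gt0// mulrAC -e divr_gt0.
  have := wronskian n; rewrite An Bn mulr0 add0r => e.
  rewrite nmulr_rgt0 ?invr_lt0// mulr0 add0r mulrA -e.
  by rewrite pmulr_rlt0// oppr_lt0.
- case/andP: hx0 => a b; have xm : m < x0.
    by rewrite lt_neqAle a andbT; apply: contra D0 => /eqP <-; rewrite Dm.
  have [xn|xn|xn] := ltgtP x0 n.
  + by rewrite divr_gt0 ?mulr_gt0 ?B_gt0 ?A_gt0 ?Dpos// ?xm.
  + rewrite nmulr_rgt0; first by rewrite invr_lt0 Dneg ?xn.
    by rewrite pmulr_rlt0 ?B_lt0 ?A_gt0 ?xn ?xm.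
  + by move: D0; rewrite xn Dn eqxx.
Qed.

(* If [c = cos Th] and [s = sin Th] at the point [x], then [e^(i (x - m))] is
   [(cos (Th / 2) + sin (Th / 2) e^(i nu))^2 / (1 + s cos nu)]. *)
Let dinv (s : R) := 1 + s * cos nu.
Let u1 (c s : R) := (1 + c) / 2 + s * cos nu + (1 - c) / 2 * (cos nu ^+ 2 - sin nu ^+ 2).
Let u2 (c s : R) := s * sin nu + (1 - c) / 2 * (2 * sin nu * cos nu).

Definition icos (c s : R) := (cos m * u1 c s - sin m * u2 c s) / dinv s.
Definition isin (c s : R) := (sin m * u1 c s + cos m * u2 c s) / dinv s.

Lemma icos_denom_gt0 (c s : R) : c ^+ 2 + s ^+ 2 = 1 -> 0 < 1 + s * cos nu.
Proof.
by move=> cs; have := sin_half_width; have := cN1; nra.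
Qed.

Let dinvE x : dinv (csin x) = sin nu ^+ 2 / N x.
Proof.
have key : N x + 2 * (A x * B x) * cos nu = sin nu ^+ 2.
  have c2 : cosA x ^+ 2 = 1 - A x ^+ 2 by have := cA1 x; lra.
  have n2 : cos nu ^+ 2 = 1 - sin nu ^+ 2 by have := cN1; lra.
  rewrite /N BE; transitivity (A x ^+ 2 * (1 - cos nu ^+ 2) + sin nu ^+ 2 * cosA x ^+ 2).
    by ring.
  by rewrite c2 n2; ring.
by have Nx := N_neq0 x; rewrite /dinv /csin -key; field.
Qed.

Lemma icosK x : icos (ccos x) (csin x) = cos x /\ isin (ccos x) (csin x) = sin x.
Proof.
have snu := lt0r_neq0 sin_half_width.
(* [v1] and [v2] compute cos (x - m) and sin (x - m); [m] is then added back by the addition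
   formulas. *)
have v1 : u1 (ccos x) (csin x) / dinv (csin x) = cosA x ^+ 2 - A x ^+ 2.
  rewrite dinvE /u1 /ccos /csin; have := N_neq0 x; rewrite /N BE => h.
  by field; rewrite h snu.
have v2 : u2 (ccos x) (csin x) / dinv (csin x) = 2 * cosA x * A x.
  rewrite dinvE /u2 /ccos /csin; have := N_neq0 x; rewrite /N BE => h.
  by field; rewrite h snu.
have e (k : R -> R) : k x = k (m + (2^-1 * x + - (m / 2)) *+ 2) by congr k; rewrite mulr2n; field.
rewrite /icos /isin (e cos) (e sin) cosD sinD cos_mulr2n sin_mulr2n -/(cosA x) -/(A x).
have c2 : cosA x ^+ 2 *+ 2 - 1 = cosA x ^+ 2 - A x ^+ 2 by have := cA1 x; rewrite mulr2n; lra.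
have s2 : (cosA x * A x) *+ 2 = 2 * cosA x * A x by rewrite mulr2n; ring.
rewrite c2 s2 -v1 -v2; split; first by rewrite mulrBl !mulrA.
by rewrite mulrDl !mulrA.
Qed.

Lemma ccos_csin_surj (c s : R) : c ^+ 2 + s ^+ 2 = 1 ->
  exists x, ccos x = c /\ csin x = s.
Proof.
move=> cs; have [T [cT sT]] := cos_sin_exists cs.
pose p := cos (T / 2); pose q := sin (T / 2).
have pq : p ^+ 2 + q ^+ 2 = 1 by exact: cos2Dsin2.
have T2 : T = (T / 2) *+ 2 by rewrite mulr2n; lra.
have ce : c = p ^+ 2 - q ^+ 2.
  rewrite -cT T2 cos_mulr2n -/p; have := pq; rewrite mulr2n; lra.
have se : s = 2 * p * q by rewrite -sT T2 sin_mulr2n -/p -/q mulr2n; ring.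
have d0 := icos_denom_gt0 cs; set d := 1 + _ in d0.
pose r := Num.sqrt d; have r0 : 0 < r by rewrite sqrtr_gt0.
have r2 : r ^+ 2 = d by rewrite sqr_sqrtr// ltW.
have r00 := lt0r_neq0 r0.
(* [t] plays the role of (x - m) / 2: it is the argument of p + q exp (i nu), a number of squared
   modulus [d]. *)
have [|t [ct st]] := @cos_sin_exists _ ((p + q * cos nu) / r) (q * sin nu / r).
  have -> : ((p + q * cos nu) / r) ^+ 2 + (q * sin nu / r) ^+ 2 =
     (p ^+ 2 + q ^+ 2 * (cos nu ^+ 2 + sin nu ^+ 2) + 2 * p * q * cos nu) / r ^+ 2.
    by field.
  by rewrite r2 cN1 mulr1 pq -se mulfV// gt_eqF.
exists (m + t *+ 2).
have cAt : cosA (m + t *+ 2) = cos t by rewrite /cosA; congr cos; rewrite mulr2n; field.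
have At : A (m + t *+ 2) = sin t by rewrite /A; congr sin; rewrite mulr2n; field.
have Bt : B (m + t *+ 2) = p * sin nu / r.
  by rewrite BE cAt At ct st; field.
have At' : A (m + t *+ 2) = q * sin nu / r by rewrite At st.
have snu := lt0r_neq0 sin_half_width.
have Nt : N (m + t *+ 2) = sin nu ^+ 2 / r ^+ 2.
  have -> : N (m + t *+ 2) = (p ^+ 2 + q ^+ 2) * (sin nu ^+ 2 / r ^+ 2).
    by rewrite /N Bt At'; field.
  by rewrite pq mul1r.
by rewrite /ccos /csin Nt Bt At' ce se; split; field; rewrite r00 snu.
Qed.

End CircleModel.

(** * The punctured plane *)

Section PolarAngle.
Context {R : realType}.
Implicit Types (a b : R) (H : R -> R).

Lemma polar_exists a b : exists t,
  a = Num.sqrt (a ^+ 2 + b ^+ 2) * cos t /\ b = Num.sqrt (a ^+ 2 + b ^+ 2) * sin t.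
Proof.
set r := Num.sqrt _; have r2 : r ^+ 2 = a ^+ 2 + b ^+ 2.
  by rewrite sqr_sqrtr// addr_ge0 ?sqr_ge0.
have [r0|r0] := eqVneq r 0.
  exists 0; rewrite r0 !mul0r; move/eqP: r2; rewrite r0 expr0n eq_sym.
  by rewrite paddr_eq0 ?sqr_ge0// !sqrf_eq0 => /andP[/eqP-> /eqP->].
have [|t [ct st]] := @cos_sin_exists _ (a / r) (b / r).
  by rewrite !expr_div_n -mulrDl -r2 mulfV// expf_neq0.
by exists t; rewrite ct st; split; rewrite mulrC divfK.
Qed.

(** An arbitrary choice of angle, with no continuity; its value matters only through 2 pi-periodic
    functions. *)
Definition carg a b : R := projT1 (cid (polar_exists a b)).

Lemma cargP a b : a = Num.sqrt (a ^+ 2 + b ^+ 2) * cos (carg a b) /\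
  b = Num.sqrt (a ^+ 2 + b ^+ 2) * sin (carg a b).
Proof. exact: projT2 (cid (polar_exists a b)). Qed.

Lemma periodic_carg H r t : periodic2pi H -> 0 < r ->
  H (carg (r * cos t) (r * sin t)) = H t.
Proof.
move=> pH r0; have := cargP (r * cos t) (r * sin t).
have -> : (r * cos t) ^+ 2 + (r * sin t) ^+ 2 = r ^+ 2.
  by rewrite !exprMn -mulrDr cos2Dsin2 mulr1.
rewrite sqrtr_sqr gtr0_norm// => -[e1 e2]; have r00 := lt0r_neq0 r0.
by apply: cos_sin_periodic => //; apply: (mulfI r00).
Qed.

(** In the half plane around a base point the angle is the base angle plus the arctangent of cross
    product over dot product. This smooth local expression stands in for [carg] when continuity and
    derivatives are proved. *)
Lemma carg_near H a0 b0 a b : periodic2pi H -> 0 < a0 * a + b0 * b ->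
  H (carg a b) = H (carg a0 b0 + atan ((a0 * b - b0 * a) / (a0 * a + b0 * b))).
Proof.
move=> pH; set p := a0 * a + b0 * b; set q := a0 * b - b0 * a => p0.
have [e1 e2] := cargP a0 b0; set r := Num.sqrt _ in e1 e2; set t := carg a0 b0 in e1 e2 *.
have r2 : r ^+ 2 = a0 ^+ 2 + b0 ^+ 2 by rewrite sqr_sqrtr// addr_ge0 ?sqr_ge0.
have r0 : 0 < r.
  rewrite lt0r sqrtr_ge0 andbT; apply/eqP => r0; move: p0.
  by rewrite /p e1 e2 r0 !mul0r addr0 ltxx.
set d := atan (q / p); pose k := p / (r * cos d).
have cd : 0 < cos d by apply: cos_gt0_pihalf; rewrite atan_gtNpi2 atan_ltpi2.
have sd : sin d = q / p * cos d.
  by rewrite -(atanK (q / p)) /tan -/d divfK// gt_eqF.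
have k0 : 0 < k by rewrite divr_gt0// mulr_gt0.
have r00 := lt0r_neq0 r0; have p00 := lt0r_neq0 p0; have cd0 := lt0r_neq0 cd.
have ct : cos t = a0 / r by rewrite e1 mulrC mulKf.
have st : sin t = b0 / r by rewrite e2 mulrC mulKf.
have ea : a = k * cos (t + d).
  rewrite cosD sd ct st /k; apply: (mulfI (expf_neq0 2 r00)).
  have -> : r ^+ 2 * (p / (r * cos d) * (a0 / r * cos d - b0 / r * (q / p * cos d))) =
    a0 * p - b0 * q by field; rewrite r00 p00.
  by rewrite r2 /p /q; ring.
have eb : b = k * sin (t + d).
  rewrite sinD sd ct st /k; apply: (mulfI (expf_neq0 2 r00)).
  have -> : r ^+ 2 * (p / (r * cos d) * (b0 / r * cos d + a0 / r * (q / p * cos d))) =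
    b0 * p + a0 * q by field; rewrite r00 p00.
  by rewrite r2 /p /q; ring.
by rewrite {1}ea {1}eb periodic_carg.
Qed.

Lemma is_derive_carg1 H (f g : R -> R) (x f' g' : R) : periodic2pi H -> nderiv 1 setT H ->
  f x ^+ 2 + g x ^+ 2 != 0 -> is_derive x 1 f f' -> is_derive x 1 g g' ->
  is_derive x 1 (fun y => H (carg (f y) (g y)))
    (derive1 H (carg (f x) (g x)) * ((f x * g' - g x * f') / (f x ^+ 2 + g x ^+ 2))).
Proof.
move=> pH sH fg0 df dg.
have cM (c : R) (k : R -> R) k' : is_derive x 1 k k' -> is_derive x 1 (fun y => c * k y) (c * k').
  by move=> dk; have := is_deriveM_fun (is_derive_cst c x 1) dk; rewrite mul0r add0r.
pose p y := f x * f y + g x * g y; pose q y := f x * g y - g x * f y.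
have dp : is_derive x 1 p (f x * f' + g x * g') := is_deriveD_fun (cM _ _ _ df) (cM _ _ _ dg).
have dq : is_derive x 1 q (f x * g' - g x * f') :=
  is_deriveD_fun (cM _ _ _ dg) (is_deriveN_fun (cM _ _ _ df)).
have px : p x = f x ^+ 2 + g x ^+ 2 by rewrite /p; ring.
have qx : q x = 0 by rewrite /q; ring.
have p0 : 0 < p x by rewrite px lt0r fg0 addr_ge0 ?sqr_ge0.
have pn0 := lt0r_neq0 p0.
have pnear : \forall y \near x, 0 < p y.
  exact: (cvgr_gt _ (is_derive_continuous dp) _ p0).
have d1 := is_deriveM_fun dq (is_deriveV_fun pn0 dp).
have d2 := is_derive_compose (is_derive1_atan _) d1.
have d3 := is_deriveD_fun (is_derive_cst (carg (f x) (g x)) x 1) d2.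
have dH : is_derive (carg (f x) (g x) + atan (q x * (p x)^-1)) 1 H
    (derive1 H (carg (f x) (g x) + atan (q x * (p x)^-1))).
  exact: nderiv_is_derive sH.
have := @is_derive_compose _ _ H
  (fun y => carg (f x) (g x) + atan (q y * (p y)^-1)) x 1 _ _ dH d3.
rewrite qx !mul0r atan0 addr0 expr0n addr0 invr1 mul1r add0r addr0 -px => d4.
apply: is_derive_near d4.
by apply: filterS pnear => y py; rewrite (carg_near pH py).
Qed.

Lemma is_derive_carg (V : normedModType R) H (f g : V -> R) (p v : V) (f' g' : R) :
  periodic2pi H -> nderiv 1 setT H ->
  f p ^+ 2 + g p ^+ 2 != 0 -> is_derive p v f f' -> is_derive p v g g' ->
  is_derive p v (fun y => H (carg (f y) (g y)))
    (derive1 H (carg (f p) (g p)) * ((f p * g' - g p * f') / (f p ^+ 2 + g p ^+ 2))).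
Proof.
move=> pH sH fg0 /is_derive_line df /is_derive_line dg; apply/is_derive_line.
have := @is_derive_carg1 H (fun h => f (h *: v + p)) (fun h => g (h *: v + p)) 0 f' g' pH sH.
by rewrite scale0r add0r; apply.
Qed.

Lemma continuous_carg H (F G : R * R -> R) (p : R * R) : periodic2pi H ->
  nderiv 1 setT H -> F p ^+ 2 + G p ^+ 2 != 0 ->
  {for p, continuous F} -> {for p, continuous G} ->
  {for p, continuous (fun p => H (carg (F p) (G p)))}.
Proof.
move=> pH sH FG0 cF cG.
pose a x := F p * F x + G p * G x; pose b x := F p * G x - G p * F x.
have cc (c : R) (k : R * R -> R) : {for p, continuous k} -> {for p, continuous (fun x => c * k x)}.
  by move=> ck; apply: continuousM => //; exact: cst_continuous.
have ca : {for p, continuous a} by apply: continuousD; apply: (cc _ _).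
have cb : {for p, continuous b} by apply: continuousB; apply: (cc _ _).
have a0 : 0 < a p by rewrite /a -!expr2 lt0r FG0// addr_ge0 ?sqr_ge0.
have cL : {for p, continuous (fun x => H (carg (F p) (G p) + atan (b x * (a x)^-1)))}.
  apply: (@continuous_comp _ _ _ (fun x => carg (F p) (G p) + atan (b x * (a x)^-1)) H).
    apply: continuousD; first exact: cst_continuous.
    apply: continuous_comp; last exact: continuous_atan.
    by apply: continuousM => //; apply: continuousV => //; exact: lt0r_neq0.
  exact: (is_derive_continuous (nderiv_is_derive _ sH)).
have anear : \forall x \near p, 0 < a x by exact: (cvgr_gt _ ca).
rewrite /prop_for /continuous_at.
rewrite (carg_near (a0 := F p) (b0 := G p) pH) ?a0//.
apply: cvg_trans cL; apply: near_eq_cvg; apply: filterS anear => x ax.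
by rewrite (carg_near pH ax).
Qed.

Lemma pderiv_carg n D (F G : R * R -> R) H : periodic2pi H ->
  (forall k, nderiv k setT H) -> (forall p, D p -> F p ^+ 2 + G p ^+ 2 != 0) ->
  pderiv n D F -> pderiv n D G -> pderiv n D (fun p => H (carg (F p) (G p))).
Proof.
move=> + + FG0; elim: n H => [|n IH] H pH sH Fn Gn;
  (split; first by move=> p Dp; exact: (continuous_carg pH (sH 1%N) (FG0 _ Dp)
    (pderiv_continuous Fn Dp) (pderiv_continuous Gn Dp))).
  by [].
case: (Fn) (Gn) => _ [F1 [F2 [dF F1n F2n]]] [_ [G1 [G2 [dG G1n G2n]]]].
move/pderivS in Fn; move/pderivS in Gn.
pose q p := (F p ^+ 2 + G p ^+ 2)^-1.
exists (fun p => derive1 H (carg (F p) (G p)) * ((F p * G1 p - G p * F1 p) * q p)),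
  (fun p => derive1 H (carg (F p) (G p)) * ((F p * G2 p - G p * F2 p) * q p)).
have qn : pderiv n D q.
  by apply: pderivV => //; apply: pderivD; exact: pderivX.
have Hn : pderiv n D (fun p => derive1 H (carg (F p) (G p))).
  apply: IH => //; first exact: derive1_periodic.
  by move=> k; apply: nderiv_derive1; [exact: openT|exact: sH].
split.
- move=> p Dp; have [[? ?] [? ?]] := (dF _ Dp, dG _ Dp).
  by split; exact: (is_derive_carg pH (sH 1%N) (FG0 _ Dp)).
- by apply: pderivM => //; apply: pderivM => //; apply: pderivB; exact: pderivM.
- by apply: pderivM => //; apply: pderivM => //; apply: pderivB; exact: pderivM.
Qed.

End PolarAngle.

(** * Almost complex structures in logarithmic coordinates *)

Section AlmostComplexStructure.
Context {R : realType}.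
Implicit Types (w v : R[i]) (k p : R -> R -> R).

Lemma sqrD_neq0 (a b : R) : (a +i* b != 0) = (a ^+ 2 + b ^+ 2 != 0).
Proof. by rewrite eq_complex paddr_eq0 ?sqr_ge0// !sqrf_eq0. Qed.

Lemma divcE (a b c d : R) : (c +i* d) / (a +i* b) =
  ((c * a + d * b) / (a ^+ 2 + b ^+ 2)) +i* ((d * a - c * b) / (a ^+ 2 + b ^+ 2)).
Proof.
apply/eqP; rewrite eq_complex /=; apply/andP; split; apply/eqP.
  by rewrite !mulrN opprK !mulrA -mulrDl.
by rewrite mulrN !mulrA addrC -mulrBl.
Qed.

Lemma omegaE (a b c d c' d' : R) : a ^+ 2 + b ^+ 2 != 0 ->
  omega (a +i* b) (c +i* d) (c' +i* d') =
  (1 + (a ^+ 2 + b ^+ 2) ^- 2) * (d * c' - c * d').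
Proof.
move=> ab0; rewrite /omega /Omega /Defs.hermitian /mxtrace !big_ord_recl big_ord0.
rewrite !mxE !big_ord_recl !big_ord0 !mxE /=.
have -> : (a * a - b * b) ^+ 2 + (a * b + b * a) ^+ 2 = (a ^+ 2 + b ^+ 2) ^+ 2 by ring.
by field.
Qed.

(* In the coordinate [v / w] on the tangent space this is the matrix
   [[- p, - (1 + p ^+ 2) / k], [k, p]]. *)
Definition logJ k p w v : R[i] :=
  let q := v / w in
  let kw := k (complex.Re w) (complex.Im w) in
  let pw := p (complex.Re w) (complex.Im w) in
  w * ((- pw * complex.Re q - (1 + pw ^+ 2) / kw * complex.Im q) +i*
       (kw * complex.Re q + pw * complex.Im q)).

Lemma logJ_div k p w v : w != 0 -> logJ k p w v / w =
  (- p (complex.Re w) (complex.Im w) * complex.Re (v / w)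
    - (1 + p (complex.Re w) (complex.Im w) ^+ 2) / k (complex.Re w) (complex.Im w)
       * complex.Im (v / w)) +i*
  (k (complex.Re w) (complex.Im w) * complex.Re (v / w)
    + p (complex.Re w) (complex.Im w) * complex.Im (v / w)).
Proof. by move=> w0; rewrite /logJ mulrC mulKf. Qed.

Let punctured : set (R * R) := [set x | x != 0].

Lemma punctured_sqrD (x : R * R) : x != 0 -> x.1 ^+ 2 + x.2 ^+ 2 != 0.
Proof. by case: x => a b; rewrite paddr_eq0 ?sqr_ge0// !sqrf_eq0. Qed.

(** In the coordinate q = v / w the matrix has trace 0 and determinant 1, and omega (v, v') is a
    positive multiple of Im q Re q' - Re q Im q'. For q = c + i d the positivity condition becomes
    ((k c + p d)^2 + d^2) / k > 0. *)
Lemma compatible_logJ k p : (forall a b, a ^+ 2 + b ^+ 2 != 0 -> 0 < k a b) ->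
  (forall n, pderiv n punctured (fun x => k x.1 x.2)) ->
  (forall n, pderiv n punctured (fun x => p x.1 x.2)) ->
  compatible_acs (logJ k p).
Proof.
move=> k0 ks ps; split.
- move=> w a v v' w0; rewrite /logJ mulrDl -mulrA.
  set K := k _ _; set P := p _ _; case: (v / w) => c d; case: (v' / w) => c' d'.
  rewrite [RHS]addrC mulrCA -mulrDr [LHS]mulrC [RHS]mulrC; congr (_ * _).
  by apply/eqP; rewrite eq_complex /=; apply/andP; split; apply/eqP; ring.
- move=> w v w0; rewrite [LHS]/logJ logJ_div//.
  have K0 : k (complex.Re w) (complex.Im w) != 0.
    by apply/lt0r_neq0/k0; move: w0; case: w => a b; rewrite sqrD_neq0.
  set K := k _ _ in K0 *; set P := p _ _; rewrite (_ : - v = w * - (v / w)); last by rewrite mulrN mulrC divfK.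
  congr (_ * _); case: (v / w) => c d /=.
  by apply/eqP; rewrite eq_complex /=; apply/andP; split; apply/eqP; field.
- move=> w v w0 v0; have K0 : 0 < k (complex.Re w) (complex.Im w).
    by apply: k0; move: w0; case: w => a b; rewrite sqrD_neq0.
  move: w0 v0 K0; case: w => a b; rewrite sqrD_neq0 => ab0.
  rewrite /logJ /=; set K := k _ _; set P := p _ _ => v0 K0.
  have w0 : a +i* b != 0 by rewrite sqrD_neq0.
  have q0 : v / (a +i* b) != 0 by rewrite mulf_neq0// invr_eq0.
  rewrite -(divfK w0 v); move: q0; case: (v / (a +i* b)) => c d; rewrite sqrD_neq0 => cd0.
  rewrite mulfK//= ; set x := _ - _; set y := _ + _.
  change (0 < omega (a +i* b) ((a * x - b * y) +i* (a * y + b * x))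
    ((c * a - d * b) +i* (c * b + d * a))); rewrite omegaE//.
  apply: mulr_gt0; first by rewrite ltr_pwDl// invr_ge0 exprn_ge0// addr_ge0 ?sqr_ge0.
  have -> : (a * y + b * x) * (c * a - d * b) - (a * x - b * y) * (c * b + d * a) =
    (a ^+ 2 + b ^+ 2) * ((K * c + P * d) ^+ 2 + d ^+ 2) / K.
    by rewrite /x /y; field; exact: lt0r_neq0.
  rewrite divr_gt0// mulr_gt0//.
    by rewrite lt0r ab0 addr_ge0 ?sqr_ge0.
  have [d0|d0] := eqVneq d 0; last by rewrite ltr_wpDl ?sqr_ge0// lt0r sqrf_eq0 d0 sqr_ge0.
  move: cd0; rewrite d0 expr0n addr0 mulr0 addr0 sqrf_eq0 => c0.
  by rewrite addr0 lt0r sqr_ge0 andbT sqrf_eq0 mulf_neq0// gt_eqF.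
- move=> [c d]; have op : open punctured.
    rewrite (_ : punctured = ~` [set 0]); first exact/closed_openC/accessible_closed_set1/hausdorff_accessible/norm_hausdorff.
    by apply/seteqP; split => x /=; [move=> /eqP|move=> H; apply/eqP].
  have sq n : pderiv n punctured (fun x => (x.1 ^+ 2 + x.2 ^+ 2)^-1).
    apply: pderivV => [x|]; first exact: punctured_sqrD.
    by apply: pderivD; apply: pderivX; [exact: pderiv_fst|exact: pderiv_snd].
  have q1 n : pderiv n punctured (fun x => (c * x.1 + d * x.2) * (x.1 ^+ 2 + x.2 ^+ 2)^-1).
    by apply: pderivM => //; apply: pderivD; apply: pderivM;
       [exact: pderiv_cst|exact: pderiv_fst|exact: pderiv_cst|exact: pderiv_snd].
  have q2 n : pderiv n punctured (fun x => (d * x.1 - c * x.2) * (x.1 ^+ 2 + x.2 ^+ 2)^-1).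
    by apply: pderivM => //; apply: pderivB; apply: pderivM;
       [exact: pderiv_cst|exact: pderiv_fst|exact: pderiv_cst|exact: pderiv_snd].
  have kV n : pderiv n punctured (fun x => (k x.1 x.2)^-1).
    by apply: pderivV => // x /punctured_sqrD /k0 /lt0r_neq0.
  have r1 n := pderivB (pderivM (pderivN (ps n)) (q1 n))
    (pderivM (pderivM (pderivD (pderiv_cst n punctured 1) (pderivX 2 (ps n))) (kV n)) (q2 n)).
  have r2 n := pderivD (pderivM (ks n) (q1 n)) (pderivM (ps n) (q2 n)).
  have f1 n := pderiv_fst n punctured; have f2 n := pderiv_snd n punctured.
  move=> n; split.
  + apply: (class_C_eq op _ (pderiv_class_C op (pderivB (pderivM (f1 n) (r1 n)) (pderivM (f2 n) (r2 n))))).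
    by move=> x _; rewrite /logJ divcE.
  + apply: (class_C_eq op _ (pderiv_class_C op (pderivD (pderivM (f1 n) (r2 n)) (pderivM (f2 n) (r1 n))))).
    by move=> x _; rewrite /logJ divcE.
Qed.

End AlmostComplexStructure.

(** * The category *)

Section FreeModules.

Lemma ffun_row_bijective (T : finType) n (e : #|T| = n) :
  let f (g : {ffun T -> int}) : 'rV[int]_n := \row_i g (enum_val (cast_ord (esym e) i)) in
  bijective f /\ forall g h, f (g + h) = f g + f h.
Proof.
move=> f; split; last by move=> g h; apply/rowP => i; rewrite !mxE ffunE.
exists (fun v : 'rV[int]_n => [ffun x => v 0 (cast_ord e (enum_rank x))]) => [g|v].
  by apply/ffunP => x; rewrite ffunE mxE cast_ordK enum_rankK.
by apply/rowP => i; rewrite mxE ffunE enum_valK cast_ordKV.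
Qed.

Lemma row_split_bijective a b :
  let f (v : 'rV[int]_(a + b)) : 'rV[int]_a * 'rV[int]_b := (lsubmx v, rsubmx v) in
  bijective f /\ forall v w, f (v + w) = f v + f w.
Proof.
move=> f; split; last first.
  by move=> v w; congr (_, _); apply/rowP => i; rewrite !mxE.
exists (fun p : 'rV[int]_a * 'rV[int]_b => row_mx p.1 p.2) => [v|[v w]].
  exact: hsubmxK.
by rewrite /f /= row_mxKl row_mxKr.
Qed.

Lemma zero_dif_iso (A B : cochain) (f : forall k, cx A k -> cx B k) :
  (forall k, bijective (f k) /\ forall x y, f k (x + y) = f k x + f k y) ->
  (forall k l (x : cx A k), dif l x = 0) -> (forall k l (x : cx B k), dif l x = 0) ->
  cochain_iso A B.
Proof.
move=> fP A0 B0; exists f; split; [by move=> k; case: (fP k)|by move=> k; case: (fP k)|].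
move=> k l x; rewrite A0 B0; case: (fP l) => _ fD.
by apply: (addrI (f l 0)); rewrite -fD !addr0.
Qed.

End FreeModules.

Lemma ord2P (i : 'I_2) : i = 0 \/ i = 1.
Proof. by case: i => [[|[|//]] ?]; [left|right]; apply: val_inj. Qed.

Section TwoObjects.
Variable C : ainf_cat 'I_2.
Variables (e : 'I_2 -> gen C) (x y : gen C).
Hypotheses (eU : forall i, strict_unit i (e i))
  (e_only : forall i (g : gen C), src g = i -> tgt g = i -> g = e i)
  (directed : forall i j : 'I_2, (j < i)%N -> forall g : gen C, ~ (src g = i /\ tgt g = j))
  (xP : [/\ src x = 0, tgt x = 1 & deg x = 0]) (yP : [/\ src y = 0, tgt y = 1 & deg y = 1])
  (xy_only : forall g : gen C, src g = 0 -> tgt g = 1 -> g = x \/ g = y)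
  (mu1_xy : forall b c : gen C, src b = 0 -> tgt b = 1 -> mu [:: b] c = 0).

Let endpoints (g : gen C) : g = e (src g) /\ tgt g = src g \/ src g = 0 /\ tgt g = 1.
Proof.
case: (ord2P (src g)) (ord2P (tgt g)) => s0 [] t0; rewrite s0 t0.
- by left; split=> //; exact: e_only.
- by right.
- by have := @directed 1 0 isT g; case.
- by left; split=> //; exact: e_only.
Qed.

Lemma mu1_zero (b c : gen C) : mu [:: b] c = 0.
Proof.
case: (endpoints b) => [[-> _]|[sb tb]]; last exact: mu1_xy.
by case: (eU (src b)).
Qed.

Lemma mu_unit s (c : gen C) : mu s c != 0 ->
  exists i e' x', strict_unit (C := C) i e' /\ (s = [:: e'; x'] \/ s = [:: x'; e']).
Proof.
case: s => [|b [|b' s]] nz; first by have := mu_path nz.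
  by rewrite mu1_zero eqxx in nz.
have /and3P[/andP[/eqP tb _] _ _] := mu_path nz.
have [i [e' [U e'in]]] : exists i e', strict_unit (C := C) i e' /\ (e' = b \/ e' = b').
  case: (endpoints b) => [[bE _]|[_ t1]].
    by exists (src b), b; split; [rewrite {2}bE; exact: eU|left].
  case: (endpoints b') => [[bE _]|[s0 _]].
    by exists (src b'), b'; split; [rewrite {2}bE; exact: eU|right].
  by rewrite t1 s0 in tb.
(* A third factor is impossible: strict unitality makes longer products containing the unit
   vanish. *)
have -> : s = [::].
  apply/eqP; rewrite -size_eq0 -leqn0 leqNgt; apply/negP => s0.
  case: U => _ _ _ _ H; move/eqP: nz; apply; apply: H => //.
  by case: e'in => ->; rewrite !inE eqxx ?orbT.
exists i, e'; case: e'in => <-; [exists b'|exists b]; split=> //; [by left|by right].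
Qed.

Lemma hom_dif_zero i j k l (f : cx (hom_complex C i j) k) : dif l f = 0.
Proof.
by apply/ffunP => z; rewrite !ffunE big1 // => w _; rewrite mu1_zero mulr0.
Qed.

Let card_hom i j k (A : pred (gen C)) :
  (forall g : gen C, [&& src g == i, tgt g == j & deg g == k] = A g) ->
  #|homgen C i j k| = #|A|.
Proof. by move=> H; rewrite card_sig; apply: eq_card => g; rewrite !inE H. Qed.

Let card_diag i k : #|homgen C i i k| = (k == 0).
Proof.
have [[se te de] _ _ _ _] := eU i.
have H (g : gen C) : [&& src g == i, tgt g == i & deg g == k] = (g == e i) && (k == 0).
  apply/and3P/andP => [[/eqP sg /eqP tg /eqP <-]|[/eqP-> /eqP->]].
    by rewrite (e_only sg tg) de !eqxx.
  by rewrite se te de !eqxx.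
rewrite (card_hom H); case: (k == 0).
  by transitivity #|pred1 (e i)|; [apply: eq_card => g; rewrite /in_mem /= andbT|exact: card1].
by apply: eq_card0 => g; rewrite /in_mem /= andbF.
Qed.

(** [k + -1] is the degree as the shifted complex presents it, so that the row vectors on the two
    sides have convertible types. *)
Let card_upper k : #|homgen C 0 1 k| = ((k == 0)%R + (k + -1 == 0)%R)%N.
Proof.
have [sx tx dx] := xP; have [sy ty dy] := yP.
have H (g : gen C) : [&& src g == 0, tgt g == 1 & deg g == k] =
    (g == x) && (k == 0) || (g == y) && (k == 1).
  apply/and3P/orP => [[/eqP sg /eqP tg /eqP <-]|[] /andP[/eqP-> /eqP->]].
  - by case: (xy_only sg tg) => ->; [left|right]; rewrite ?dx ?dy !eqxx.
  - by rewrite sx tx dx.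
  - by rewrite sy ty dy.
rewrite (card_hom H) subr_eq0; have [->|k0] := eqVneq k 0.
  by transitivity #|pred1 x|; [apply: eq_card => g; rewrite /in_mem /= andbT andbF orbF|exact: card1].
have [_|k1] := eqVneq k 1.
  by transitivity #|pred1 y|; [apply: eq_card => g; rewrite /in_mem /= andbT andbF|exact: card1].
by apply: eq_card0 => g; rewrite /in_mem /= !andbF.
Qed.

Lemma hom_complex_iso i j : cochain_iso (hom_complex C i j)
  (if (i < j)%N then cdsum cochainZ (cshift cochainZ (- 1))
   else if i == j then cochainZ else cochain0).
Proof.
have [ij|ji|/val_inj ij] := ltngtP i j.
- have [-> ->] : i = 0 /\ j = 1.
    by case: (ord2P i) (ord2P j) ij => -> [] ->.
  pose f k (g : cx (hom_complex C 0 1) k) : cx (cdsum cochainZ (cshift cochainZ (- 1))) k :=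
    let v := \row_i g (enum_val (cast_ord (esym (card_upper k)) i)) in (lsubmx v, rsubmx v).
  apply: (@zero_dif_iso _ _ f).
  + move=> k; have [b1 a1] := ffun_row_bijective (card_upper k).
    have [b2 a2] := row_split_bijective (k == 0) (k + -1 == 0).
    split; first exact: bij_comp b2 b1.
    by move=> g h; exact: etrans (congr1 (fun v : 'rV_((k == 0) + (k - 1 == 0)) => (lsubmx v, rsubmx v)) (a1 g h)) (a2 _ _).
  + by move=> k l g; exact: hom_dif_zero.
  + by move=> k l g; rewrite /= /cdsum_dif /= /cshift_dif /= /zero_dif mul0rz.
- have -> : (i == j) = false by apply/eqP => E; rewrite E ltnn in ji.
  have card0 k : #|homgen C i j k| = 0%N.
    by apply: eq_card0 => -[g /= gP]; case/and3P: (gP) => /eqP sg /eqP tg _; case: (directed ji (conj sg tg)).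
  pose f k (g : cx (hom_complex C i j) k) : cx cochain0 k :=
    \row_i g (enum_val (cast_ord (esym (card0 k)) i)).
  apply: (@zero_dif_iso _ _ f) => //.
  + by move=> k; exact: ffun_row_bijective.
  + by move=> k l g; exact: hom_dif_zero.
- rewrite ij eqxx; pose f k (g : cx (hom_complex C j j) k) : cx cochainZ k :=
    \row_i g (enum_val (cast_ord (esym (card_diag j k)) i)).
  apply: (@zero_dif_iso _ _ f) => //.
  + by move=> k; exact: ffun_row_bijective.
  + by move=> k l g; exact: hom_dif_zero.
Qed.

End TwoObjects.

(** * An A-infinity category with these morphisms *)

Section Existence.

(* [(true, b)] is the unit of the object [b], and [(false, b)] the morphism of
   degree [b] from the first to the second object. *)
Definition lg2_gen : finType := (bool * bool)%type.
Definition lg2_src (g : lg2_gen) : 'I_2 := if g.1 && g.2 then 1 else 0.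
Definition lg2_tgt (g : lg2_gen) : 'I_2 := if g.1 && ~~ g.2 then 0 else 1.
Definition lg2_deg (g : lg2_gen) : int := (~~ g.1 && g.2)%:R.
(** The coefficient of m_2(b2, b1). A composable pair always contains a unit, and if [b1] is not
    one, the sign is that of m_2(e, x) in [strict_unit]. *)
Definition lg2_coef (b1 b2 : lg2_gen) : int :=
  if lg2_tgt b1 == lg2_src b2 then
    if b1.1 then 1 else (-1) ^+ (b1.2 : nat)
  else 0.
Definition lg2_prod (b1 b2 : lg2_gen) : lg2_gen := if b1.1 then b2 else b1.
Definition lg2_mu (s : seq lg2_gen) (c : lg2_gen) : int :=
  if s is [:: b1; b2] then lg2_coef b1 b2 * (lg2_prod b1 b2 == c)%:R else 0.

Lemma lg2_mu_path s c : lg2_mu s c != 0 ->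
  if s is b :: s' then
    [&& path (fun x y => lg2_tgt x == lg2_src y) b s', lg2_src c == lg2_src b
      & lg2_tgt c == lg2_tgt (last b s')]
  else false.
Proof.
case: s => [|b1 [|b2 [|b3 s]]]; rewrite /= ?eqxx // andbT.
by move: b1 b2 c => [[] []] [[] []] [[] []].
Qed.

Lemma lg2_mu_deg s c : lg2_mu s c != 0 ->
  lg2_deg c = \sum_(b <- s) lg2_deg b + 2 - (size s)%:Z.
Proof.
case: s => [|b1 [|b2 [|b3 s]]]; rewrite /= ?eqxx // big_cons big_seq1 addrK.
by move: b1 b2 c => [[] []] [[] []] [[] []].
Qed.

Lemma lg2_mu_size s c : size s != 2%N -> lg2_mu s c = 0.
Proof. by case: s => [|b1 [|b2 [|b3 s]]]. Qed.

Lemma lg2_mu_sum b1 b2 (F : lg2_gen -> int) :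
  \sum_d lg2_mu [:: b1; b2] d * F d = lg2_coef b1 b2 * F (lg2_prod b1 b2).
Proof.
rewrite (bigD1 (lg2_prod b1 b2))//= eqxx mulr1 big1 ?addr0// => d /negbTE dn.
by rewrite eq_sym dn mulr0 mul0r.
Qed.

Lemma lg2_mu_ainf s c :
  \sum_(n < (size s).+1) \sum_(m < (size s).+1 | (0 < m)%N && (n + m <= size s)%N)
    \sum_d (-1) ^ (\sum_(b <- take n s) (lg2_deg b - 1))
      * lg2_mu (take m (drop n s)) d * lg2_mu (take n s ++ d :: drop (n + m) s) c = 0.
Proof.
(* Both products in a nonzero term are binary, which forces the sequence to have length three. *)
have [s3|s3] := eqVneq (size s) 3%N; last first.
  rewrite big1// => n _; rewrite big1// => m /andP[m0 nm]; rewrite big1// => d _.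
  have sz1 : size (take m (drop n s)) = m.
    by apply: size_takel; rewrite size_drop leq_subRL// (leq_trans (leq_addr _ _) nm).
  have [m2|m2] := eqVneq (m : nat) 2%N; last by rewrite [lg2_mu (take m _) d]lg2_mu_size ?sz1// mulr0 mul0r.
  rewrite [X in _ * X]lg2_mu_size ?mulr0//; apply: contra s3.
  rewrite size_cat /= size_takel ?(leq_trans (leq_addr _ _) nm)// size_drop m2 => /eqP.
  by rewrite m2 in nm; move: (size s) (nat_of_ord n) nm => S N; lia.
case: s s3 => [|b1 [|b2 [|b3 [|//]]]] //= _.
rewrite !big_ord_recl !big_ord0 /= !big_mkcond !big_ord_recl !big_ord0 /=.
rewrite [X in _ + (_ + (X + _))]big1; last by move=> m _; rewrite big1// => d _; rewrite mulr0.
rewrite [X in _ + (_ + (_ + (X + _)))]big1; last by move=> m _; rewrite big1// => d _; rewrite mulr0.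
rewrite [X in _ + (X + _)]big_mkcond !big_ord_recl big_ord0 /= big_nil big_seq1.
have sum0 a : \sum_(d : lg2_gen) a * 0 * 0 = 0 :> int by rewrite big1// => d _; rewrite mulr0.
have sumE b b' a (F : lg2_gen -> int) : \sum_d a * (lg2_coef b b' * (lg2_prod b b' == d)%:R) * F d =
    a * (lg2_coef b b' * F (lg2_prod b b')).
  by rewrite -lg2_mu_sum mulr_sumr; apply: eq_bigr => d _; exact: esym (mulrA _ _ _).
rewrite !sum0 !sumE.
(* The remaining identity is evaluated on all choices of the four generators. *)
by clear sum0 sumE; move: b1 b2 b3 c => [[] []] [[] []] [[] []] [[] []].
Qed.

Definition lg2_cat : ainf_cat 'I_2 := AinfCat lg2_mu_path lg2_mu_deg lg2_mu_ainf.

Lemma lg2_cat_unit i : strict_unit (C := lg2_cat) i (true, i == 1).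
Proof.
split.
- by case: (ord2P i) => ->.
- by [].
- by case: (ord2P i) => -> [[] []] [[] []] => /eqP.
- by case: (ord2P i) => -> [[] []] [[] []] => /eqP.
- move=> s c _ s2; apply: lg2_mu_size; by case: s s2 => [|? [|? [|]]].
Qed.

Lemma lg2_cat_endo i (g : gen lg2_cat) : src g = i -> tgt g = i -> g = (true, i == 1).
Proof. by case: (ord2P i) g => -> [[] []] => /eqP + /eqP. Qed.

Lemma lg2_cat_directed (i j : 'I_2) : (j < i)%N -> forall g : gen lg2_cat, ~ (src g = i /\ tgt g = j).
Proof.
by case: (ord2P i) (ord2P j) => -> [] -> // _ [[] []] [] /eqP + /eqP.
Qed.

Lemma lg2_cat_upper (g : gen lg2_cat) : src g = 0 -> tgt g = 1 -> g = (false, g.2).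
Proof. by case: g => [[] []] /eqP + /eqP. Qed.

End Existence.

(** * The regular fibre and its holomorphic strips *)

Section FibreCoordinates.
Context {R : realType}.
Variables (D : R -> R) (m n : R).
Hypotheses (mn : m < n < m + pi *+ 2)
  (Ds : forall k, nderiv k setT D) (Dp : periodic2pi D)
  (D'0 : forall x, D x = 0 -> derive1 D x != 0) (Dm : D m = 0) (Dn : D n = 0)
  (D'm : 0 < derive1 D m) (D'n : derive1 D n < 0)
  (Dpos : forall x, m < x < n -> 0 < D x)
  (Dneg : forall x, n < x < m + pi *+ 2 -> D x < 0).

Local Notation C := (ccos m n).
Local Notation S := (csin m n).
Local Notation X := (cspeed m n).
Local Notation al := (cscale D m n).
Local Notation ic := (icos m n).
Local Notation isn := (isin m n).

Let Cs k : nderiv k setT C := nderiv_ccos mn k.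
Let Ss k : nderiv k setT S := nderiv_csin mn k.
Let Xs k : nderiv k setT X := nderiv_cspeed mn k.
Let als k : nderiv k setT al. Proof. exact: nderiv_cscale. Qed.
Let Cp : periodic2pi C. Proof. exact: periodic_ccos. Qed.
Let Sp : periodic2pi S. Proof. exact: periodic_csin. Qed.
Let Xp : periodic2pi X. Proof. exact: periodic_cspeed. Qed.
Let alp : periodic2pi al. Proof. exact: periodic_cscale. Qed.
Let C1 x : C x ^+ 2 + S x ^+ 2 = 1. Proof. exact: ccos2Dcsin2. Qed.
Let X0 x : 0 < X x. Proof. exact: cspeed_gt0. Qed.
Let al0 x : 0 < al x. Proof. exact: cscale_gt0. Qed.
Let alD x : al x * D x = 2 * S x. Proof. exact: cscaleD. Qed.
Let icK x : ic (C x) (S x) = cos x /\ isn (C x) (S x) = sin x. Proof. exact: icosK. Qed.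
Let al's k : nderiv k setT (derive1 al).
Proof. by apply: nderiv_derive1; [exact: openT|exact: als]. Qed.
Let al'p : periodic2pi (derive1 al) := derive1_periodic alp.
Let C'E x : derive1 C x = - (X x * S x).
Proof. by rewrite derive1E; case: (is_derive_ccos mn x). Qed.
Let S'E x : derive1 S x = X x * C x.
Proof. by rewrite derive1E; case: (is_derive_csin mn x). Qed.

(* [sinh (2 log r)] at the point [a + i b]; it vanishes on the unit circle, and
   the time-t Hamiltonian flow adds [t * D (arg w)] to it. *)
Definition sinh_height (a b : R) : R := ((a ^+ 2 + b ^+ 2) - (a ^+ 2 + b ^+ 2)^-1) / 2.

(* In the coordinates [Y = sinh X] and [Th], where [ccos] and [csin] are the
   cosine and sine of [Th], the Lagrangians are the curves [Y = - sin Th] and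
   [Y = sin Th]; [X + i Th] is the holomorphic coordinate defining J, and
   [kap1 + i kap2 = cosh (X + i Th)]. *)
Definition model_Y (a b : R) : R :=
  al (carg a b) * sinh_height a b - S (carg a b).
Definition model_G (a b : R) : R := Num.sqrt (1 + model_Y a b ^+ 2).
Definition kap1 (a b : R) : R := model_G a b * C (carg a b).
Definition kap2 (a b : R) : R := model_Y a b * S (carg a b).
(** [Jk] and [Jp] are the coefficients of d log r and d arg in dX / Th', where X is the coordinate
    with sinh X = [model_Y] and Th' is [cspeed], which the code abbreviates by the letter [X]. The
    common factor Th' does not affect the Cauchy-Riemann equations of X + i Th. *)
Definition Jk (a b : R) : R := al (carg a b) * ((a ^+ 2 + b ^+ 2) + (a ^+ 2 + b ^+ 2)^-1)
  * (model_G a b * X (carg a b))^-1.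
Definition Jp (a b : R) : R :=
  (derive1 al (carg a b) * sinh_height a b * (X (carg a b))^-1 - C (carg a b)) * (model_G a b)^-1.

Lemma model_G_gt0 a b : 0 < model_G a b.
Proof. by rewrite sqrtr_gt0 ltr_pwDl// sqr_ge0. Qed.

Lemma model_G2 a b : model_G a b ^+ 2 = 1 + model_Y a b ^+ 2.
Proof. by rewrite sqr_sqrtr// addr_ge0// sqr_ge0. Qed.

Let sqrD_gt0 (a b : R) : a ^+ 2 + b ^+ 2 != 0 -> 0 < a ^+ 2 + b ^+ 2.
Proof. by move=> h; rewrite lt0r h addr_ge0 ?sqr_ge0. Qed.

Lemma Jk_gt0 a b : a ^+ 2 + b ^+ 2 != 0 -> 0 < Jk a b.
Proof.
move=> /sqrD_gt0 h; apply: mulr_gt0.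
  by apply: mulr_gt0; [exact: al0|rewrite addr_gt0 ?invr_gt0].
by rewrite invr_gt0; apply: mulr_gt0; [exact: model_G_gt0|exact: X0].
Qed.

Section PartialDerivatives.
Variables (k : nat) (W : set (R * R)) (F G : R * R -> R).
Hypotheses (FG0 : forall p, W p -> F p ^+ 2 + G p ^+ 2 != 0)
  (Fk : pderiv k W F) (Gk : pderiv k W G).

Let sq : pderiv k W (fun p => F p ^+ 2 + G p ^+ 2).
Proof. by apply: pderivD; exact: pderivX. Qed.
Let sqV : pderiv k W (fun p => (F p ^+ 2 + G p ^+ 2)^-1).
Proof. exact: pderivV. Qed.
Let cargk H (pH : periodic2pi H) (sH : forall k, nderiv k setT H) :
  pderiv k W (fun p => H (carg (F p) (G p))).
Proof. exact: pderiv_carg. Qed.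

Lemma pderiv_sinh_height : pderiv k W (fun p => sinh_height (F p) (G p)).
Proof. by apply: pderivM; [exact: pderivB|exact: pderiv_cst]. Qed.

Lemma pderiv_model_Y : pderiv k W (fun p => model_Y (F p) (G p)).
Proof.
apply: pderivB; last exact: cargk.
by apply: pderivM; [exact: cargk|exact: pderiv_sinh_height].
Qed.

Lemma pderiv_model_G : pderiv k W (fun p => model_G (F p) (G p)).
Proof.
apply: pderiv_sqrt => [p _|]; first by rewrite ltr_pwDl// sqr_ge0.
by apply: pderivD; [exact: pderiv_cst|apply: pderivX; exact: pderiv_model_Y].
Qed.

Lemma pderiv_kap1 : pderiv k W (fun p => kap1 (F p) (G p)).
Proof. by apply: pderivM; [exact: pderiv_model_G|exact: cargk]. Qed.

Lemma pderiv_kap2 : pderiv k W (fun p => kap2 (F p) (G p)).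
Proof. by apply: pderivM; [exact: pderiv_model_Y|exact: cargk]. Qed.

Lemma pderiv_Jk : pderiv k W (fun p => Jk (F p) (G p)).
Proof.
apply: pderivM; first by apply: pderivM; [exact: cargk|exact: pderivD].
apply: pderivV; last by apply: pderivM; [exact: pderiv_model_G|exact: cargk].
by move=> p _; rewrite mulf_neq0 ?gt_eqF ?model_G_gt0.
Qed.

Lemma pderiv_Jp : pderiv k W (fun p => Jp (F p) (G p)).
Proof.
apply: pderivM; last first.
  by apply: pderivV; [move=> p _; rewrite gt_eqF ?model_G_gt0|exact: pderiv_model_G].
apply: pderivB; last exact: cargk.
apply: pderivM; last by apply: pderivV; [move=> p _; rewrite gt_eqF|exact: cargk].
by apply: pderivM; [exact: cargk|exact: pderiv_sinh_height].
Qed.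

End PartialDerivatives.

Lemma compatible_J : compatible_acs (logJ Jk Jp).
Proof.
apply: compatible_logJ; first exact: Jk_gt0.
- by move=> k; apply: pderiv_Jk => [p| |]; [exact: punctured_sqrD|exact: pderiv_fst|exact: pderiv_snd].
- by move=> k; apply: pderiv_Jp => [p| |]; [exact: punctured_sqrD|exact: pderiv_fst|exact: pderiv_snd].
Qed.

Section Derivatives.
Variables (V : normedModType R) (F G : V -> R) (p v : V) (f g : R).
Hypotheses (FG0 : F p ^+ 2 + G p ^+ 2 != 0) (dF : is_derive p v F f) (dG : is_derive p v G g).

(** The two parts of dw / w on the tangent vector, that is, the derivatives of log r and of the
    angle. *)
Definition log_re := (F p * f + G p * g) / (F p ^+ 2 + G p ^+ 2).
Definition log_im := (F p * g - G p * f) / (F p ^+ 2 + G p ^+ 2).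
Definition model_dX := Jk (F p) (G p) * log_re + Jp (F p) (G p) * log_im.

Lemma is_derive_carg_csin : is_derive p v (fun q => S (carg (F q) (G q)))
  (X (carg (F p) (G p)) * C (carg (F p) (G p)) * log_im).
Proof. by rewrite -S'E; apply: is_derive_carg. Qed.

Lemma is_derive_carg_ccos : is_derive p v (fun q => C (carg (F q) (G q)))
  (- (X (carg (F p) (G p)) * S (carg (F p) (G p))) * log_im).
Proof. by rewrite -C'E; apply: is_derive_carg. Qed.

Lemma is_derive_sinh_height : is_derive p v (fun q => sinh_height (F q) (G q))
  (((F p ^+ 2 + G p ^+ 2) + (F p ^+ 2 + G p ^+ 2)^-1) * log_re).
Proof.
have ds := is_deriveD_fun (is_deriveX_fun 2 dF) (is_deriveX_fun 2 dG).
have := is_deriveM_fun (is_deriveD_fun ds (is_deriveN_fun 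
  (@is_deriveV_fun _ _ (fun q => F q ^+ 2 + G q ^+ 2) p v _ FG0 ds)))
  (is_derive_cst (2^-1 : R) p v).
by move/is_derive_eq; apply; rewrite /log_re /= !expr1; field.
Qed.

Lemma is_derive_model_Y : is_derive p v (fun q => model_Y (F q) (G q))
  (model_G (F p) (G p) * X (carg (F p) (G p)) * model_dX).
Proof.
have da := is_derive_carg alp (als 1%N) FG0 dF dG.
have := is_deriveD_fun (is_deriveM_fun da is_derive_sinh_height) (is_deriveN_fun is_derive_carg_csin).
move/is_derive_eq; apply; rewrite /model_dX /Jk /Jp -/log_im.
have G0 := lt0r_neq0 (model_G_gt0 (F p) (G p)).
by have X00 := lt0r_neq0 (X0 (carg (F p) (G p))); field; rewrite X00 G0.
Qed.

Lemma is_derive_model_G : is_derive p v (fun q => model_G (F q) (G q))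
  (model_Y (F p) (G p) * X (carg (F p) (G p)) * model_dX).
Proof.
have dq := is_deriveD_fun (is_derive_cst (1 : R) p v) (is_deriveX_fun 2 is_derive_model_Y).
have q0 : 0 < 1 + model_Y (F p) (G p) ^+ 2 by rewrite ltr_pwDl// sqr_ge0.
have := @is_derive_compose _ _ _ (fun q => 1 + model_Y (F q) (G q) ^+ 2) p v _ _
  (is_derive1_sqrt q0) dq.
move/is_derive_eq; apply; rewrite -/(model_G (F p) (G p)) /= expr1.
by have G0 := lt0r_neq0 (model_G_gt0 (F p) (G p)); field; rewrite G0.
Qed.

Lemma is_derive_kap1 : is_derive p v (fun q => kap1 (F q) (G q))
  (X (carg (F p) (G p)) * (model_Y (F p) (G p) * C (carg (F p) (G p)) * model_dX
     - model_G (F p) (G p) * S (carg (F p) (G p)) * log_im)).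
Proof.
have := is_deriveM_fun is_derive_model_G is_derive_carg_ccos.
by move/is_derive_eq; apply; ring.
Qed.

Lemma is_derive_kap2 : is_derive p v (fun q => kap2 (F q) (G q))
  (X (carg (F p) (G p)) * (model_G (F p) (G p) * S (carg (F p) (G p)) * model_dX
     + model_Y (F p) (G p) * C (carg (F p) (G p)) * log_im)).
Proof.
have := is_deriveM_fun is_derive_model_Y is_derive_carg_csin.
by move/is_derive_eq; apply; ring.
Qed.

End Derivatives.

(** Divided by w, the equation of J-holomorphic maps is the Cauchy-Riemann system of X + i Th, both
    sides carrying the factor 1 / [cspeed]. The constant functions [F] and [G] only supply the base
    point. *)
Lemma logJ_eq (a b f1 g1 f2 g2 : R) (F := fun=> a : R) (G := fun=> b : R) (p : R) :
  a ^+ 2 + b ^+ 2 != 0 ->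
  (f1 +i* g1) + logJ Jk Jp (a +i* b) (f2 +i* g2) = 0 <->
  model_dX F G p f1 g1 = log_im F G p f2 g2 /\ log_im F G p f1 g1 = - model_dX F G p f2 g2.
Proof.
move=> ab0; have w0 : a +i* b != 0 by rewrite sqrD_neq0.
have k0 := lt0r_neq0 (Jk_gt0 ab0).
have -> : (f1 +i* g1) + logJ Jk Jp (a +i* b) (f2 +i* g2) = 0 <->
    (f1 +i* g1) / (a +i* b) + logJ Jk Jp (a +i* b) (f2 +i* g2) / (a +i* b) = 0.
  rewrite -mulrDl; split=> [->|/eqP]; first by rewrite mul0r.
  by rewrite mulf_eq0 invr_eq0 (negbTE w0) orbF => /eqP.
rewrite logJ_div// !divcE /=.
have e1 f g : log_re F G p f g = (f * a + g * b) / (a ^+ 2 + b ^+ 2).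
  by rewrite /log_re /F /G (mulrC a) (mulrC b).
have e2 f g : log_im F G p f g = (g * a - f * b) / (a ^+ 2 + b ^+ 2).
  by rewrite /log_im /F /G (mulrC a) (mulrC b).
rewrite /model_dX -!e1 -!e2 /F /G /=.
set x1 := log_re _ _ _ _ _; set t1 := log_im _ _ _ _ _.
set x2 := log_re _ _ _ _ _; set t2 := log_im _ _ _ _ _.
set K := Jk _ _ in k0 *; set P := Jp _ _; split.
- move=> /eqP; rewrite eq_complex /= => /andP[/eqP h1 /eqP h2].
  have -> : t1 = - (K * x2 + P * t2) by lra.
  have -> : x1 = P * x2 + (1 + P ^+ 2) / K * t2 by lra.
  by split; first by field.
- move=> [h1 h2]; apply/eqP; rewrite eq_complex /=; apply/andP; split; apply/eqP; last by lra.
  have -> : x1 = (t2 - P * t1) / K by rewrite -h1; field.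
  by rewrite h2; field.
Qed.

(** h + sqrt (1 + h^2) is exp (arsinh h), the inverse of q -> sinh (log q). *)
Lemma sinh_sqrK (q : R) : 0 < q -> let h := (q - q^-1) / 2 in
  h + Num.sqrt (1 + h ^+ 2) = q.
Proof.
move=> q0 h; have qn0 := lt0r_neq0 q0.
have -> : 1 + h ^+ 2 = ((q + q^-1) / 2) ^+ 2 by rewrite /h; field.
rewrite sqrtr_sqr ger0_norm; first by rewrite /h; field.
by rewrite divr_ge0// addr_ge0 ?invr_ge0 ?ltW.
Qed.

Lemma sinh_sqrt (h : R) : let q := h + Num.sqrt (1 + h ^+ 2) in
  0 < q /\ (q - q^-1) / 2 = h.
Proof.
set r := Num.sqrt _ => q; have h2 : 0 < 1 + h ^+ 2 by rewrite ltr_pwDl// sqr_ge0.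
have r2 : r ^+ 2 = 1 + h ^+ 2 by rewrite sqr_sqrtr// ltW.
have r0 : 0 < r by rewrite sqrtr_gt0.
have q0 : 0 < q by rewrite /q; nra.
split=> //; have -> : q^-1 = r - h.
  apply: (mulfI (lt0r_neq0 q0)); rewrite mulfV ?lt0r_neq0// /q.
  have -> : (h + r) * (r - h) = r ^+ 2 - h ^+ 2 by ring.
  by rewrite r2; ring.
by rewrite /q; field.
Qed.

(** With [pt_re] and [pt_im], the inverse of the coordinates (cos Th, sin Th, sinh X): the equation
    [model_Y = y] determines sinh (2 log r), hence r^2, and the direction comes from [icos] and
    [isin]. *)
Definition pt_sqnorm (c s y : R) : R :=
  let h := (y + s) / al (carg (ic c s) (isn c s)) in h + Num.sqrt (1 + h ^+ 2).
Definition pt_re (c s y : R) : R := Num.sqrt (pt_sqnorm c s y) * ic c s.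
Definition pt_im (c s y : R) : R := Num.sqrt (pt_sqnorm c s y) * isn c s.

Lemma pt_sqnorm_gt0 c s y : 0 < pt_sqnorm c s y.
Proof. by case: (sinh_sqrt ((y + s) / al (carg (ic c s) (isn c s)))). Qed.

Lemma icos2Disin2 (c s : R) : c ^+ 2 + s ^+ 2 = 1 -> ic c s ^+ 2 + isn c s ^+ 2 = 1.
Proof.
move=> cs; have [x [<- <-]] := ccos_csin_surj mn cs.
by have [-> ->] := icK x; exact: cos2Dsin2.
Qed.

Lemma pt_coords (c s y : R) : c ^+ 2 + s ^+ 2 = 1 ->
  let a := pt_re c s y in let b := pt_im c s y in
  [/\ a ^+ 2 + b ^+ 2 = pt_sqnorm c s y, a ^+ 2 + b ^+ 2 != 0,
      C (carg a b) = c, S (carg a b) = s & model_Y a b = y].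
Proof.
move=> cs a b; have q0 := pt_sqnorm_gt0 c s y.
have ab : a ^+ 2 + b ^+ 2 = pt_sqnorm c s y.
  transitivity (Num.sqrt (pt_sqnorm c s y) ^+ 2 * (ic c s ^+ 2 + isn c s ^+ 2)).
    by rewrite /a /b /pt_re /pt_im; set u := ic c s; set v := isn c s; ring.
  by rewrite (icos2Disin2 cs) mulr1 sqr_sqrtr// ltW.
have [x [cx sx]] := ccos_csin_surj mn cs.
have r0 : 0 < Num.sqrt (pt_sqnorm c s y) by rewrite sqrtr_gt0.
have [ix jx] := icK x; rewrite cx sx in ix jx.
have H f : periodic2pi f -> f (carg a b) = f x.
  by move=> pf; rewrite /a /b /pt_re /pt_im ix jx periodic_carg.
have Cab := H _ Cp; have Sab := H _ Sp; split.
- exact: ab.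
- by rewrite ab gt_eqF.
- by rewrite Cab.
- by rewrite Sab.
- rewrite /model_Y Sab sx /sinh_height ab (H _ alp) /pt_sqnorm.
  have e : carg (ic c s) (isn c s) = carg (1 * cos x) (1 * sin x) by rewrite ix jx !mul1r.
  rewrite e (periodic_carg _ alp ltr01).
  have [_ ->] := sinh_sqrt ((y + s) / al x).
  by rewrite mulrC divfK ?addrK// gt_eqF.
Qed.

Lemma ptK (a b : R) : a ^+ 2 + b ^+ 2 != 0 ->
  let c := C (carg a b) in let s := S (carg a b) in let y := model_Y a b in
  pt_re c s y = a /\ pt_im c s y = b.
Proof.
move=> ab0 c s y; have [ea eb] := cargP a b.
have [i1 i2] := icK (carg a b).
have qE : pt_sqnorm c s y = a ^+ 2 + b ^+ 2.
  rewrite /pt_sqnorm /y /model_Y subrK /c /s i1 i2.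
  rewrite -(mul1r (cos _)) -(mul1r (sin _)) (periodic_carg _ alp ltr01).
  rewrite mulrC mulKf ?gt_eqF//; apply: sinh_sqrK; exact: sqrD_gt0.
by rewrite /pt_re /pt_im qE /c /s i1 i2 -ea -eb.
Qed.

Lemma pderiv_icos k W (F G : R * R -> R) : (forall p, W p -> F p ^+ 2 + G p ^+ 2 = 1) ->
  pderiv k W F -> pderiv k W G ->
  pderiv k W (fun p => ic (F p) (G p)) /\ pderiv k W (fun p => isn (F p) (G p)).
Proof.
move=> FG1 Fk Gk; have cM (c : R) (f : R * R -> R) : pderiv k W f -> pderiv k W (fun p => c * f p).
  by move=> fk; apply: pderivM => //; exact: pderiv_cst.
have cMr (c : R) (f : R * R -> R) : pderiv k W f -> pderiv k W (fun p => f p * c).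
  by move=> fk; apply: pderivM => //; exact: pderiv_cst.
have dk : pderiv k W (fun p => (1 + G p * cos (half_width m n))^-1).
  apply: pderivV => [p Wp|]; first by rewrite gt_eqF// (icos_denom_gt0 mn (FG1 _ Wp)).
  by apply: pderivD; [exact: pderiv_cst|exact: (cMr _ _)].
have ck : pderiv k W (fun p => (1 - F p) / 2).
  by apply: (cMr _ _); apply: pderivB => //; exact: pderiv_cst.
have ck' : pderiv k W (fun p => (1 + F p) / 2).
  by apply: (cMr _ _); apply: pderivD => //; exact: pderiv_cst.
split; apply: pderivM => //.
- apply: pderivB; apply: (cM _ _).
    by apply: pderivD; [apply: pderivD|]; [|exact: (cMr _ _)|exact: (cMr _ _)].
  by apply: pderivD; exact: (cMr _ _).
- apply: pderivD; apply: (cM _ _).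
    by apply: pderivD; [apply: pderivD|]; [|exact: (cMr _ _)|exact: (cMr _ _)].
  by apply: pderivD; exact: (cMr _ _).
Qed.

Lemma pderiv_pt k W (F G H : R * R -> R) : (forall p, W p -> F p ^+ 2 + G p ^+ 2 = 1) ->
  pderiv k W F -> pderiv k W G -> pderiv k W H ->
  pderiv k W (fun p => pt_re (F p) (G p) (H p)) /\
  pderiv k W (fun p => pt_im (F p) (G p) (H p)).
Proof.
move=> FG1 Fk Gk Hk; have [ik jk] := pderiv_icos FG1 Fk Gk.
have ak : pderiv k W (fun p => (al (carg (ic (F p) (G p)) (isn (F p) (G p))))^-1).
  apply: pderivV => [p _|]; first by rewrite gt_eqF.
  apply: pderiv_carg => // p Wp.
  by rewrite (icos2Disin2 (FG1 _ Wp)) oner_eq0.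
have hk := pderivM (pderivD Hk Gk) ak.
have rk : pderiv k W (fun p => Num.sqrt (pt_sqnorm (F p) (G p) (H p))).
  apply: pderiv_sqrt => [p _|]; first exact: pt_sqnorm_gt0.
  apply: pderivD => //; apply: pderiv_sqrt => [p _|]; first by rewrite ltr_pwDl// sqr_ge0.
  by apply: pderivD; [exact: pderiv_cst|exact: pderivX].
by split; apply: pderivM.
Qed.

Lemma sinh_height_eq0 a b : a ^+ 2 + b ^+ 2 != 0 ->
  (sinh_height a b == 0) = (a ^+ 2 + b ^+ 2 == 1).
Proof.
move=> ab0; rewrite /sinh_height mulf_eq0 invr_eq0 pnatr_eq0 orbF subr_eq0.
rewrite -(inj_eq (mulfI ab0)) mulfV// -expr2 sqrf_eq1.
suff -> : (a ^+ 2 + b ^+ 2 == -1) = false by rewrite orbF.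
by apply/eqP => e; have := sqrD_gt0 ab0; rewrite e; lra.
Qed.

Lemma model_Y_L0 a b : (model_Y a b == - S (carg a b)) = (sinh_height a b == 0).
Proof.
rewrite /model_Y -subr_eq0 opprK subrK mulf_eq0.
by rewrite [al _ == 0]gt_eqF.
Qed.

(** The normalisation [al * D = 2 S] is made for this: it turns the graph of [D] into Y = S while
    the unit circle is Y = - S. *)
Lemma model_Y_L1 a b : (model_Y a b == S (carg a b)) = (sinh_height a b == D (carg a b)).
Proof.
rewrite /model_Y subr_eq -mulr2n -mulr_natl -alD.
by apply: inj_eq; apply: mulfI; rewrite gt_eqF.
Qed.

(* The Möbius image [(z + i) / (z - i)] of the point [z = a + i b], and its
   inverse for [e = -1], in the coordinates (cos Th, sin Th, sinh X). The strips
   are the images of [z = exp (pi/2 s + i (pi/2 t - pi/4))]. *)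
Definition lens_N2 (a b : R) : R := (a ^+ 2 + b ^+ 2 - 1) ^+ 2 + 4 * a ^+ 2.
Definition lens_C (a b : R) : R := (a ^+ 2 + b ^+ 2 - 1) * (Num.sqrt (lens_N2 a b))^-1.
Definition lens_S (e a b : R) : R := e * (2 * a) * (Num.sqrt (lens_N2 a b))^-1.
Definition lens_Y (e a b : R) : R := e * (2 * b) * (Num.sqrt (lens_N2 a b))^-1.

Lemma lens_N2E a b : lens_N2 a b = (a ^+ 2 + b ^+ 2 + 1) ^+ 2 - 4 * b ^+ 2.
Proof. by rewrite /lens_N2; ring. Qed.

Lemma lens_CS (e a b : R) : e ^+ 2 = 1 -> 0 < lens_N2 a b ->
  lens_C a b ^+ 2 + lens_S e a b ^+ 2 = 1.
Proof.
move=> e1 N0; have r2 : Num.sqrt (lens_N2 a b) ^+ 2 = lens_N2 a b by rewrite sqr_sqrtr// ltW.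
have r0 : Num.sqrt (lens_N2 a b) != 0 by rewrite gt_eqF// sqrtr_gt0.
transitivity (((a ^+ 2 + b ^+ 2 - 1) ^+ 2 + e ^+ 2 * (4 * a ^+ 2)) / Num.sqrt (lens_N2 a b) ^+ 2).
  by rewrite /lens_C /lens_S; field.
by rewrite e1 r2 mul1r mulfV// gt_eqF.
Qed.

Lemma lens_G (e a b : R) : e ^+ 2 = 1 -> 0 < lens_N2 a b ->
  Num.sqrt (1 + lens_Y e a b ^+ 2) = (a ^+ 2 + b ^+ 2 + 1) * (Num.sqrt (lens_N2 a b))^-1.
Proof.
move=> e1 N0; have r2 : Num.sqrt (lens_N2 a b) ^+ 2 = lens_N2 a b by rewrite sqr_sqrtr// ltW.
have r0 : Num.sqrt (lens_N2 a b) != 0 by rewrite gt_eqF// sqrtr_gt0.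
have -> : 1 + lens_Y e a b ^+ 2 = ((a ^+ 2 + b ^+ 2 + 1) * (Num.sqrt (lens_N2 a b))^-1) ^+ 2.
  have key : Num.sqrt (lens_N2 a b) ^+ 2 + 4 * b ^+ 2 = (a ^+ 2 + b ^+ 2 + 1) ^+ 2.
    by rewrite r2 lens_N2E; ring.
  transitivity ((Num.sqrt (lens_N2 a b) ^+ 2 + e ^+ 2 * (4 * b ^+ 2)) / Num.sqrt (lens_N2 a b) ^+ 2).
    by rewrite /lens_Y; field.
  rewrite e1 mul1r key exprMn exprVn.
  by [].
rewrite sqrtr_sqr ger0_norm// mulr_ge0// ?invr_ge0 ?sqrtr_ge0//.
by rewrite !addr_ge0 ?sqr_ge0.
Qed.

(** The last two conclusions are the derivatives of Th and X. Replacing (a', b') by (- b', a') turns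
    the first expression into the second and the second into minus the first, which is the
    Cauchy-Riemann system. *)
Lemma is_derive_lens (V : normedModType R) (a b : V -> R) (p v : V) (a' b' e : R) :
  e ^+ 2 = 1 -> 0 < lens_N2 (a p) (b p) -> is_derive p v a a' -> is_derive p v b b' ->
  exists c' s' y', [/\ is_derive p v (fun q => lens_C (a q) (b q)) c',
    is_derive p v (fun q => lens_S e (a q) (b q)) s',
    is_derive p v (fun q => lens_Y e (a q) (b q)) y',
    lens_C (a p) (b p) * s' - lens_S e (a p) (b p) * c' =
      2 * e * ((b p ^+ 2 - a p ^+ 2 - 1) * a' - 2 * a p * b p * b') / lens_N2 (a p) (b p)
  & y' / Num.sqrt (1 + lens_Y e (a p) (b p) ^+ 2) =
      2 * e * ((a p ^+ 2 - b p ^+ 2 + 1) * b' - 2 * a p * b p * a') / lens_N2 (a p) (b p)].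
Proof.
move=> e1 N0 da db; rewrite lens_G//.
set r := Num.sqrt (lens_N2 (a p) (b p)).
have r2 : r ^+ 2 = lens_N2 (a p) (b p) by rewrite sqr_sqrtr// ltW.
have r0 : 0 < r by rewrite sqrtr_gt0.
have rn0 := lt0r_neq0 r0.
have dq := is_deriveD_fun (is_deriveD_fun (is_deriveX_fun 2 da) (is_deriveX_fun 2 db))
  (is_derive_cst (- 1 : R) p v).
have dN := is_deriveD_fun (is_deriveX_fun 2 dq)
  (is_deriveM_fun (is_derive_cst (4 : R) p v) (is_deriveX_fun 2 da)).
have dr := @is_derive_compose _ _ _ (fun q => lens_N2 (a q) (b q)) p v _ _
  (is_derive1_sqrt N0) dN.
have dV := @is_deriveV_fun _ _ (fun q => Num.sqrt (lens_N2 (a q) (b q))) p v _ rn0 dr.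
have cM (k : R) f f' : is_derive p v f f' -> is_derive p v (fun q => k * f q) (k * f').
  by move=> df; have := is_deriveM_fun (is_derive_cst k p v) df; rewrite mul0r add0r.
have dC := is_deriveM_fun dq dV.
have dS := is_deriveM_fun (cM e _ _ (cM 2 _ _ da)) dV.
have dY := is_deriveM_fun (cM e _ _ (cM 2 _ _ db)) dV.
eexists; eexists; eexists; split; [exact: dC|exact: dS|exact: dY| |].
- rewrite /lens_C /lens_S -/r -r2 /= !expr1 !mul0r; field.
  by rewrite rn0.
- rewrite /lens_Y -/r /= !expr1 !mul0r.
  have q0 : a p ^+ 2 + b p ^+ 2 + 1 != 0 by rewrite gt_eqF// ltr_wpDl// addr_ge0 ?sqr_ge0.
  transitivity (2 * e * (b' * r ^+ 2 - b p * ((a p ^+ 2 + b p ^+ 2 - 1) *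
     (2 * (a p * a' + b p * b')) + 4 * (a p * a'))) / (r ^+ 2 * (a p ^+ 2 + b p ^+ 2 + 1))).
    by field; rewrite rn0 q0.
  rewrite {1}r2 r2 /lens_N2; have N00 := lt0r_neq0 N0; rewrite /lens_N2 in N00.
  by field; rewrite q0 N00.
Qed.

Lemma pderiv_lens k W (F G : R * R -> R) (e : R) : (forall p, W p -> 0 < lens_N2 (F p) (G p)) ->
  pderiv k W F -> pderiv k W G ->
  [/\ pderiv k W (fun p => lens_C (F p) (G p)), pderiv k W (fun p => lens_S e (F p) (G p))
    & pderiv k W (fun p => lens_Y e (F p) (G p))].
Proof.
move=> N0 Fk Gk.
have cM (c : R) (f : R * R -> R) : pderiv k W f -> pderiv k W (fun p => c * f p).
  by move=> fk; apply: pderivM => //; exact: pderiv_cst.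
have qk : pderiv k W (fun p => F p ^+ 2 + G p ^+ 2 - 1).
  by apply: pderivB; [apply: pderivD; exact: pderivX|exact: pderiv_cst].
have Nk : pderiv k W (fun p => (Num.sqrt (lens_N2 (F p) (G p)))^-1).
  apply: pderivV => [p Wp|]; first by rewrite gt_eqF// sqrtr_gt0 N0.
  apply: pderiv_sqrt => //; apply: pderivD; first exact: pderivX.
  by apply: (cM _ _); exact: pderivX.
by split; apply: pderivM => //; do 2 apply: (cM _ _).
Qed.

(* Two points of the model with the same value of [kap1 + i kap2] differ by the
   involution (Th, X) -> (- Th, - X). *)
Lemma lens_unique (e a b c s y : R) : e ^+ 2 = 1 -> 0 < a -> 0 < lens_N2 a b ->
  c ^+ 2 + s ^+ 2 = 1 -> 0 < e * s ->
  Num.sqrt (1 + y ^+ 2) * c =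
    (a ^+ 2 + b ^+ 2 + 1) * (Num.sqrt (lens_N2 a b))^-1 * lens_C a b ->
  y * s = lens_Y e a b * lens_S e a b ->
  [/\ c = lens_C a b, s = lens_S e a b & y = lens_Y e a b].
Proof.
move=> e1 a0 N0 cs es; have CS := lens_CS e1 N0; rewrite -(lens_G e1 N0).
set s0 := lens_S e a b in CS *; set y0 := lens_Y e a b; set c0 := lens_C a b in CS *.
have es0 : 0 < e * s0.
  rewrite /s0 /lens_S !mulrA -expr2 e1 mul1r mulr_gt0 ?invr_gt0 ?sqrtr_gt0//.
  by rewrite mulr_gt0.
clearbody s0 y0 c0.
have G0 z : 0 < Num.sqrt (1 + z ^+ 2) :> R by rewrite sqrtr_gt0 ltr_pwDl// sqr_ge0.
have G2 z : Num.sqrt (1 + z ^+ 2) ^+ 2 = 1 + z ^+ 2 :> R by rewrite sqr_sqrtr// addr_ge0// sqr_ge0.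
move=> h1 h2.
have s20 : 0 < s ^+ 2 by rewrite lt0r sqr_ge0 andbT sqrf_eq0; apply/eqP => s0'; rewrite s0' mulr0 ltxx in es.
have s020 : 0 < s0 ^+ 2 by rewrite lt0r sqr_ge0 andbT sqrf_eq0; apply/eqP => s0'; rewrite s0' mulr0 ltxx in es0.
have k1 : (1 + y ^+ 2) * (1 - s ^+ 2) = (1 + y0 ^+ 2) * (1 - s0 ^+ 2).
  have := congr1 (fun x => x ^+ 2) h1; rewrite /= !exprMn !G2 => h.
  have -> : 1 - s ^+ 2 = c ^+ 2 by rewrite -cs addrK.
  by have -> : 1 - s0 ^+ 2 = c0 ^+ 2 by rewrite -CS addrK.
have k2 : y ^+ 2 * s ^+ 2 = y0 ^+ 2 * s0 ^+ 2 by rewrite -!exprMn h2.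
have k3 : y ^+ 2 = y0 ^+ 2 + s ^+ 2 - s0 ^+ 2 by lra.
(* Eliminating y^2 from the two equations leaves a product whose second factor is positive, since s
   is nonzero. *)
have k4 : (s ^+ 2 - s0 ^+ 2) * (y0 ^+ 2 + s ^+ 2) = 0.
  by rewrite k3 in k2; transitivity ((y0 ^+ 2 + s ^+ 2 - s0 ^+ 2) * s ^+ 2 - y0 ^+ 2 * s0 ^+ 2);
     [ring|rewrite k2 subrr].
have k5 : s ^+ 2 = s0 ^+ 2.
  move/eqP: k4; rewrite mulf_eq0 => /orP[|/eqP k]; first by rewrite subr_eq0 => /eqP.
  by have := sqr_ge0 y0; lra.
have ss0 : s = s0.
  move/eqP: k5; rewrite eqf_sqr => /orP[/eqP//|/eqP sN].
  by move: es; rewrite sN mulrN; lra.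
have sn0 : s0 != 0 by rewrite -sqrf_eq0 gt_eqF.
have yy0 : y = y0 by apply: (mulIf sn0); rewrite -{1}ss0.
split=> //; apply: (mulfI (lt0r_neq0 (G0 y0))).
by rewrite -h1 yy0.
Qed.

(* Real and imaginary part of [exp (pi/2 s + i (pi/2 t - pi/4))]. *)
Definition strip_re (p : R * R) : R := expR (pi / 2 * p.1 + 0) * cos (pi / 2 * p.2 + - (pi / 4)).
Definition strip_im (p : R * R) : R := expR (pi / 2 * p.1 + 0) * sin (pi / 2 * p.2 + - (pi / 4)).

Lemma nderiv_expR k : nderiv k setT (@expR R).
Proof.
elim: k => //= k IH; exists expR => // x _; exact: is_derive_expR.
Qed.

Lemma pderiv_strip k W : pderiv k W strip_re /\ pderiv k W strip_im.
Proof.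
have e1 : pderiv k W (fun p => expR (pi / 2 * p.1 + 0)).
  apply: (pderiv_comp (f := expR)); first by move=> j; exact: nderiv_expR.
  by apply: pderivD; [apply: pderivM; [exact: pderiv_cst|exact: pderiv_fst]|exact: pderiv_cst].
have e2 (f : R -> R) : (forall k, nderiv k setT f) -> pderiv k W (fun p : R * R => f p.2).
  by move=> fk; apply: (pderiv_comp fk); exact: pderiv_snd.
split; apply: pderivM => //.
- by apply: (e2 (fun x => cos (pi / 2 * x + - (pi / 4)))) => j; have [] := nderiv_sin_cos j setT (pi / 2 : R) (- (pi / 4)).
- by apply: (e2 (fun x => sin (pi / 2 * x + - (pi / 4)))) => j; have [] := nderiv_sin_cos j setT (pi / 2 : R) (- (pi / 4)).
Qed.

Lemma is_derive_strip (s t : R) :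
  [/\ is_derive (s, t) (1, 0) strip_re (pi / 2 * strip_re (s, t)),
      is_derive (s, t) (1, 0) strip_im (pi / 2 * strip_im (s, t)),
      is_derive (s, t) (0, 1) strip_re (- (pi / 2 * strip_im (s, t)))
    & is_derive (s, t) (0, 1) strip_im (pi / 2 * strip_re (s, t))].
Proof.
have dE := is_derive_compose (is_derive_expR _) (is_derive_affine (pi / 2) 0 s).
have da := is_derive_affine (pi / 2) (- (pi / 4)) t.
have dc := is_derive_compose (is_derive_cos _) da.
have ds := is_derive_compose (is_derive_sin _) da.
rewrite /strip_re /strip_im /=; split.
- apply/is_derive_slice1; have := is_deriveM_fun dE (is_derive_cst (cos (pi / 2 * t + - (pi / 4))) s 1).
  by move/is_derive_eq; apply; rewrite /cst /=; ring.
- apply/is_derive_slice1; have := is_deriveM_fun dE (is_derive_cst (sin (pi / 2 * t + - (pi / 4))) s 1).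
  by move/is_derive_eq; apply; rewrite /cst /=; ring.
- apply/is_derive_slice2; have := is_deriveM_fun (is_derive_cst (expR (pi / 2 * s + 0)) t 1) dc.
  by move/is_derive_eq; apply; rewrite /cst /=; ring.
- apply/is_derive_slice2; have := is_deriveM_fun (is_derive_cst (expR (pi / 2 * s + 0)) t 1) ds.
  by move/is_derive_eq; apply; rewrite /cst /=; ring.
Qed.

(** Smoothness is required on a strip wider than 0 <= t <= 1; with the margin 1/4 the argument stays
    between - 3 pi / 8 and 3 pi / 8. *)
Lemma strip_re_gt0 p : -4^-1 < p.2 < 1 + 4^-1 -> 0 < strip_re p.
Proof.
move=> /andP[p1 p2]; rewrite /strip_re mulr_gt0 ?expR_gt0// cos_gt0_pihalf//.
by have := pi_gt0 R; move=> pi0; apply/andP; split; nra.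
Qed.

Lemma lens_N2_gt0 a b : 0 < a -> 0 < lens_N2 a b.
Proof. by move=> a0; rewrite /lens_N2 ltr_wpDl ?sqr_ge0// mulr_gt0// exprn_gt0. Qed.

(** The two boundary lines go to the rays of argument - pi / 4 and pi / 4, on which [lens_Y] is
    minus or plus [lens_S]. *)
Lemma strip_boundary s : strip_im (s, 0) = - strip_re (s, 0) /\ strip_im (s, 1) = strip_re (s, 1).
Proof.
have c4 : sin (pi / 4) = cos (pi / 4) :> R.
  rewrite -[in LHS](_ : pi / 2 - pi / 4 = pi / 4); last by field.
  by rewrite sinB sin_pihalf cos_pihalf mul1r mul0r subr0.
rewrite /strip_im /strip_re /= !mulr0 !mulr1 add0r sinN cosN c4 mulrN; split=> //.
have e : pi / 2 + - (pi / 4) = pi / 4 :> R by field.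
by rewrite !e c4.
Qed.

Lemma strip_sqnorm p : strip_re p ^+ 2 + strip_im p ^+ 2 = expR (pi * p.1).
Proof.
rewrite /strip_re /strip_im !exprMn -mulrDr cos2Dsin2 mulr1 -expRM_natl addr0; congr expR.
by rewrite mulrA; congr (_ * _); field.
Qed.

(** The square of the point is exp (pi s + i pi (t - 1 / 2)), the value of the Cayley transform
    found in [strip_rigidity]. *)
Lemma strip_double p : [/\ strip_re p ^+ 2 - strip_im p ^+ 2 = expR (pi * p.1) * sin (pi * p.2)
  & 2 * strip_re p * strip_im p = - (expR (pi * p.1) * cos (pi * p.2))].
Proof.
have eE : expR (pi / 2 * p.1 + 0) ^+ 2 = expR (pi * p.1).
  rewrite -expRM_natl addr0; congr expR.
  by rewrite mulrA; congr (_ * _); field.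
have a2 : pi / 2 * p.2 + - (pi / 4) + (pi / 2 * p.2 + - (pi / 4)) = pi * p.2 - pi / 2 by field.
have cD := cosD (pi / 2 * p.2 + - (pi / 4)) (pi / 2 * p.2 + - (pi / 4)).
have sD := sinD (pi / 2 * p.2 + - (pi / 4)) (pi / 2 * p.2 + - (pi / 4)).
rewrite a2 cosB cos_pihalf sin_pihalf mulr0 mulr1 add0r in cD.
rewrite a2 sinB cos_pihalf sin_pihalf mulr0 mulr1 add0r in sD.
rewrite -eE -[- (_ * cos _)]mulrN cD sD /strip_re /strip_im.
by split; ring.
Qed.

Definition flat_cycle : set R[i] :=
  [set w | w != 0 /\ sinh_height (complex.Re w) (complex.Im w) = 0].
Definition graph_cycle : set R[i] :=
  [set w | w != 0 /\ sinh_height (complex.Re w) (complex.Im w)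
                       = D (carg (complex.Re w) (complex.Im w))].

(** Uniqueness of derivatives reads those of Th and X off the model coordinates, so the formulas of
    [pt_re] and [pt_im] need not be differentiated. *)
Lemma model_derivatives (V : normedModType R) (c s y : V -> R) (p v : V) (c' s' y' f g : R) :
  let F q := pt_re (c q) (s q) (y q) in let G q := pt_im (c q) (s q) (y q) in
  (\forall q \near p, c q ^+ 2 + s q ^+ 2 = 1) ->
  is_derive p v F f -> is_derive p v G g ->
  is_derive p v c c' -> is_derive p v s s' -> is_derive p v y y' ->
  X (carg (F p) (G p)) * log_im F G p f g = c p * s' - s p * c' /\
  X (carg (F p) (G p)) * model_dX F G p f g = y' / Num.sqrt (1 + y p ^+ 2).
Proof.
move=> F G cs dF dG dc ds dy.
have [_ FG0 Cp0 Sp0 Yp0] := pt_coords (y p) (nbhs_singleton cs).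
have {}FG0 : F p ^+ 2 + G p ^+ 2 != 0 by [].
have H1 : \forall q \near p, S (carg (F q) (G q)) = s q.
  by apply: filterS cs => q /(pt_coords (y q)) [].
have H2 : \forall q \near p, C (carg (F q) (G q)) = c q.
  by apply: filterS cs => q /(pt_coords (y q)) [].
have H3 : \forall q \near p, model_Y (F q) (G q) = y q.
  by apply: filterS cs => q /(pt_coords (y q)) [].
have e1 := is_derive_unique (is_derive_near H1 (is_derive_carg_csin FG0 dF dG)) ds.
have e2 := is_derive_unique (is_derive_near H2 (is_derive_carg_ccos FG0 dF dG)) dc.
have e3 := is_derive_unique (is_derive_near H3 (is_derive_model_Y FG0 dF dG)) dy.
move: e1 e2 e3; rewrite -/(F p) -/(G p) in Cp0 Sp0 Yp0; rewrite /model_G Cp0 Sp0 Yp0.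
set T := log_im _ _ _ _ _; set V0 := model_dX _ _ _ _ _; set x := X _.
have g0 : Num.sqrt (1 + y p ^+ 2) != 0 by rewrite gt_eqF// sqrtr_gt0 ltr_pwDl// sqr_ge0.
move=> <- <- <-; split; last by field.
rewrite -[LHS]mul1r -(nbhs_singleton cs); ring.
Qed.

Definition model_strip (e : R) (p : R * R) : R[i] :=
  let a := strip_re p in let b := strip_im p in
  pt_re (lens_C a b) (lens_S e a b) (lens_Y e a b) +i*
  pt_im (lens_C a b) (lens_S e a b) (lens_Y e a b).

Let wide : set (R * R) := [set p | - 4^-1 < p.2 < 1 + 4^-1].

Let open_wide : open wide. Proof. exact: open_strip. Qed.

(** * The two explicit holomorphic strips *)

Section ModelStrip.
Variable e : R.
Hypothesis e1 : e ^+ 2 = 1.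
Local Notation u := (model_strip e).

Let N0 p : wide p -> 0 < lens_N2 (strip_re p) (strip_im p).
Proof. by move/strip_re_gt0/lens_N2_gt0. Qed.

Let lens_CSw p : wide p ->
  lens_C (strip_re p) (strip_im p) ^+ 2 + lens_S e (strip_re p) (strip_im p) ^+ 2 = 1.
Proof. by move=> /N0; exact: lens_CS. Qed.

Lemma pderiv_model_strip k : pderiv k wide (fun p => complex.Re (u p)) /\
  pderiv k wide (fun p => complex.Im (u p)).
Proof.
have [ak bk] := pderiv_strip k wide.
have [Ck Sk Yk] := pderiv_lens e N0 ak bk.
exact: (pderiv_pt lens_CSw Ck Sk Yk).
Qed.

Lemma wide_cstrip (s t : R) : 0 <= t <= 1 -> wide (s, t).
Proof. by move=> /andP[t0 t1]; rewrite /wide /=; apply/andP; split; lra. Qed.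

Lemma model_strip_coords p : wide p ->
  let a := strip_re p in let b := strip_im p in
  let F := complex.Re (u p) in let G := complex.Im (u p) in
  [/\ F ^+ 2 + G ^+ 2 != 0, C (carg F G) = lens_C a b, S (carg F G) = lens_S e a b
    & model_Y F G = lens_Y e a b].
Proof. by move=> /lens_CSw cs; case: (pt_coords (lens_Y e (strip_re p) (strip_im p)) cs). Qed.

(** The last equation is the velocity of Th along s; its sign is that of - e and fixes the
    orientation sign of the strip. *)
Lemma model_strip_derive s t : 0 <= t <= 1 ->
  let p := (s, t) in let a := strip_re p in let b := strip_im p in
  let F q := complex.Re (u q) in let G q := complex.Im (u q) in
  exists f1 g1 f2 g2, 
  [/\ [/\ is_derive p (1, 0) F f1, is_derive p (1, 0) G g1,
      is_derive p (0, 1) F f2 & is_derive p (0, 1) G g2],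
    model_dX F G p f1 g1 = log_im F G p f2 g2, log_im F G p f1 g1 = - model_dX F G p f2 g2
    & X (carg (F p) (G p)) * log_im F G p f1 g1 =
        - (pi * e * a * (a ^+ 2 + b ^+ 2 + 1)) / lens_N2 a b].
Proof.
move=> t01 p a b F G; have wp := wide_cstrip s t01.
have [[_ [F1 [F2 [dF _ _]]]] [_ [G1 [G2 [dG _ _]]]]] := pderiv_model_strip 1.
have [dF1 dF2] := dF p wp; have [dG1 dG2] := dG p wp.
have [da1 db1 da2 db2] := is_derive_strip s t.
have [c1 [s1 [y1 [dc1 ds1 dy1 T1 V1]]]] := is_derive_lens e1 (N0 wp) da1 db1.
have [c2 [s2 [y2 [dc2 ds2 dy2 T2 V2]]]] := is_derive_lens e1 (N0 wp) da2 db2.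
have CSn : \forall q \near p, lens_C (strip_re q) (strip_im q) ^+ 2 + lens_S e (strip_re q) (strip_im q) ^+ 2 = 1.
  by apply: filterS (open_nbhs_nbhs (conj open_wide wp)) => q /lens_CSw.
have [E1 E2] := model_derivatives CSn dF1 dG1 dc1 ds1 dy1.
have [E3 E4] := model_derivatives CSn dF2 dG2 dc2 ds2 dy2.
exists (F1 p), (G1 p), (F2 p), (G2 p); split => //.
- apply: (mulfI (lt0r_neq0 (X0 (carg (F p) (G p))))); rewrite [LHS]E2 [RHS]E3 T2 V1.
  by rewrite -/a -/b; have := lt0r_neq0 (N0 wp); rewrite -/a -/b => n0; field.
- apply: (mulfI (lt0r_neq0 (X0 (carg (F p) (G p))))); rewrite mulrN.
  apply/(etrans E1)/(etrans _ (congr1 -%R (esym E4))); rewrite T1 V2.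
  by rewrite -/a -/b; have := lt0r_neq0 (N0 wp); rewrite -/a -/b => n0; field.
- rewrite [LHS]E1 T1 -/a -/b.
  by have := lt0r_neq0 (N0 wp); rewrite -/a -/b => n0; field.
Qed.

Lemma normc_le (x y : R) : Normc.normc (x +i* y) <= `|x| + `|y|.
Proof.
rewrite /Normc.normc -[leRHS]ger0_norm ?addr_ge0// -sqrtr_sqr ler_wsqrtr//.
rewrite -(real_normK (num_real x)) -(real_normK (num_real y)).
have := normr_ge0 x; have := normr_ge0 y; nra.
Qed.

Lemma pt_crit x : S x = 0 -> pt_re (C x) 0 0 = cos x /\ pt_im (C x) 0 0 = sin x.
Proof.
move=> Sx; have ab1 : (1 * cos x) ^+ 2 + (1 * sin x) ^+ 2 = 1 by rewrite !mul1r cos2Dsin2.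
have ab0 : (1 * cos x) ^+ 2 + (1 * sin x) ^+ 2 != 0 by rewrite ab1 oner_neq0.
have := ptK ab0; rewrite /model_Y !periodic_carg// Sx /sinh_height ab1 invr1 subrr mul0r mulr0.
by rewrite subrr !mul1r.
Qed.

(** The reflection z -> 1 / conj z, which is s -> - s on the strip, changes only the sign of cos Th;
    it reduces the end at +oo to the end at -oo. *)
Lemma lens_inv (r c s : R) : 0 < r -> c ^+ 2 + s ^+ 2 = 1 -> 0 < lens_N2 (r * c) (r * s) ->
  [/\ lens_C (r^-1 * c) (r^-1 * s) = - lens_C (r * c) (r * s),
      lens_S e (r^-1 * c) (r^-1 * s) = lens_S e (r * c) (r * s)
    & lens_Y e (r^-1 * c) (r^-1 * s) = lens_Y e (r * c) (r * s)].
Proof.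
move=> r0 cs N; have rn0 := lt0r_neq0 r0.
have sE : s ^+ 2 = 1 - c ^+ 2 by rewrite -cs addrC addKr.
have sq (x : R) : (x * c) ^+ 2 + (x * s) ^+ 2 = x ^+ 2 by rewrite !exprMn -mulrDr cs mulr1.
have NE : Num.sqrt (lens_N2 (r^-1 * c) (r^-1 * s)) = r ^- 2 * Num.sqrt (lens_N2 (r * c) (r * s)).
  have -> : lens_N2 (r^-1 * c) (r^-1 * s) = (r ^- 2) ^+ 2 * lens_N2 (r * c) (r * s).
    by rewrite /lens_N2 !sq; field.
  by rewrite sqrtrM ?sqr_ge0// sqrtr_sqr ger0_norm// invr_ge0 exprn_ge0// ltW.
have rN : Num.sqrt (lens_N2 (r * c) (r * s)) != 0 by rewrite gt_eqF// sqrtr_gt0.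
rewrite /lens_C /lens_S /lens_Y NE !sq; move: rN; set z := Num.sqrt _ => z0.
by split; field; rewrite rn0 z0.
Qed.

Lemma model_strip_reflect s t : 0 <= t <= 1 ->
  let a := strip_re (- s, t) in let b := strip_im (- s, t) in
  u (s, t) = pt_re (- 1 * lens_C a b) (lens_S e a b) (lens_Y e a b) +i*
             pt_im (- 1 * lens_C a b) (lens_S e a b) (lens_Y e a b).
Proof.
move=> t01 a b; have := N0 (wide_cstrip s t01); rewrite /a /b /strip_re /strip_im /= mulrN !addr0 expRN.
set r := expR _; set c := cos _; set q := sin _ => Np.
have [-> -> ->] := lens_inv (expR_gt0 _ : 0 < r) (cos2Dsin2 _ : c ^+ 2 + q ^+ 2 = 1) Np.
by rewrite mulN1r opprK /u /strip_re /strip_im /= !addr0.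
Qed.

(** At z = 0 the lens formulas are continuous and give cos Th = -1, sin Th = 0 and X = 0; the sign
    [sg] selects which of the two intersection points is described. *)
Lemma model_limit (sg x : R) : sg ^+ 2 = 1 -> C x = - sg -> S x = 0 ->
  forall eps, 0 < eps -> exists2 d, 0 < d & forall a b, `|a| < d -> `|b| < d ->
    Normc.normc ((pt_re (sg * lens_C a b) (lens_S e a b) (lens_Y e a b) +i*
       pt_im (sg * lens_C a b) (lens_S e a b) (lens_Y e a b)) - cexp x) < eps.
Proof.
move=> sg1 Cx Sx eps eps0.
pose U : set (R * R) := [set p | 0 < lens_N2 p.1 p.2].
have [Ck Sk Yk] := @pderiv_lens 0 U fst snd e (fun p Up => Up) (pderiv_fst 0 U) (pderiv_snd 0 U).
have CSU p : U p -> (sg * lens_C p.1 p.2) ^+ 2 + lens_S e p.1 p.2 ^+ 2 = 1.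
  by move=> Up; rewrite exprMn sg1 mul1r; exact: lens_CS.
have Ck' := pderivM (pderiv_cst 0 U sg) Ck.
have [/pderiv_continuous cre /pderiv_continuous cim] := pderiv_pt CSU Ck' Sk Yk.
have N00 : lens_N2 0 0 = 1 by rewrite /lens_N2; ring.
have U0 : U (0, 0) by rewrite /U /= N00.
have C00 : sg * lens_C 0 0 = C x.
  by rewrite /lens_C N00 sqrtr1 Cx; field.
have S00 : lens_S e 0 0 = 0 by rewrite /lens_S mulr0 mulr0 mul0r.
have Y00 : lens_Y e 0 0 = 0 by rewrite /lens_Y mulr0 mulr0 mul0r.
have [pr pi] := pt_crit Sx.
have e2 : 0 < eps / 2 by rewrite divr_gt0.
have := cre _ U0; rewrite /prop_for /continuous_at /= C00 S00 Y00 pr => /cvgrPdist_lt /(_ _ e2) n1.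
have := cim _ U0; rewrite /prop_for /continuous_at /= C00 S00 Y00 pi => /cvgrPdist_lt /(_ _ e2) n2.
have [d d0 dH] := (nbhs_ballP (0, 0) _).1 (filterI n1 n2).
exists d => // a b ad bd; have [] := dH (a, b).
  by split; rewrite /= /ball /= sub0r normrN.
rewrite /= => h1 h2.
apply: (le_lt_trans (normc_le (pt_re _ _ _ - cos x) (pt_im _ _ _ - sin x))).
by rewrite distrC [X in _ + X]distrC (splitr eps) ltrD.
Qed.

Lemma strip_small s t d : 0 < d -> s < ln d / (pi / 2) ->
  `|strip_re (s, t)| < d /\ `|strip_im (s, t)| < d.
Proof.
move=> d0 sd; have p0 : 0 < pi / 2 :> R by rewrite divr_gt0 ?pi_gt0.
have Ed : expR (pi / 2 * s + 0) < d.
  by rewrite addr0 -[ltRHS]lnK ?posrE// ltr_expR mulrC -ltr_pdivlMr.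
have H (x : R) : `|x| <= 1 -> `|expR (pi / 2 * s + 0) * x| < d.
  move=> x1; apply: le_lt_trans Ed; rewrite normrM ger0_norm ?expR_ge0//.
  by rewrite ler_piMr ?expR_ge0.
split; apply: H; first by rewrite ler_norml cos_geN1 cos_le1.
by rewrite ler_norml sin_geN1 sin_le1.
Qed.

Lemma model_strip_strip : strip (logJ Jk Jp) flat_cycle graph_cycle (cexp n) (cexp m) u.
Proof.
split.
- exists 4^-1; first by rewrite invr_gt0.
  by move=> k; have [/(pderiv_class_C open_wide) ? /(pderiv_class_C open_wide) ?] := pderiv_model_strip k.
- move=> s t t01; have [FG0 _ _ _] := model_strip_coords (wide_cstrip s t01).
  split; first by rewrite /u /= sqrD_neq0.
  have [f1 [g1 [f2 [g2 [[[_ d1] [_ d2] [_ d3] [_ d4]] E1 E2 _]]]]] := model_strip_derive s t01.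
  rewrite /cderive d1 d2 d3 d4.
  by apply/(logJ_eq f1 g1 f2 g2 0 FG0).
- move=> s; have t0 : 0 <= (0 : R) <= 1 by rewrite lexx ler01.
  have t1 : 0 <= (1 : R) <= 1 by rewrite lexx ler01.
  have [b0 b1] := strip_boundary s; split.
  + have [FG0 _ S0 Y0] := model_strip_coords (wide_cstrip s t0).
    split; first by rewrite /u /= sqrD_neq0.
    by apply/eqP; rewrite -model_Y_L0 Y0 S0 /lens_Y b0 /lens_S !mulrN !mulNr.
  + have [FG0 _ S0 Y0] := model_strip_coords (wide_cstrip s t1).
    split; first by rewrite /u /= sqrD_neq0.
    by apply/eqP; rewrite -model_Y_L1 Y0 S0 /lens_Y b1.
- move=> eps eps0; have [Cn Sn] := ccosn mn.
  have [d d0 H] := model_limit (expr1n _ 2) Cn Sn eps0.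
  exists (ln d / (pi / 2)) => s t t01 sS.
  have [ad bd] := strip_small t d0 sS.
  by have := H _ _ ad bd; rewrite mul1r.
- move=> eps eps0; have [Cm Sm] := ccosm mn.
  have Cm' : C m = - - 1 by rewrite opprK.
  have N1 : (- 1 : R) ^+ 2 = 1 by rewrite sqrrN expr1n.
  have [d d0 H] := model_limit N1 Cm' Sm eps0.
  exists (- (ln d / (pi / 2))) => s t t01 sS.
  have sS' : - s < ln d / (pi / 2) by rewrite ltrNl.
  have [ad bd] := strip_small t d0 sS'.
  by rewrite model_strip_reflect//; exact: H.
Qed.

End ModelStrip.
Lemma normc_ge (x y : R) : `|x| <= Normc.normc (x +i* y) /\ `|y| <= Normc.normc (x +i* y).
Proof.
by split; rewrite /= -sqrtr_sqr ler_wsqrtr// ?lerDl ?lerDr sqr_ge0.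
Qed.

(** cosh (log ((z + i) / (z - i))) = (z^2 - 1) / (z^2 + 1), and cosh is even, so [e] drops out; [M]
    is |z^2 + 1|^2. *)
Lemma lens_kappa e c s t : e ^+ 2 = 1 -> 0 <= t <= 1 ->
  let a := strip_re (s + c, t) in let b := strip_im (s + c, t) in
  let E := expR (pi * (s + c)) in let M := E ^+ 2 + 2 * E * sin (pi * t) + 1 in
  (a ^+ 2 + b ^+ 2 + 1) * (Num.sqrt (lens_N2 a b))^-1 * lens_C a b = (E ^+ 2 - 1) / M /\
  lens_Y e a b * lens_S e a b = - (2 * E * cos (pi * t)) / M.
Proof.
move=> e1 t01 a b E M; have N0 : 0 < lens_N2 a b.
  by apply/lens_N2_gt0/strip_re_gt0/wide_cstrip.
have qE : a ^+ 2 + b ^+ 2 = E := strip_sqnorm (s + c, t).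
have [dE sE] := strip_double (s + c, t); rewrite -/a -/b -/E /= in dE sE.
have NE : lens_N2 a b = M.
  rewrite /lens_N2 qE /M; have -> : 4 * a ^+ 2 = 2 * (a ^+ 2 + b ^+ 2) + 2 * (a ^+ 2 - b ^+ 2) by ring.
  by rewrite qE dE; ring.
have r2 : Num.sqrt (lens_N2 a b) ^+ 2 = M by rewrite sqr_sqrtr ?ltW.
have r0 : Num.sqrt (lens_N2 a b) != 0 by rewrite gt_eqF// sqrtr_gt0.
rewrite -r2 /lens_C qE /lens_Y /lens_S; split; first by field.
have -> : - (2 * E * cos (pi * t)) = e ^+ 2 * (2 * (2 * a * b)) by rewrite e1 sE; ring.
by field.
Qed.

(** The closed strip is star-shaped about the origin, so the intermediate value theorem on segments
    is enough. *)
Lemma nonzero_constant_sign (f : R * R -> R) :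
  (forall p, cstrip p -> {for p, continuous f}) -> (forall p, cstrip p -> f p != 0) ->
  exists2 e : R, e = 1 \/ e = -1 & forall p, cstrip p -> 0 < e * f p.
Proof.
move=> cf f0; pose o : R * R := (0, 0).
have co : cstrip o by rewrite /cstrip /= lexx ler01.
have H p : cstrip p -> 0 < f o * f p.
  move=> cp; pose q (x : R) : R * R := (x * p.1, x * p.2).
  have cq x : 0 <= x <= 1 -> cstrip (q x).
    move: cp; rewrite /cstrip /= => /andP[p0 p1] /andP[x0 x1].
    by rewrite mulr_ge0//= mulr_ile1.
  have cfq x : 0 <= x <= 1 -> {for x, continuous (fun x => f (q x))}.
    move=> x01; rewrite /prop_for /continuous_at.
    apply: (@continuous_comp _ _ _ q f); last exact: cf (cq _ x01).
    have c1 : y * p.1 @[y --> x] --> x * p.1 by apply: cvgMl; exact: cvg_id.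
    have c2 : y * p.2 @[y --> x] --> x * p.2 by apply: cvgMl; exact: cvg_id.
    exact: (cvg_pair c1 c2).
  rewrite ltNge; apply/negP => fp.
  have q0 : q 0 = o by rewrite /q !mul0r.
  have q1 : q 1 = p by rewrite /q !mul1r -surjective_pairing.
  have W : {within `[0, 1], continuous (fun x => f (q x))}.
    apply: continuous_in_subspaceT => x; rewrite inE /= in_itv /=; exact: cfq.
  have [|x xI fx] := @IVT R (fun x => f (q x)) 0 1 0 ler01 W.
    rewrite q0 q1 ge_min le_max; have [h|h] := leP (f o) 0 => /=.
      by rewrite leNgt; apply/negP => h'; have := f0 _ co; nra.
    by rewrite (ltW h) /= andbT; nra.
  by move/eqP: fx; apply/negP/f0/cq; rewrite in_itv /= in xI.
have [fo|fo] := ltP 0 (f o).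
  exists 1; first by left.
  by move=> p /H; rewrite mul1r pmulr_rgt0.
exists (-1); first by right.
by move=> p /H; rewrite mulN1r oppr_gt0 nmulr_rgt0// lt_neqAle fo f0.
Qed.

(** * Classification of the holomorphic strips *)

Section Classification.
Variable v : R * R -> R[i].
Hypothesis vs : strip (logJ Jk Jp) flat_cycle graph_cycle (cexp n) (cexp m) v.

Let F p := complex.Re (v p).
Let G p := complex.Im (v p).

Let FG0 p : cstrip p -> F p ^+ 2 + G p ^+ 2 != 0.
Proof.
case: vs => _ H _ _ _; case: p => s t /(H s t) [+ _].
by rewrite -sqrD_neq0 /F /G; case: (v (s, t)).
Qed.

Let FGk k : pderiv k cstrip F /\ pderiv k cstrip G.
Proof.
case: vs => -[d d0 sm] _ _ _ _; have sub : cstrip `<=` [set p | - d < p.2 < 1 + d].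
  by move=> p; rewrite /cstrip /= => /andP[p0 p1]; apply/andP; split; lra.
split; apply: pderiv_sub sub _; apply: class_C_pderiv => j; by have [] := sm j.
Qed.

Let K1 p := kap1 (F p) (G p).
Let K2 p := kap2 (F p) (G p).

Lemma strip_kappa_holomorphic : holomorphic K1 K2.
Proof.
have [F2 G2] := FGk 2; split; [exact: pderiv_kap1|exact: pderiv_kap2|].
move=> p cp; have [_ [f1 [f2 [dF _ _]]]] := F2; have [_ [g1 [g2 [dG _ _]]]] := G2.
have [dF1 dF2] := dF p cp; have [dG1 dG2] := dG p cp.
have /(logJ_eq (f1 p) (g1 p) (f2 p) (g2 p) 0 (FG0 cp)) [E1 E2] :
    (f1 p +i* g1 p) + logJ Jk Jp (F p +i* G p) (f2 p +i* g2 p) = 0.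
  case: vs => _ H _ _ _; case: p cp dF1 dF2 dG1 dG2 => s t cp [_ dF1] [_ dF2] [_ dG1] [_ dG2].
  have [_] := H s t cp; rewrite /cderive dF1 dF2 dG1 dG2 /F /G.
  by case: (v (s, t)).
have p0 := FG0 cp.
have [_ ->] := is_derive_kap1 p0 dF1 dG1; have [_ ->] := is_derive_kap2 p0 dF2 dG2.
have [_ ->] := is_derive_kap1 p0 dF2 dG2; have [_ ->] := is_derive_kap2 p0 dF1 dG1.
set T1 := log_im F G p (f1 p) (g1 p); set T2 := log_im F G p (f2 p) (g2 p).
set V1 := model_dX F G p (f1 p) (g1 p); set V2 := model_dX F G p (f2 p) (g2 p).
have -> : V1 = T2 by exact: E1.
have -> : T1 = - V2 by exact: E2.
by split; ring.
Qed.

(** The factor [t *+ 2 - 1] is the sign -1 at t = 0 and 1 at t = 1, so that both boundary conditions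
    are treated together. *)
Let boundary s t : t = 0 \/ t = 1 ->
  cstrip (s, t) /\ model_Y (F (s, t)) (G (s, t)) = (t *+ 2 - 1) * S (carg (F (s, t)) (G (s, t))).
Proof.
case: vs => _ _ H _ _; have [[v0 h0] [v1 h1]] := H s => -[] ->.
- split; first by rewrite /cstrip /= lexx ler01.
  by apply/eqP; rewrite mul0rn sub0r mulN1r model_Y_L0 /F /G h0.
- split; first by rewrite /cstrip /= lexx ler01.
  by apply/eqP; rewrite mulr2n addrK mul1r model_Y_L1 /F /G h1.
Qed.

Let kappa_boundary s t : t = 0 \/ t = 1 -> let x := S (carg (F (s, t)) (G (s, t))) in
  K1 (s, t) ^+ 2 + K2 (s, t) ^+ 2 = 1 /\ K2 (s, t) = (t *+ 2 - 1) * x ^+ 2.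
Proof.
move=> t01 x; have [cp Y0] := boundary s t01; rewrite -/x in Y0.
have sg : (t *+ 2 - 1) ^+ 2 = 1 by case: t01 => ->; rewrite ?mul0rn ?sub0r ?sqrrN ?mulr2n ?addrK expr1n.
have K2E : K2 (s, t) = (t *+ 2 - 1) * x ^+ 2 by rewrite /K2 /kap2 Y0 -/x expr2 mulrA.
split=> //; rewrite K2E /K1 /kap1.
have := C1 (carg (F (s, t)) (G (s, t))); rewrite -/x.
have := model_G2 (F (s, t)) (G (s, t)); rewrite Y0.
clearbody x; set g := model_G _ _; set c := C _; clearbody g c => g2 c2.
have c2' : c ^+ 2 = 1 - x ^+ 2 by rewrite -c2 addrK.
by rewrite !exprMn g2 c2' exprMn sg; ring.
Qed.

Let crit_limit x : S x = 0 -> forall e, 0 < e ->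
  exists2 d, 0 < d & forall p, Normc.normc (v p - cexp x) < d ->
    `|K1 p - C x| < e /\ `|K2 p| < e.
Proof.
move=> Sx e e0; pose U : set (R * R) := [set p | p.1 ^+ 2 + p.2 ^+ 2 != 0].
have c1 := pderiv_continuous (@pderiv_kap1 0 U fst snd (fun p Up => Up) (pderiv_fst 0 U) (pderiv_snd 0 U)).
have c2 := pderiv_continuous (@pderiv_kap2 0 U fst snd (fun p Up => Up) (pderiv_fst 0 U) (pderiv_snd 0 U)).
have ab1 : (1 * cos x) ^+ 2 + (1 * sin x) ^+ 2 = 1 by rewrite !mul1r cos2Dsin2.
have Up : U (1 * cos x, 1 * sin x) by rewrite /U /= ab1 oner_eq0.
have Y0 : model_Y (1 * cos x) (1 * sin x) = 0.
  by rewrite /model_Y !periodic_carg// Sx /sinh_height ab1 invr1 subrr mul0r mulr0 subrr.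
have K1E : kap1 (1 * cos x) (1 * sin x) = C x.
  by rewrite /kap1 /model_G Y0 (periodic_carg _ Cp ltr01) expr0n addr0 sqrtr1 mul1r.
have K2E : kap2 (1 * cos x) (1 * sin x) = 0 by rewrite /kap2 Y0 mul0r.
have := c1 _ Up; rewrite /prop_for /continuous_at /= K1E => /cvgrPdist_lt /(_ _ e0) n1.
have := c2 _ Up; rewrite /prop_for /continuous_at /= K2E => /cvgrPdist_lt /(_ _ e0) n2.
have [d d0 dH] := (nbhs_ballP _ _).1 (filterI n1 n2).
exists d => // p pd; have [] := dH (F p, G p).
  have [h1 h2] := normc_ge (F p - cos x) (G p - sin x).
  have {}pd : Normc.normc ((F p - cos x) +i* (G p - sin x)) < d by move: pd; rewrite /F /G; case: (v p).
  split; rewrite /= /ball /= mul1r distrC.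
    exact: le_lt_trans h1 pd.
  exact: le_lt_trans h2 pd.
by rewrite /= sub0r normrN distrC.
Qed.

Lemma strip_kappa : exists c, forall s t, 0 <= t <= 1 ->
  let E := expR (pi * (s + c)) in let M := E ^+ 2 + 2 * E * sin (pi * t) + 1 in
  [/\ 0 < M, K1 (s, t) = (E ^+ 2 - 1) / M & K2 (s, t) = - (2 * E * cos (pi * t)) / M].
Proof.
have [Cm Sm] := ccosm mn; have [Cn Sn] := ccosn mn.
apply: strip_rigidity; first exact: strip_kappa_holomorphic.
- move=> s; have [-> ->] := kappa_boundary s (or_introl erefl).
  by rewrite mul0rn sub0r mulN1r oppr_le0 sqr_ge0.
- move=> s; have [-> ->] := kappa_boundary s (or_intror erefl).
  by rewrite mulr2n addrK mul1r sqr_ge0.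
(* Here K2 = 0 forces sin Th = 0 and sinh X = 0, a branch point of cosh, so both terms of the
   derivative of [kap1] vanish. *)
- move=> s t t01 k1; have [h1 h2] := kappa_boundary s t01; have [cp Y0] := boundary s t01.
  have K0 : K2 (s, t) = 0.
    have : K2 (s, t) ^+ 2 = 0 by case: k1 h1 => ->; rewrite ?sqrrN expr1n; lra.
    by move/eqP; rewrite sqrf_eq0 => /eqP.
  have S0 : S (carg (F (s, t)) (G (s, t))) = 0.
    move/eqP: h2; rewrite K0 eq_sym mulf_eq0 sqrf_eq0 => /orP[/eqP h|/eqP//].
    by exfalso; case: t01 h => ->; rewrite ?mul0rn ?mulr2n; lra.
  rewrite S0 mulr0 in Y0.
  have [[_ [f1 [f2 [dF _ _]]]] [_ [g1 [g2 [dG _ _]]]]] := FGk 1.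
  have [_ dF2] := dF _ cp; have [_ dG2] := dG _ cp.
  have := is_derive_kap1 (FG0 cp) dF2 dG2; rewrite S0 Y0.
  by move/is_derive_eq; apply; ring.
- move=> e e0; have [d d0 H] := crit_limit Sn e0.
  case: vs => _ _ _ /(_ d d0) [T HT] _; exists T => s t t01 sT.
  by have := H _ (HT s t t01 sT); rewrite Cn opprK.
- move=> e e0; have [d d0 H] := crit_limit Sm e0.
  case: vs => _ _ _ _ /(_ d d0) [T HT]; exists T => s t t01 sT.
  by have := H _ (HT s t t01 sT); rewrite Cm.
Qed.

Lemma strip_classification : exists e c, (e = 1 \/ e = -1) /\
  forall s t, 0 <= t <= 1 -> v (s, t) = model_strip e (s + c, t).
Proof.
have [c Hc] := strip_kappa; have [F1 G1] := FGk 1.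
have fk : pderiv 1 cstrip (fun p => S (carg (F p) (G p))) by exact: pderiv_carg.
have [p cp|p cp|e e1 He] := @nonzero_constant_sign (fun p => S (carg (F p) (G p))).
- exact: (pderiv_continuous fk cp).
(* If sin Th = 0 then K is real with |K1| >= 1, whereas the explicit formula gives |K1| < 1. Hence
   sin Th keeps one sign [e], which selects one of the two preimages under cosh. *)
- apply/eqP => S0; case: p cp S0 => s t cp S0; have [M0 k1 k2] := Hc s t cp.
  have K0 : K2 (s, t) = 0 by rewrite /K2 /kap2 S0 mulr0.
  have := C1 (carg (F (s, t)) (G (s, t))); rewrite S0 expr0n addr0 => c2.
  have : 1 <= K1 (s, t) ^+ 2.
    rewrite /K1 /kap1 exprMn c2 mulr1 model_G2 lerDl; exact: sqr_ge0.
  have /andP[t0 t1] : 0 <= t <= 1 := cp.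
  have st : 0 <= sin (pi * t).
    by apply: sin_ge0_pi; rewrite ?mulr_ge0 ?pi_ge0//= ger_pMr ?pi_gt0.
  rewrite k1 exprMn exprVn ler_pdivlMr ?exprn_gt0// mul1r.
  move: M0; set E := expR _; have E0 : 0 < E by exact: expR_gt0.
  clearbody E; set x := sin _ in st *; clearbody x => M0.
  rewrite leNgt => /negP[]; rewrite -subr_gt0.
  have -> : (E ^+ 2 + 2 * E * x + 1) ^+ 2 - (E ^+ 2 - 1) ^+ 2 =
    (2 * E * x + 2) * (2 * E ^+ 2 + 2 * E * x) by ring.
  by have := mulr_ge0 (ltW E0) st; have := exprn_gt0 2 E0; nra.
exists e, c; split=> // s t t01; have [M0 k1 k2] := Hc s t t01.
have e2 : e ^+ 2 = 1 by case: e1 => ->; rewrite ?sqrrN expr1n.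
have w : wide (s + c, t) by exact: wide_cstrip.
have a0 := strip_re_gt0 w.
have [l1 l2] := lens_kappa c s e2 t01.
rewrite -k1 in l1; rewrite -k2 in l2.
have [c1 s1 y1] := lens_unique e2 a0 (lens_N2_gt0 _ a0) (C1 _) (He (s, t) t01) (esym l1) (esym l2).
have [p1 p2] := ptK (FG0 (p := (s, t)) t01).
rewrite /model_strip -c1 -s1 -y1 p1 p2 /F /G; by case: (v (s, t)).
Qed.

End Classification.

(** * Boundary crossings, phases and signs of the strips *)

Lemma D_eq0 x : (D x == 0) = (S x == 0).
Proof.
by rewrite -[LHS]orFb -(gt_eqF (al0 x)) -mulf_eq0 alD mulf_eq0 pnatr_eq0.
Qed.

Definition carg_of (w : R[i]) : R := carg (complex.Re w) (complex.Im w).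

Lemma flat_graph w : (flat_cycle w -> (graph_cycle w <-> S (carg_of w) = 0)) /\
  (graph_cycle w -> (flat_cycle w <-> S (carg_of w) = 0)).
Proof.
rewrite /flat_cycle /graph_cycle /carg_of /=; set x := carg _ _; split=> -[w0 h]; split.
- by case=> _; rewrite h => /esym/eqP; rewrite D_eq0 => /eqP.
- by move=> Sx; split=> //; rewrite h; apply/esym/eqP; rewrite D_eq0 Sx.
- by case=> _; rewrite h => /eqP; rewrite D_eq0 => /eqP.
- by move=> Sx; split=> //; rewrite h; apply/eqP; rewrite D_eq0 Sx.
Qed.

Lemma unit_vector_ratio (c s c' s' : R) : c ^+ 2 + s ^+ 2 = 1 -> c' ^+ 2 + s' ^+ 2 = 1 ->
  0 < s * s' -> c * s' = c' * s -> c = c' /\ s = s'.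
Proof.
move=> h h' ss e; have s2 : s ^+ 2 = s' ^+ 2.
  transitivity ((c' ^+ 2 + s' ^+ 2) * s ^+ 2); first by rewrite h' mul1r.
  rewrite mulrDl -exprMn -e exprMn mulrC -[s' ^+ 2 in RHS]mulr1 -h; ring.
have s'0 : s' != 0 by apply/eqP => z; rewrite z mulr0 ltxx in ss.
have sE : s = s'.
  move/eqP: s2; rewrite eqf_sqr => /orP[/eqP//|/eqP sN].
  by move: ss; rewrite sN mulNr oppr_gt0 ltNge -expr2 sqr_ge0.
by split=> //; apply: (mulIf s'0); rewrite e sE.
Qed.

Lemma model_strip_eq e s t w : e ^+ 2 = 1 -> 0 <= t <= 1 -> w != 0 ->
  let x := carg_of w in
  let a := strip_re (s, t) in let b := strip_im (s, t) in
  model_strip e (s, t) = w <-> [/\ lens_C a b = C x, lens_S e a b = S x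
    & lens_Y e a b = model_Y (complex.Re w) (complex.Im w)].
Proof.
move=> e1 t01; case: w => a0 b0; rewrite sqrD_neq0 /carg_of /= => w0.
set a := strip_re _; set b := strip_im _.
have [_ cC cS cY] := model_strip_coords e1 (wide_cstrip s t01).
split=> [E|[h1 h2 h3]]; first by rewrite -cC -cS -cY E.
by rewrite /model_strip -/a -/b h1 h2 h3; have [-> ->] := ptK w0.
Qed.

(** On a boundary ray sinh (pi s / 2) is a fixed multiple of cot Th; so a point of the cycle away
    from the intersections is met exactly once when [e] has the sign of its [S], and never
    otherwise. *)
Lemma model_strip_crossing e t w : e ^+ 2 = 1 -> t = 0 \/ t = 1 -> w != 0 ->
  let x := carg_of w in S x != 0 ->
  model_Y (complex.Re w) (complex.Im w) = (t *+ 2 - 1) * S x ->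
  exists s0, [set s | model_strip e (s, t) = w] = if 0 < e * S x then [set s0] else set0.
Proof.
move=> e1 t01 w0 x S0 Yw.
have t01' : 0 <= t <= 1 by case: t01 => ->; rewrite ?lexx ler01.
pose k : R := cos (pi / 4).
have k0 : 0 < k by apply: cos_gt0_pihalf; apply/andP; have := pi_gt0 R; split; lra.
have k2 : 2 * k ^+ 2 = 1.
  have := strip_sqnorm (0, 1); have [_ ->] := strip_boundary 0.
  rewrite /strip_re /= !mulr0 mulr1 add0r expR0 mul1r.
  have -> : pi / 2 + - (pi / 4) = pi / 4 :> R by field.
  by rewrite /k; lra.
pose r s : R := expR (pi / 2 * s + 0).
have r0 s : 0 < r s by exact: expR_gt0.
have aE s : strip_re (s, t) = r s * k.
  by case: t01 => ->; rewrite /strip_re /= -/(r s) ?mulr0 ?mulr1 ?add0r ?cosN//;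
     congr (_ * cos _); field.
have bE s : strip_im (s, t) = (t *+ 2 - 1) * strip_re (s, t).
  have [b0 b1] := strip_boundary s; case: t01 => ->.
    by rewrite b0 mul0rn sub0r mulN1r.
  by rewrite b1 mulr2n addrK mul1r.
have sg2 : (t *+ 2 - 1) ^+ 2 = 1.
  by case: t01 => ->; rewrite ?mul0rn ?sub0r ?sqrrN ?mulr2n ?addrK expr1n.
have qE s : strip_re (s, t) ^+ 2 + strip_im (s, t) ^+ 2 = r s ^+ 2.
  rewrite bE aE; transitivity (r s ^+ 2 * k ^+ 2 * (1 + (t *+ 2 - 1) ^+ 2)); first by ring.
  by rewrite sg2; transitivity (r s ^+ 2 * (2 * k ^+ 2)); [ring|rewrite k2 mulr1].
have Sgt s : 0 < e * lens_S e (strip_re (s, t)) (strip_im (s, t)).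
  have a0 := strip_re_gt0 (wide_cstrip s t01').
  have -> : e * lens_S e (strip_re (s, t)) (strip_im (s, t)) = e ^+ 2 *
      (2 * strip_re (s, t) * (Num.sqrt (lens_N2 (strip_re (s, t)) (strip_im (s, t))))^-1).
    by rewrite /lens_S; ring.
  rewrite e1 mul1r; apply: mulr_gt0; first by apply: mulr_gt0.
  by rewrite invr_gt0 sqrtr_gt0 lens_N2_gt0.
have eqE s : model_strip e (s, t) = w <-> 0 < e * S x /\ (r s - (r s)^-1) / 2 = e * k * C x / S x.
  have N0 := lens_N2_gt0 (strip_im (s, t)) (strip_re_gt0 (wide_cstrip s t01')).
  have n0 : Num.sqrt (lens_N2 (strip_re (s, t)) (strip_im (s, t))) != 0 by rewrite gt_eqF// sqrtr_gt0.
  have rn0 := lt0r_neq0 (r0 s).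
  have cross : lens_C (strip_re (s, t)) (strip_im (s, t)) * (2 * e * k * r s) =
      (r s ^+ 2 - 1) * lens_S e (strip_re (s, t)) (strip_im (s, t)).
    rewrite /lens_C /lens_S; move: n0; set z := Num.sqrt _; clearbody z => n0.
    by rewrite qE aE; field.
  rewrite model_strip_eq//; split=> [[cC cS _]|[eS rE]].
    split; first by rewrite -cS.
    have e0 : e != 0 by apply/eqP => z; move: e1; rewrite z expr0n => /eqP; rewrite eq_sym oner_eq0.
    rewrite cC cS in cross.
    have d0 : 2 * r s * S x != 0 by apply: mulf_neq0 => //; apply: mulf_neq0 => //; rewrite pnatr_eq0.
    apply: (mulfI d0).
    transitivity ((r s ^+ 2 - 1) * S x); first by field; rewrite rn0.
    by rewrite -cross; field.
  have cs := lens_CS e1 N0.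
  have [|| cC cS] := unit_vector_ratio cs (C1 x).
  - rewrite -[ltRHS]mul1r -e1; have -> : forall z z' : R, e ^+ 2 * (z * z') = (e * z) * (e * z') by move=> *; ring.
    exact: mulr_gt0.
  - have key : (r s ^+ 2 - 1) * S x = 2 * e * k * r s * C x.
      transitivity ((r s - (r s)^-1) / 2 * (2 * r s * S x)); first by field.
      by rewrite rE; field.
    have d0 : 2 * e * k * r s != 0.
      rewrite !mulf_neq0 ?pnatr_eq0 ?(gt_eqF k0)//.
      by apply/eqP => z; move: e1; rewrite z expr0n => /eqP; rewrite eq_sym oner_eq0.
    apply: (mulfI d0); rewrite mulrA [_ * lens_C _ _]mulrC cross mulrAC key; ring.
  by split=> //; rewrite Yw -cS /lens_Y /lens_S bE; ring.
have [h hE] : exists h : R, h = e * k * C x / S x by eexists.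
have [q0 qh] := sinh_sqrt h; set q := h + _ in q0 qh.
exists (ln q / (pi / 2)); have p0 : 0 < pi / 2 :> R by rewrite divr_gt0 ?pi_gt0.
case: ifPn => eS; apply/seteqP; split => s //=; last 1 first.
- by move=> /eqE[]; rewrite (negbTE eS).
- move=> /eqE[_ rE]; have rq : r s = q.
    by rewrite -(sinh_sqrK (r0 s)) rE -hE.
  by rewrite -rq /r expRK addr0 [pi / 2 * s]mulrC mulfK ?gt_eqF.
- move=> ->; apply/eqE; split=> //; rewrite /r addr0 [_ * (_ / _)]mulrC divfK ?gt_eqF//.
  by rewrite lnK ?posrE// qh.
Qed.
(** Along the graph d log r is [D' / (q + q^-1)] times d arg, so relative to w the counterclockwise
    tangent has argument pi / 2 minus the arctangent of that slope. *)
Definition graph_phase (w : R[i]) : R :=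
  let q := complex.Re w ^+ 2 + complex.Im w ^+ 2 in
  2^-1 - atan (derive1 D (carg_of w) / (q + q^-1)) / pi.

Lemma phase_polar (k y : R) : exists2 r : R, 0 < r &
  (k * y) +i* y = (y * r)%:C * cexp (pi * (2^-1 - atan k / pi)).
Proof.
exists (Num.sqrt (1 + k ^+ 2)); first by rewrite sqrtr_gt0 ltr_pwDl// sqr_ge0.
have r0 : Num.sqrt (1 + k ^+ 2) != 0 by rewrite gt_eqF// sqrtr_gt0 ltr_pwDl// sqr_ge0.
have -> : pi * (2^-1 - atan k / pi) = pi / 2 - atan k.
  by rewrite mulrBr mulrCA mulfV ?gt_eqF ?pi_gt0// mulr1.
have c0 : cos (atan k) = (Num.sqrt (1 + k ^+ 2))^-1 by rewrite cos_atan.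
have s0 : sin (atan k) = k * (Num.sqrt (1 + k ^+ 2))^-1.
  have := atanK k; rewrite /tan c0 invrK => {2}<-.
  by rewrite mulfK.
apply/eqP; rewrite eq_complex /cexp /=; apply/andP; split; apply/eqP.
- by rewrite cosB cos_pihalf sin_pihalf mul0r mul1r add0r mul0r subr0 s0; field.
- by rewrite sinB cos_pihalf sin_pihalf mul0r mul1r subr0 mul0r addr0 c0; field.
Qed.

Lemma graph_tangent (c : R -> R[i]) (t f g : R) : (forall s, graph_cycle (c s)) ->
  is_derive t 1 (fun s => complex.Re (c s)) f -> is_derive t 1 (fun s => complex.Im (c s)) g ->
  let a := complex.Re (c t) in let b := complex.Im (c t) in
  ((a ^+ 2 + b ^+ 2) + (a ^+ 2 + b ^+ 2)^-1) * ((f * a + g * b) / (a ^+ 2 + b ^+ 2)) =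
  derive1 D (carg a b) * ((g * a - f * b) / (a ^+ 2 + b ^+ 2)).
Proof.
move=> gc df dg a b; have ab0 : a ^+ 2 + b ^+ 2 != 0.
  by have [w0 _] := gc t; rewrite -sqrD_neq0 /a /b; case: (c t) w0.
have dh := is_derive_sinh_height ab0 df dg.
have dD := is_derive_carg Dp (Ds 1) ab0 df dg.
have E : \forall s \near t, sinh_height (complex.Re (c s)) (complex.Im (c s)) =
    D (carg (complex.Re (c s)) (complex.Im (c s))).
  by apply: (@filterE _ (nbhs t)) => s; have [] := gc s.
have -> : f * a + g * b = a * f + b * g by ring.
have -> : g * a - f * b = a * g - b * f by ring.
exact: is_derive_unique (is_derive_near E dh) dD.
Qed.

Lemma graph_phase_polar (a b f g : R) : a ^+ 2 + b ^+ 2 != 0 ->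
  ((a ^+ 2 + b ^+ 2) + (a ^+ 2 + b ^+ 2)^-1) * ((f * a + g * b) / (a ^+ 2 + b ^+ 2)) =
    derive1 D (carg a b) * ((g * a - f * b) / (a ^+ 2 + b ^+ 2)) ->
  exists2 r : R, 0 < r & (f +i* g) / (a +i* b) =
    ((g * a - f * b) / (a ^+ 2 + b ^+ 2) * r)%:C * cexp (pi * graph_phase (a +i* b)).
Proof.
move=> ab0 E; have q0 := sqrD_gt0 ab0.
have n0 : (a ^+ 2 + b ^+ 2) + (a ^+ 2 + b ^+ 2)^-1 != 0 by rewrite gt_eqF// addr_gt0 ?invr_gt0.
have [r r0 H] := phase_polar (derive1 D (carg a b) / ((a ^+ 2 + b ^+ 2) + (a ^+ 2 + b ^+ 2)^-1))
   ((g * a - f * b) / (a ^+ 2 + b ^+ 2)).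
exists r => //; rewrite /graph_phase /carg_of [LHS]divcE -H; congr (_ +i* _).
apply: (mulfI n0); rewrite E [RHS]mulrA; congr (_ * _).
by rewrite mulrCA mulfV// mulr1.
Qed.

Lemma graph_oriented (a b f g : R) : a ^+ 2 + b ^+ 2 != 0 ->
  ((a ^+ 2 + b ^+ 2) + (a ^+ 2 + b ^+ 2)^-1) * ((f * a + g * b) / (a ^+ 2 + b ^+ 2)) =
    derive1 D (carg a b) * ((g * a - f * b) / (a ^+ 2 + b ^+ 2)) ->
  (g * a - f * b) / (a ^+ 2 + b ^+ 2) != 0 ->
  positively_oriented graph_phase (a +i* b) (f +i* g) <-> 0 < (g * a - f * b) / (a ^+ 2 + b ^+ 2).
Proof.
move=> ab0 E y0; have [r r0 H] := graph_phase_polar ab0 E.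
set y := _ / _ in y0 H *; split=> [[r' r'0]|yp].
- rewrite H; set z := cexp _; have z0 : z != 0.
    by rewrite /z /cexp sqrD_neq0 cos2Dsin2 oner_eq0.
  move/(mulIf z0); case=> e; have : 0 < y * r by rewrite e.
  by rewrite pmulr_lgt0.
- by exists (y * r) => //; exact: mulr_gt0.
Qed.

Lemma crossings_shift (c : R -> R[i]) (c0 : R -> R[i]) k w s0 (b : bool) :
  (forall s, c s = c0 (s + k)) -> [set s | c0 s = w] = (if b then [set s0] else set0) ->
  crossings c w = b.
Proof.
move=> cE c0E; have -> : crossings c w = #|` fset_set (if b then [set s0 - k] else set0)|%fset.
  rewrite /crossings; congr (#|` fset_set _|%fset); apply/seteqP.
  have H s : c s = w <-> s + k \in (if b then [set s0] else set0).
    by rewrite -c0E cE; split=> [h|]; rewrite inE.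
  split=> s /=; [move/H|]; case: ifP H => _ H; rewrite ?inE //=.
  - by move=> <-; rewrite addrK.
  - by move=> ->; apply/H; rewrite inE /= subrK.
by case: (b); rewrite ?fset_set1 ?cardfs1// fset_set0 cardfs0.
Qed.

Section StripCount.
Variables L0 L1 : brane R.
Hypotheses (L0E : lag L0 = flat_cycle) (L1E : lag L1 = graph_cycle)
  (ph1E : phase L1 = graph_phase)
  (mark0 : ~ (flat_cycle `&` graph_cycle) (mark L0))
  (mark1 : ~ (flat_cycle `&` graph_cycle) (mark L1)).

Lemma mark_crossing e t (L : brane R) : e ^+ 2 = 1 ->
  (t = 0 /\ L = L0) \/ (t = 1 /\ L = L1) ->
  S (carg_of (mark L)) != 0 /\ exists s0, [set s | model_strip e (s, t) = mark L] =
    if 0 < e * S (carg_of (mark L)) then [set s0] else set0.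
Proof.
move=> e1 [] [-> ->].
- have f0 : flat_cycle (mark L0) by rewrite -L0E; exact: mark_lag.
  have S0 : S (carg_of (mark L0)) != 0.
    by apply/eqP => z; apply: mark0; split=> //; apply/(proj1 (flat_graph _)).
  split=> //; case: (f0) => w0 h; apply: model_strip_crossing => //; first by left.
  by rewrite mul0rn sub0r mulN1r; apply/eqP; rewrite model_Y_L0 h.
- have f1 : graph_cycle (mark L1) by rewrite -L1E; exact: mark_lag.
  have S0 : S (carg_of (mark L1)) != 0.
    by apply/eqP => z; apply: mark1; split=> //; apply/(proj2 (flat_graph _)).
  split=> //; case: (f1) => w0 h; apply: model_strip_crossing => //; first by right.
  by rewrite mulr2n addrK mul1r; apply/eqP; rewrite model_Y_L1 h.
Qed.

Lemma strip_sign_model v e c : e = 1 \/ e = -1 ->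
  (forall s t, 0 <= t <= 1 -> v (s, t) = model_strip e (s + c, t)) ->
  strip_sign L0 L1 v = (if 0 < e then 1 else -1) * (-1) ^+ (0 < e * S (carg_of (mark L0)))%R
    * (-1) ^+ (0 < e * S (carg_of (mark L1)))%R.
Proof.
move=> e1 vE; have e2 : e ^+ 2 = 1 by case: e1 => ->; rewrite ?sqrrN expr1n.
have t0 : 0 <= (0 : R) <= 1 by rewrite lexx ler01.
have t1 : 0 <= (1 : R) <= 1 by rewrite lexx ler01.
rewrite /strip_sign.
have [_ [s0 H0]] := mark_crossing e2 (or_introl (conj erefl erefl)).
have [_ [s1 H1]] := mark_crossing e2 (or_intror (conj erefl erefl)).
rewrite (crossings_shift (fun s => vE s 0 t0) H0) (crossings_shift (fun s => vE s 1 t1) H1).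
congr (_ * _ * _).
(* The phase orients the graph counterclockwise, and the angle decreases along s exactly when e >
   0. *)
have key s : positively_oriented (phase L1) (v (s, 1)) (- cderive v (s, 1) (1, 0)) <-> 0 < e.
  have [f1 [g1 [_ [_ [[df dg _ _] _ _ tE]]]]] := model_strip_derive e2 (s + c) t1.
  have [ab0 _ _ _] := model_strip_coords e2 (wide_cstrip (s + c) t1).
  have a0 := strip_re_gt0 (wide_cstrip (s + c) t1).
  have N0 := lens_N2_gt0 (strip_im (s + c, 1)) a0.
  have /is_derive_slice1 df' := df; have /is_derive_slice1 dg' := dg.
  have dsh : is_derive s (1 : R) (fun x : R => x + c) 1.
    have := is_derive_affine 1 c s; apply: is_derive_near.
    by apply: (@filterE _ (nbhs s)) => x; rewrite mul1r.
  have near (F : R -> R) (G : R -> R) d : (forall x, F x = G (x + c)) ->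
      is_derive (s + c) 1 G d -> is_derive s 1 F d.
    move=> FG dG; have := @is_derive_compose _ _ G (fun x : R => x + c) s 1 _ _ dG dsh; rewrite mulr1; apply: is_derive_near.
    by apply: (@filterE _ (nbhs s)) => x; rewrite FG.
  have dF : is_derive s 1 (fun x => complex.Re (v (x, 1))) f1.
    by apply: near df' => x; rewrite vE.
  have dG : is_derive s 1 (fun x => complex.Im (v (x, 1))) g1.
    by apply: near dg' => x; rewrite vE.
  have gc x : graph_cycle (v (x, 1)).
    by rewrite vE//; have [_ _ H _ _] := model_strip_strip e2; have [_] := H (x + c).
  have T := graph_tangent gc dF dG.
  have [_ dF1] := (is_derive_slice1 (fun q => complex.Re (v q)) s 1 f1).2 dF.
  have [_ dG1] := (is_derive_slice1 (fun q => complex.Im (v q)) s 1 g1).2 dG.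
  rewrite /cderive dF1 dG1 ph1E.
  move: T ab0 tE; rewrite /log_im; cbv beta; rewrite -(vE s 1 t1); case: (v (s, 1)) => a b /= T ab0 tE.
  set y := (a * g1 - b * f1) / _ in tE.
  have yE : 0 < - y * e.
    have : 0 < X (carg a b) * (- y * e).
      have -> : X (carg a b) * (- y * e) = e ^+ 2 * (pi * strip_re (s + c, 1) *
         (strip_re (s + c, 1) ^+ 2 + strip_im (s + c, 1) ^+ 2 + 1) / lens_N2 (strip_re (s + c, 1)) (strip_im (s + c, 1))).
        by rewrite mulrA mulrN tE; ring.
      rewrite e2 mul1r divr_gt0// mulr_gt0//; first by rewrite mulr_gt0 ?pi_gt0.
      by rewrite ltr_wpDl// addr_ge0 ?sqr_ge0.
    by rewrite pmulr_rgt0.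
  have yN : (- g1 * a - - f1 * b) / (a ^+ 2 + b ^+ 2) = - y by rewrite /y; ring.
  rewrite graph_oriented//.
  - by rewrite yN; case: e1 yE => ->; lra.
  - by rewrite yN mulrN; have -> : y = (g1 * a - f1 * b) / (a ^+ 2 + b ^+ 2);
      [rewrite /y (mulrC a) (mulrC b)|rewrite -T; ring].
  - by rewrite yN; apply/eqP => z; rewrite z mul0r ltxx in yE.
case: asboolP => [/(_ 0)/key ->//|H]; case: ifP => // e0; exfalso; apply: H => s; exact/key.
Qed.

(** Each marked point lies on the boundary of exactly one of the two strips. Passing from one strip
    to the other thus changes both marking factors, which compensate, and the orientation factor,
    which remains. *)
Lemma strip_sign_sum v w c d :
  (forall s t, 0 <= t <= 1 -> v (s, t) = model_strip 1 (s + c, t)) ->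
  (forall s t, 0 <= t <= 1 -> w (s, t) = model_strip (-1) (s + d, t)) ->
  strip_sign L0 L1 v + strip_sign L0 L1 w = 0.
Proof.
move=> vE wE; rewrite (strip_sign_model (or_introl erefl) vE) (strip_sign_model (or_intror erefl) wE).
have [S0 _] := mark_crossing (expr1n _ 2) (or_introl (conj erefl erefl)).
have [S1 _] := mark_crossing (expr1n _ 2) (or_intror (conj erefl erefl)).
have -> : (0 < -1 :> R) = false by apply/negbTE; rewrite -leNgt; lra.
rewrite ltr01 !mul1r !mulN1r !oppr_gt0.
case: ltgtP S0 => // _ _; case: ltgtP S1 => // _ _; by rewrite ?expr0 ?expr1.
Qed.

(** One direction computes m_1 in an arbitrary category, the other shows that the constructed
    category qualifies. *)
Lemma strip_count_zero k : strip_count (logJ Jk Jp) L0 L1 (cexp n) (cexp m) k <-> k = 0.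
Proof.
have N1 : (-1 : R) ^+ 2 = 1 by rewrite sqrrN expr1n.
have shift0 e s t : 0 <= t <= 1 -> model_strip e (s, t) = model_strip e (s + 0, t).
  by rewrite addr0.
(* The sign of sin Th recovers [e] from the strip, so the two strips are not translates of each
   other. *)
have sg s e c e' c' : e ^+ 2 = 1 -> e' ^+ 2 = 1 ->
    model_strip e (s + c, 0) = model_strip e' (s + c', 0) -> 0 < e -> 0 < e'.
  move=> e1 e1' E e0; have t0 : 0 <= (0 : R) <= 1 by rewrite lexx ler01.
  have w1 := wide_cstrip (s + c) t0; have w2 := wide_cstrip (s + c') t0.
  have [_ _ S1 _] := model_strip_coords e1 w1.
  have [_ _ S2 _] := model_strip_coords e1' w2.
  have lp a b : 0 < a -> forall e, exists2 r, 0 < r & lens_S e a b = e * r.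
    move=> a0 e2; exists (2 * a * (Num.sqrt (lens_N2 a b))^-1); last by rewrite /lens_S; ring.
    by apply: mulr_gt0; [exact: mulr_gt0|rewrite invr_gt0 sqrtr_gt0 lens_N2_gt0].
  have [r1 r10 E1] := lp _ (strip_im (s + c, 0)) (strip_re_gt0 w1) e.
  have [r2 r20 E2] := lp _ (strip_im (s + c', 0)) (strip_re_gt0 w2) e'.
  have : e * r1 = e' * r2 by rewrite -E1 -E2 -S1 -S2 E.
  by move=> E3; rewrite -(pmulr_lgt0 _ r20) -E3 mulr_gt0.
rewrite /strip_count L0E L1E; split=> [[N [u [us uinj uall kE]]]|->].
- have [kp [a ap]] := uall _ (model_strip_strip (expr1n _ 2)).
  have [kn [b bn]] := uall _ (model_strip_strip N1).
  have tr k0 e c : (forall s t, 0 <= t <= 1 -> model_strip e (s, t) = u k0 (s + c, t)) ->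
      forall s t, 0 <= t <= 1 -> u k0 (s, t) = model_strip e (s + - c, t).
    by move=> H s t t01; rewrite H// subrK.
  have up := tr _ _ _ ap; have un := tr _ _ _ bn.
  have kpn : kp != kn.
    apply/eqP => E; rewrite E in up.
    have t0 : 0 <= (0 : R) <= 1 by rewrite lexx ler01.
    have := sg 0 1 (- a) (-1) (- b) (expr1n _ 2) N1; rewrite -up// -un//.
    by move=> /(_ erefl ltr01); rewrite ltNge; lra.
  have only l : l = kp \/ l = kn.
    have := us l; rewrite -/flat_cycle => /strip_classification [e [c [e1 uE]]].
    case: e1 uE => -> uE; [left|right]; apply: uinj.
      by exists (- a - c) => s t t01; rewrite uE// up// addrA subrK.
    by exists (- b - c) => s t t01; rewrite uE// un// addrA subrK.
  rewrite kE (bigD1 kp)//= (bigD1 kn) 1?eq_sym//= big1 => [|l /andP[lp ln]].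
    by rewrite addr0; exact: strip_sign_sum up un.
  by case: (only l) => E; rewrite E eqxx in lp ln.
- exists 2, (fun i => model_strip (if i == 0 then 1 else -1)); split.
  + by move=> i; apply: model_strip_strip; case: ifP => _; rewrite ?expr1n.
  + move=> i j [a H]; have t0 : 0 <= (0 : R) <= 1 by rewrite lexx ler01.
    have E := H 0 0 t0; rewrite (shift0 _ _ _ t0) in E.
    have [e1 e2] : (if i == 0 then 1 else -1 : R) ^+ 2 = 1 /\ (if j == 0 then 1 else -1 : R) ^+ 2 = 1.
      by split; case: ifP => _; rewrite ?expr1n.
    have h1 := sg _ _ _ _ _ e2 e1 E; have h2 := sg _ _ _ _ _ e1 e2 (esym E).
    have n1 : (0 < -1 :> R) -> False by lra.
    apply/val_inj; case: i j h1 h2 {H E e1 e2} => -[|[|//]] ? [[|[|//]] ?] //= h1 h2; exfalso; apply: n1.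
      by apply: h2; exact: ltr01.
    by apply: h1; exact: ltr01.
  + move=> v /strip_classification [e [c [e1 vE]]].
    exists (if 0 < e then 0 else 1), c => s t t01; rewrite vE//; congr (model_strip _ _).
    have n1 : (0 < -1 :> R) = false by apply/negbTE; rewrite -leNgt; lra.
    by case: e1 => ->; rewrite ?ltr01 ?n1.
  + rewrite !big_ord_recl big_ord0 addr0; apply/esym.
    by apply: strip_sign_sum => s t; exact: shift0.
Qed.

End StripCount.

(** * Vanishing cycles, the Hamiltonian flow and gradings *)

Lemma flat_cycleE (a b : R) : flat_cycle (a +i* b) <-> a ^+ 2 + b ^+ 2 = 1.
Proof.
rewrite /flat_cycle /= sqrD_neq0; split=> [[ab0 /eqP]|ab1].
  by rewrite sinh_height_eq0// => /eqP.
have ab0 : a ^+ 2 + b ^+ 2 != 0 by rewrite ab1 oner_eq0.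
by split=> //; apply/eqP; rewrite sinh_height_eq0// ab1.
Qed.

Lemma vanishing_cycleE i : vanishing_cycle i = flat_cycle.
Proof.
apply/seteqP; split=> -[a b].
- move=> [w0 [[l [t [/matrixP E _]]] _]]; apply/flat_cycleE.
  have := E 0 0; have := E 0 1; rewrite !mxE /= => e01 [l0].
  move: e01; rewrite -l0 expr0n subr0 sqrtr1 mul1r => -[-> ->].
  exact: cos2Dsin2.
- move=> /flat_cycleE ab1; have w0 : a +i* b != 0 by rewrite sqrD_neq0 ab1 oner_eq0.
  have [t [ca sb]] := cos_sin_exists ab1.
  split=> //; split; last by rewrite fibE; exists (a +i* b).
  exists 0, t; split; last by case: ifP => _; apply/andP; split; lra.
  rewrite /fib /alpha expr0n subr0 sqrtr1 !mul1r /cexp cosN sinN ca sb.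
  congr sl2; apply: (mulfI w0); rewrite mulfV//.
  by apply/eqP; rewrite eq_complex /= -ab1; apply/andP; split; apply/eqP; ring.
Qed.

Lemma hamiltonian_vector (a b f g k : R) (q := a ^+ 2 + b ^+ 2) : q != 0 ->
  (forall v, omega (a +i* b) (f +i* g) v = k * complex.Im (v / (a +i* b))) <->
  f = - k * a / (q + q^-1) /\ g = - k * b / (q + q^-1).
Proof.
move=> q0; have qp := sqrD_gt0 q0; rewrite -/q in qp.
have n0 : q + q^-1 != 0 by rewrite gt_eqF// addr_gt0 ?invr_gt0.
have q2 : 1 + q ^- 2 = (q + q^-1) / q by field.
split=> [H|[-> ->] [c d]].
- have := H (1 +i* 0); have := H (0 +i* 1).
  rewrite !omegaE// !divcE /= -/q q2 => h1 h2.
  split; apply: (mulfI n0); rewrite mulrCA mulfV// mulr1; apply: (mulIf (invr_neq0 q0)).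
  + transitivity (- ((q + q^-1) / q * (g * 0 - f * 1))); first by ring.
    by rewrite h1; ring.
  + transitivity ((q + q^-1) / q * (g * 1 - f * 0)); first by ring.
    by rewrite h2; ring.
- have q20 : q * q + 1 != 0 by rewrite gt_eqF// ltr_wpDl ?mulr_ge0 ?ltW.
  rewrite omegaE// divcE /= -/q q2; field.
  by rewrite q0.
Qed.

Lemma cderivable_is_derive (c : R -> R[i]) (t : R) : cderivable c t 1 ->
  is_derive t 1 (fun s => complex.Re (c s)) (complex.Re (cderive c t 1)) /\
  is_derive t 1 (fun s => complex.Im (c s)) (complex.Im (cderive c t 1)).
Proof. by case=> d1 d2; split; [exact: DeriveDef d1 erefl|exact: DeriveDef d2 erefl]. Qed.

Lemma hamiltonian_orbit_polar h c t (x := carg_of (c t)) : (forall x, D x = - derive1 h x) ->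
  hamiltonian_orbit h c -> 0 <= t <= 1 ->
  let a := complex.Re (c t) in let b := complex.Im (c t) in let q := a ^+ 2 + b ^+ 2 in
  [/\ q != 0, is_derive t 1 (fun s => complex.Re (c s)) (D x * a / (q + q^-1))
    & is_derive t 1 (fun s => complex.Im (c s)) (D x * b / (q + q^-1))].
Proof.
move=> hD oc t01 a b q; have [w0 dc H] := oc t t01; have [d1 d2] := cderivable_is_derive dc.
have q0 : q != 0 by rewrite /q /a /b -sqrD_neq0; case: (c t) w0.
have E : c t = (Normc.normc (c t))%:C * cexp x.
  have [e1 e2] := cargP a b; rewrite /x /carg_of -/a -/b.
  have nE : Normc.normc (c t) = Num.sqrt (a ^+ 2 + b ^+ 2) by rewrite /a /b; case: (c t).
  by apply/eqP; rewrite eq_complex /= nE -/a -/b !mul0r subr0 addr0 -e1 -e2 !eqxx.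
have /hamiltonian_vector : forall v, omega (a +i* b) (cderive c t 1) v = - D x * complex.Im (v / (a +i* b)).
  move=> v; have -> : a +i* b = c t by rewrite /a /b; case: (c t).
  by rewrite hD opprK; exact: H x v E.
move=> /(_ q0) [f g]; rewrite !opprK in f g; by rewrite -f -g.
Qed.

Lemma constant_derivative (f : R -> R) (d : R) :
  (forall t : R, 0 <= t <= 1 -> is_derive t 1 f d) -> forall t, 0 <= t <= 1 -> f t = f 0 + t * d.
Proof.
move=> df t /andP[]; rewrite le_eqVlt => /orP[/eqP<- _|t0 t1]; first by rewrite mul0r addr0.
have [x|x _ e] := @mean_value_step R f (fun=> d) 0 t t0.
  by rewrite add0r => /andP[x0 xt]; apply: df; rewrite x0 (le_trans xt).
by rewrite add0r in e; rewrite -e addrC subrK.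
Qed.

Lemma hamiltonian_image_graph h : (forall x, D x = - derive1 h x) ->
  hamiltonian_image h flat_cycle = graph_cycle.
Proof.
move=> hD; apply/seteqP; split=> [_ [c [[w0 c0] oc] <-]|[a b] [w0 hw]].
- pose A s := complex.Re (c s); pose B s := complex.Im (c s).
  have t1 : 0 <= (1 : R) <= 1 by rewrite lexx ler01.
  (* The flow is radial. Constancy of [D] of the angle is enough, and proving only this avoids a
     continuous branch of the angle; [sinh_height] then grows linearly. *)
  have cst t : 0 <= t <= 1 -> D (carg (A t) (B t)) = D (carg (A 0) (B 0)).
    move=> t01; rewrite (@constant_derivative (fun s => D (carg (A s) (B s))) 0 _ t t01) ?mulr0 ?addr0// => s s01.
    have [q0 dA dB] := hamiltonian_orbit_polar hD oc s01.
    have := is_derive_carg Dp (Ds 1) q0 dA dB; move/is_derive_eq; apply.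
    by rewrite -/(A s) -/(B s); ring.
  have dh (t : R) : 0 <= t <= 1 -> is_derive t 1 (fun s => sinh_height (A s) (B s)) (D (carg (A 0) (B 0))).
    move=> t01; have [q0 dA dB] := hamiltonian_orbit_polar hD oc t01.
    have q1 := sqrD_gt0 q0.
    have := is_derive_sinh_height q0 dA dB; move/is_derive_eq; apply.
    rewrite -(cst t t01) /log_re /carg_of -/(A t) -/(B t); move: q0 q1; rewrite -/(A t) -/(B t).
    set q := A t ^+ 2 + B t ^+ 2; set z := D _ => q0 q1.
    have n0 : q + q^-1 != 0 by rewrite gt_eqF// addr_gt0 ?invr_gt0.
    have E N : N != 0 -> N * ((A t * (z * A t / N) + B t * (z * B t / N)) / q) = z * (q / q).
      by move=> N0; move: q0; rewrite /q => q0; field; rewrite q0 N0.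
    by rewrite [LHS]E// divff// mulr1.
  have [w1 _ _] := oc 1 t1; split=> //.
  rewrite (constant_derivative dh t1) -/(A 1) -/(B 1) (cst 1 t1).
  by rewrite [sinh_height _ _]c0 add0r mul1r.
- have ab0 : a ^+ 2 + b ^+ 2 != 0 by rewrite -sqrD_neq0.
  pose x := carg a b; pose d := D x; have {}hw : sinh_height a b = d by [].
  (* The flow line to the given point: exp (arsinh (t d)) is the squared radius at which
     [sinh_height] equals t d. *)
  pose q t : R := t * d + Num.sqrt (1 + (t * d) ^+ 2).
  have qP t : 0 < q t /\ (q t - (q t)^-1) / 2 = t * d := sinh_sqrt (t * d).
  pose r t := Num.sqrt (q t).
  have r0 t : 0 < r t by rewrite sqrtr_gt0; case: (qP t).
  have r2 t : r t ^+ 2 = q t by rewrite sqr_sqrtr// ltW//; case: (qP t).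
  have sq t : (r t * cos x) ^+ 2 + (r t * sin x) ^+ 2 = q t.
    by rewrite !exprMn -mulrDr cos2Dsin2 mulr1 r2.
  pose c t := (r t * cos x) +i* (r t * sin x).
  have dr (t : R) : is_derive t 1 r (d * r t / (q t + (q t)^-1)).
    have dt : is_derive t (1 : R) (fun s => s * d) d.
      have := is_deriveM_fun (is_derive_id t 1) (is_derive_cst d t 1).
      by move/is_derive_eq; apply; rewrite /cst mul1r mulr0 addr0.
    have G0 : 0 < 1 + (t * d) ^+ 2 by rewrite ltr_pwDl// sqr_ge0.
    have d2 := is_deriveD_fun (is_derive_cst (1 : R) t 1) (is_deriveX_fun 2 dt).
    have d3 := @is_derive_compose _ _ _ (fun s : R => 1 + (s * d) ^+ 2) t 1 _ _ (is_derive1_sqrt G0) d2.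
    have d4 := is_deriveD_fun dt d3.
    have d5 := @is_derive_compose _ _ _ q t 1 _ _ (is_derive1_sqrt (proj1 (qP t))) d4.
    move: d5; move/is_derive_eq; apply; rewrite -/(r t) /= expr1.
    set G := Num.sqrt _; have Gp : 0 < G by rewrite sqrtr_gt0.
    have qn := lt0r_neq0 (proj1 (qP t)).
    have GE : q t + (q t)^-1 = 2 * G.
      have := proj2 (qP t); have : q t = t * d + G by [].
      by move: (q t) (q t)^-1 => Q Q'; lra.
    have tdE : t * d = q t - G by rewrite /q addrK.
    have rn := lt0r_neq0 (r0 t); have Gn := lt0r_neq0 Gp.
    rewrite GE tdE /cst -r2; clearbody G.
    by field; rewrite Gn rn.
  have c0E : flat_cycle (c 0).
    by apply/flat_cycleE; rewrite sq /q !mul0r expr0n addr0 add0r sqrtr1.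
  have c1E : c 1 = a +i* b.
    have [ea eb] := cargP a b.
    have q1 : q 1 = a ^+ 2 + b ^+ 2.
      rewrite /q mul1r -hw; exact: sinh_sqrK (sqrD_gt0 ab0).
    by rewrite /c /r q1 -ea -eb.
  exists c => //; split=> // t t01.
  have q0 := lt0r_neq0 (proj1 (qP t)).
  have dA : is_derive t 1 (fun s => complex.Re (c s)) (d * (r t * cos x) / (q t + (q t)^-1)).
    have := is_deriveM_fun (dr t) (is_derive_cst (cos x) t 1).
    by move/is_derive_eq; apply; rewrite /cst mulr0 addr0; ring.
  have dB : is_derive t 1 (fun s => complex.Im (c s)) (d * (r t * sin x) / (q t + (q t)^-1)).
    have := is_deriveM_fun (dr t) (is_derive_cst (sin x) t 1).
    by move/is_derive_eq; apply; rewrite /cst mulr0 addr0; ring.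
  split; first by rewrite /c sqrD_neq0 sq.
    by split; [case: dA|case: dB].
  move=> th v; rewrite /c /Normc.normc sq -/(r t) => /eqP; rewrite eq_complex /= !mul0r subr0 addr0.
  have rn := lt0r_neq0 (r0 t).
  move=> /andP[/eqP/(mulfI rn) cth /eqP/(mulfI rn) sth].
  have dE : - (derive1n 1 h th) = d.
    by rewrite /d (cos_sin_periodic Dp cth sth) hD.
  have sq0 : (r t * cos x) ^+ 2 + (r t * sin x) ^+ 2 != 0 by rewrite sq.
  rewrite /cderive; case: dA => _ ->; case: dB => _ ->.
  by apply: (hamiltonian_vector _ _ _ sq0).2; rewrite dE sq.
Qed.

Lemma perturbed_cycleE h i : (forall x, D x = - derive1 h x) ->
  perturbed_cycle h i = if i == 0 then flat_cycle else graph_cycle.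
Proof.
by move=> hD; rewrite /perturbed_cycle !vanishing_cycleE hamiltonian_image_graph.
Qed.

Lemma flat_graph_cycle : flat_cycle `&` graph_cycle = [set cexp m; cexp n].
Proof.
have cx x : S x = 0 -> flat_cycle (cexp x) /\ graph_cycle (cexp x).
  move=> Sx; have f : flat_cycle (cexp x) by apply/flat_cycleE; exact: cos2Dsin2.
  split=> //; apply/(proj1 (flat_graph _)) => //.
  by rewrite /carg_of /= -[cos x]mul1r -[sin x]mul1r (periodic_carg _ Sp ltr01).
apply/seteqP; split=> [[a b] [f]|w /= [] ->].
- move: (f) => /flat_cycleE ab1 /(proj1 (flat_graph _) f); rewrite /carg_of /= => S0.
  have [x0 hx0 red] := periodic2pi_reduce m (carg a b).
  have [ea eb] := cargP a b; rewrite ab1 sqrtr1 !mul1r in ea eb.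
  have wE : a +i* b = cexp x0 by congr (_ +i* _); rewrite [LHS](ea, eb); [exact: red (@cosD2pi R)|exact: red (@sinD2pi R)].
  rewrite (red _ Sp) in S0; have /eqP D0 : D x0 == 0 by rewrite D_eq0 S0.
  rewrite wE; case/andP: hx0; rewrite le_eqVlt => /orP[/eqP<- _|x1 x2]; first by left.
  have [x3|x3|->] := ltgtP x0 n; last by right.
  + by have := Dpos (introT andP (conj x1 x3)); rewrite D0 ltxx.
  + by have := Dneg (introT andP (conj x3 x2)); rewrite D0 ltxx.
- by apply: cx; have [] := ccosm mn.
- by apply: cx; have [] := ccosn mn.
Qed.

Lemma flat_tangent w v : tangent flat_cycle w v ->
  exists2 y : R, v / w = 0 +i* y & w != 0.
Proof.
case=> c [c0 fc /cderivable_is_derive [dF dG] cv].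
move: dF dG; rewrite cv; case: v cv => f g _ dF dG; rewrite /= in dF dG.
rewrite -c0; have [w0 _] := fc 0.
have ab1 t : complex.Re (c t) ^+ 2 + complex.Im (c t) ^+ 2 = 1.
  by have := fc t; case: (c t) => a b /flat_cycleE.
have := is_deriveD_fun (is_deriveX_fun 2 dF) (is_deriveX_fun 2 dG).
have := is_derive_cst (1 : R) (0 : R) (1 : R); have E : \forall t \near (0 : R), 1 = complex.Re (c t) ^+ 2 + complex.Im (c t) ^+ 2.
  by apply: (@filterE _ (nbhs (0 : R))) => t; rewrite ab1.
move=> /(is_derive_near E) k1 /(is_derive_unique k1) /= k2.
move: w0 (ab1 0) k2; case: (c 0) => a b /= w0 ab k2.
eexists; last exact: w0.
rewrite divcE; congr (_ +i* _); rewrite !expr1 in k2.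
have -> : f * a + g * b = 0 by lra.
by rewrite mul0r.
Qed.

Lemma graph_cycle_tangent a b v : tangent graph_cycle (a +i* b) v ->
  a ^+ 2 + b ^+ 2 != 0 /\
  ((a ^+ 2 + b ^+ 2) + (a ^+ 2 + b ^+ 2)^-1) * complex.Re (v / (a +i* b)) =
    derive1 D (carg a b) * complex.Im (v / (a +i* b)).
Proof.
case=> c [c0 fc /cderivable_is_derive [dF dG] cv].
move: dF dG; rewrite cv; case: v cv => f g _ dF dG; rewrite /= in dF dG.
have [w0 _] := fc 0; rewrite c0 sqrD_neq0 in w0; split=> //.
by have := graph_tangent fc dF dG; rewrite c0 divcE.
Qed.

(** Tangents to the circle have v / w imaginary, while the graph crosses it with slope proportional
    to [D'], nonzero because the critical points are nondegenerate. *)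
Lemma transverse_cycles : transverse flat_cycle graph_cycle.
Proof.
move=> w v fw gw /flat_tangent [y vw w0]; case: w fw gw vw w0 => a b fw gw vw w0.
move=> /graph_cycle_tangent [ab0]; rewrite vw /= mulr0 => /esym/eqP.
have := (proj1 (flat_graph _) fw).1 gw; rewrite /carg_of /= => /eqP; rewrite -D_eq0 => /eqP/D'0 D1.
rewrite mulf_eq0 (negbTE D1) /= => /eqP y0; rewrite y0 in vw.
by apply: (mulIf (invr_neq0 w0)); rewrite vw mul0r.
Qed.

Lemma cexpD (x y : R) : cexp (x + y) = cexp x * cexp y.
Proof.
rewrite /cexp cosD sinD; apply/eqP; rewrite eq_complex /=; apply/andP; split; apply/eqP; ring.
Qed.

Lemma flat_grading : grading flat_cycle (fun=> 2^-1).
Proof.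
split; first by move=> w _ e e0; exists 1; rewrite ?ltr01// => w' _ _; rewrite subrr normr0.
move=> w v _ /flat_tangent [y vw w0] v0; rewrite vw.
have y0 : y != 0.
  apply/eqP => z; move/eqP: vw; rewrite z mulf_eq0 (negbTE v0) invr_eq0 (negbTE w0).
  by [].
exists (y ^+ 2); first by rewrite lt0r sqr_ge0 sqrf_eq0 y0.
have -> : pi *+ 2 * 2^-1 = pi :> R by rewrite mulr2n; field.
by rewrite /cexp cospi sinpi; apply/eqP; rewrite eq_complex /=; apply/andP; split; apply/eqP; ring.
Qed.

Lemma graph_grading : grading graph_cycle graph_phase.
Proof.
split.
- move=> [a b] [w0 _] e e0; rewrite sqrD_neq0 in w0.
  pose U : set (R * R) := [set p | p.1 ^+ 2 + p.2 ^+ 2 != 0].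
  have sq : pderiv 0 U (fun p => p.1 ^+ 2 + p.2 ^+ 2).
    by apply: pderivD; apply: pderivX; [exact: pderiv_fst|exact: pderiv_snd].
  have dk : pderiv 0 U (fun p => derive1 D (carg p.1 p.2)).
    apply: pderiv_carg; [exact: derive1_periodic|by move=> k; apply: nderiv_derive1; [exact: openT|exact: Ds]|by []|exact: pderiv_fst|exact: pderiv_snd].
  have n0 (p : R * R) : U p -> p.1 ^+ 2 + p.2 ^+ 2 + (p.1 ^+ 2 + p.2 ^+ 2)^-1 != 0.
    by move=> /sqrD_gt0 q0; rewrite gt_eqF// addr_gt0 ?invr_gt0.
  have sV : pderiv 0 U (fun p => p.1 ^+ 2 + p.2 ^+ 2 + (p.1 ^+ 2 + p.2 ^+ 2)^-1).
    by apply: pderivD => //; exact: pderivV.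
  have k0 : pderiv 0 U (fun p => graph_phase (p.1 +i* p.2)).
    apply: pderivB; first exact: pderiv_cst.
    apply: pderivM; last exact: pderiv_cst.
    by apply: pderiv_atan; apply: pderivM; [exact: dk|exact: pderivV].
  have := pderiv_continuous k0 (w0 : U (a, b)).
  rewrite /prop_for /continuous_at /= => /cvgrPdist_lt /(_ _ e0) nr.
  have [d d0 dH] := (nbhs_ballP _ _).1 nr.
  exists d => // -[a' b'] _ wd; have [h1 h2] := normc_ge (a' - a) (b' - b).
  have := dH (a', b'); rewrite distrC; apply; split; rewrite /= /ball /= distrC.
    exact: le_lt_trans h1 wd.
  exact: le_lt_trans h2 wd.
- move=> [a b] v _ /graph_cycle_tangent [ab0 E] v0; case: v v0 E => f g v0 E.
  rewrite divcE /= in E; have [r r0 H] := graph_phase_polar ab0 E.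
  rewrite H; set y := (g * a - f * b) / _ in H *.
  have y0 : y * r != 0.
    apply/eqP => z; move/eqP: H; rewrite z mul0r mulf_eq0 (negbTE v0) invr_eq0.
    by rewrite (negbTE (_ : a +i* b != 0))// sqrD_neq0.
  exists ((y * r) ^+ 2); first by rewrite lt0r sqr_ge0 sqrf_eq0 y0.
  have -> : pi *+ 2 * graph_phase (a +i* b) = pi * graph_phase (a +i* b) + pi * graph_phase (a +i* b).
    by rewrite mulr2n mulrDl.
  rewrite cexpD; set z := cexp _; set k := y * r; clearbody z k.
  by rewrite exprMn rmorphXn -(expr2 z).
Qed.

(** On the unit circle the phase difference is - atan (D' / 2) / pi. At [m], where D' > 0, it lies
    in (-1/2, 0) and its floor is -1; at [n] it lies in (0, 1/2) and its floor is 0. *)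
Lemma floer_degree_crit (L0 L1 : brane R) : phase L0 = (fun=> 2^-1) -> phase L1 = graph_phase ->
  floer_degree L0 L1 (cexp m) = 0 /\ floer_degree L0 L1 (cexp n) = 1.
Proof.
move=> p0 p1; rewrite /floer_degree p0 p1.
have E x : graph_phase (cexp x) - 2^-1 = - (atan (derive1 D x / 2) / pi).
  rewrite /graph_phase /= cos2Dsin2 invr1 /carg_of /=.
  rewrite -[cos x]mul1r -[sin x]mul1r (periodic_carg _ (derive1_periodic Dp) ltr01).
  by rewrite addrAC subrr sub0r.
have pi0 := pi_gt0 R; rewrite !E.
have a0 := atan0 R.
have am : 0 < atan (derive1 D m / 2) by rewrite -a0; apply: lt_atan; rewrite divr_gt0.
have an : atan (derive1 D n / 2) < 0 by rewrite -a0; apply: lt_atan; rewrite pmulr_llt0 ?invr_gt0.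
have := atan_ltpi2 (derive1 D m / 2); have := atan_gtNpi2 (derive1 D n / 2).
move: am an; set x := atan (derive1 D m / 2); set y := atan (derive1 D n / 2); clearbody x y => x0 y0 hy hx.
have fx : Num.floor (- (x / pi)) = -1.
  have h0 : 0 < x / pi by rewrite divr_gt0.
  have h1 : x / pi < 1 by rewrite ltr_pdivrMr// mul1r; lra.
  by apply/floor_def; rewrite addNr mulr0z mulrN1z; apply/andP; split; lra.
have fy : Num.floor (- (y / pi)) = 0.
  have h0 : 0 < - y / pi by rewrite divr_gt0// oppr_gt0.
  have h1 : - y / pi < 1 by rewrite ltr_pdivrMr// mul1r; lra.
  by apply/floor_def; rewrite add0r mulr0z -mulNr; apply/andP; split; lra.
by rewrite fx fy.
Qed.

(** * The Floer complex of the two cycles *)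

Section FloerComplex.
Variables L0 L1 : brane R.
Hypotheses (L0E : lag L0 = flat_cycle) (L1E : lag L1 = graph_cycle)
  (ph0E : phase L0 = (fun=> 2^-1)) (ph1E : phase L1 = graph_phase)
  (mark0 : ~ (flat_cycle `&` graph_cycle) (mark L0))
  (mark1 : ~ (flat_cycle `&` graph_cycle) (mark L1)).

Lemma cexp_crit_neq : cexp m <> cexp n.
Proof.
case=> cmn smn; have := cos_sin_periodic Cp cmn smn.
by have [-> _] := ccosm mn; have [-> _] := ccosn mn; lra.
Qed.

Lemma floer_hom_gens (K : ainf_cat 'I_2) : floer_hom (logJ Jk Jp) K 0 1 L0 L1 ->
  exists x y : gen K, [/\ [/\ src x = 0, tgt x = 1 & deg x = 0],
    [/\ src y = 0, tgt y = 1 & deg y = 1],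
    forall g : gen K, src g = 0 -> tgt g = 1 -> g = x \/ g = y
  & forall b c : gen K, src b = 0 -> tgt b = 1 -> mu [:: b] c = 0].
Proof.
case=> _ [pt [inj img degE muE]].
have [d0 d1] := floer_degree_crit ph0E ph1E.
rewrite L0E L1E flat_graph_cycle in img.
have [x [sx tx] px] : (pt @` [set g | src g = 0 /\ tgt g = 1]) (cexp m) by rewrite img; left.
have [y [sy ty] py] : (pt @` [set g | src g = 0 /\ tgt g = 1]) (cexp n) by rewrite img; right.
have dx : deg x = 0 by rewrite degE// px.
have dy : deg y = 1 by rewrite degE// py.
have xy (g : gen K) : src g = 0 -> tgt g = 1 -> g = x \/ g = y.
  move=> sg tg; have : (pt @` [set g | src g = 0 /\ tgt g = 1]) (pt g) by exists g.
  by rewrite img => -[pg|pg]; [left|right]; apply: inj;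
    rewrite ?inE ?sg ?tg ?sx ?tx ?sy ?ty ?eqxx ?px ?py.
exists x, y; split=> // b c sb tb.
have [//|nz] := eqVneq (mu [:: b] c) 0.
have /and3P[_ /eqP sc /eqP tc] := mu_path nz; rewrite sb in sc; rewrite /= tb in tc.
have := muE b c sb tb sc tc; case: eqP => // dbc.
(* Only from [x] to [y] does the degree rise by one, and there the strip count vanishes. *)
case: (xy _ sb tb) dbc => ->; case: (xy _ sc tc) => ->; rewrite ?dx ?dy// px py.
by rewrite strip_count_zero.
Qed.

Lemma lg2_floer_hom : floer_hom (logJ Jk Jp) lg2_cat 0 1 L0 L1.
Proof.
have [d0 d1] := floer_degree_crit ph0E ph1E.
split; first by rewrite L0E L1E; exact: transverse_cycles.
exists (fun g : gen lg2_cat => if g.2 then cexp n else cexp m); split.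
- move=> g g' /andP[/eqP sg /eqP tg] /andP[/eqP sg' /eqP tg'].
  rewrite (lg2_cat_upper sg tg) (lg2_cat_upper sg' tg') /=.
  by case: g.2; case: g'.2 => // E; [case: cexp_crit_neq|case: cexp_crit_neq].
- rewrite L0E L1E flat_graph_cycle; apply/seteqP; split=> [_ [g _ <-]|w [] ->].
  + by case: g.2; [right|left].
  + by exists (false, false).
  + by exists (false, true).
- by move=> g sg tg; rewrite (lg2_cat_upper sg tg) /=; case: g.2.
- move=> g g' sg tg sg' tg'.
  rewrite (lg2_cat_upper sg tg) (lg2_cat_upper sg' tg') /=.
  by case: g.2; case: g'.2 => //=; apply/strip_count_zero.
Qed.

End FloerComplex.

End FibreCoordinates.

(** * Critical points and thimbles *)

Section CriticalPoints.
Context {R : realType}.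

Lemma sl2N (x y z : R[i]) : - sl2 x y z = sl2 (- x) (- y) (- z).
Proof. by apply/matrixP => i j; rewrite !mxE; case: ifP; case: ifP. Qed.

Lemma orbit_H0 : Defs.orbit (H0 R).
Proof. by exists 1%:M; rewrite /= ?det1// mul1mx invmx1 mulmx1. Qed.

Lemma orbit_oppH0 : Defs.orbit (- H0 R).
Proof.
pose g : 'M[R[i]]_2 := \matrix_(i, j) if i == 0 then (if j == 0 then 0 else 1)
  else (if j == 0 then - 1 else 0).
have g1 : \det g = 1 by rewrite det_mx2 !mxE /= mulr0 mulrN1 opprK add0r.
have gu : g \in unitmx by rewrite unitmxE g1 unitr1.
exists g; first exact: g1.
apply: (can_inj (mulmxK gu)); rewrite mulmxKV; last exact: gu.
apply/matrixP => i j; rewrite !mxE !big_ord_recl !big_ord0 !mxE /=.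
case: (unliftP 0 i) => [k|] ->; case: (unliftP 0 j) => [l|] -> /=;
  rewrite ?mulr0 ?mul0r ?mulr1 ?mul1r ?mulrN1 ?addr0 ?add0r ?oppr0 ?opprK //.
Qed.

Lemma critical_H0 (e : R[i]) (B : 'M[R[i]]_2) : height (B *m (e *: H0 R) - (e *: H0 R) *m B) = 0.
Proof.
rewrite /height mulmxBr !linearB /= -!scalemxAr -!scalemxAl !linearZ /=.
have -> : \tr (H0 R *m (B *m H0 R)) = \tr (H0 R *m (H0 R *m B)) by rewrite mulmxA mxtrace_mulC.
by rewrite scalerN; exact: subrr.
Qed.

Lemma critical_pointsE : @critical_points R = [set - H0 R; H0 R].
Proof.
apply/seteqP; split=> [A [[g /= g1 AE] crit]|A [] ->]; last first.
- by split; [exact: orbit_H0|move=> B _; have := critical_H0 1 B; rewrite scale1r].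
- by split; [exact: orbit_oppH0|move=> B _; have := critical_H0 (-1) B; rewrite scaleN1r].
have gu : g \in unitmx by rewrite unitmxE g1 unitr1.
have trA : \tr A = 0.
  rewrite -AE mxtrace_mulC mulmxA mulVmx // mul1mx /mxtrace big_ord_recl big_ord1.
  by rewrite !mxE /= subrr.
have dA : \det A = - 1.
  by rewrite -AE !det_mulmx g1 mul1r det_inv g1 invr1 mulr1 det_sl2 expr1n mulr0 subr0.
have [x [y [z AE']]] : exists x y z, A = sl2 x y z.
  by exists (A 0 0), (A 0 1), (A 1 0); exact: sl2_of_trace0.
clear AE trA; subst A.
have two0 : (2 : R[i]) != 0 by rewrite pnatr_eq0.
(* Off-diagonal directions kill y and z; the determinant then leaves x = 1 or x = -1. *)
have off b c : b * z - y * c = 0.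
  have := crit (sl2 0 b c); rewrite /mxtrace !big_ord_recl !big_ord0 !mxE /= oppr0 !addr0.
  move=> /(_ erefl); rewrite /height /mxtrace.
  rewrite !big_ord_recl !big_ord0 !mxE !big_ord_recl !big_ord0 !mxE !big_ord_recl !big_ord0 !mxE /=.
  move=> h; apply: (mulfI two0); rewrite mulr0 -[RHS]h; ring.
have z0 : z = 0 by have := off 1 0; rewrite mul1r mulr0 subr0.
have y0 : y = 0 by have := off 0 1; rewrite mul0r mulr1 sub0r => /eqP; rewrite oppr_eq0 => /eqP.
rewrite z0 y0 det_sl2 mulr0 subr0 in dA *.
move/eqP: dA; rewrite eqr_opp sqrf_eq1 => /orP[] /eqP->; first by right.
by left; rewrite /H0 sl2N oppr0.
Qed.

Lemma H0_neq_opp : - H0 R <> H0 R.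
Proof.
move/matrixP/(_ 0 0); rewrite !mxE /= => /eqP; rewrite eq_sym -subr_eq0 opprK -mulr2n.
by rewrite pnatr_eq0.
Qed.

Lemma apex_critical : injective (@apex R) /\ range (@apex R) = @critical_points R.
Proof.
split.
- move=> i j; rewrite /apex.
  by case: (ord2P i) (ord2P j) => -> [] -> //= E; [case: H0_neq_opp|case: H0_neq_opp].
- rewrite critical_pointsE; apply/seteqP; split=> [_ [i _ <-]|A [] ->].
  + by rewrite /apex; case: ifP => _; [left|right].
  + by exists 0.
  + by exists 1.
Qed.

Lemma thimble_apex i : thimble i (@apex R i).
Proof.
have e l : l ^+ 2 = 1 -> alpha l 0 = sl2 l%:C 0 0 :> 'M[R[i]]_2.
  by move=> l2; rewrite /alpha l2 subrr sqrtr0 !mul0r.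
case: (ord2P i) => ->; rewrite /apex /=.
- exists (- 1), 0; rewrite e ?sqrrN ?expr1n//; split; last by rewrite lexx /=; lra.
  by rewrite /H0 sl2N oppr0 rmorphN1.
- exists 1, 0; rewrite e ?expr1n//; split=> //; by rewrite lexx ler01.
Qed.

End CriticalPoints.
Theorem theorem3p1 (R : realType) (h : R -> R) (hh : morse_two_crit h) :
  exists (J : R[i] -> R[i] -> R[i]) (ph : 'I_2 -> R[i] -> R),
    [/\ compatible_acs J,
        forall i, grading (perturbed_cycle h i) (ph i)
      & forall L : 'I_2 -> brane R,
          (forall i, [/\ lag (L i) = perturbed_cycle h i, phase (L i) = ph i
                       & ~ (lag (L 0) `&` lag (L 1)) (mark (L i))]) ->
          (exists C : ainf_cat 'I_2, fukaya_seidel J L C) /\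
          forall C : ainf_cat 'I_2, fukaya_seidel J L C ->
            (forall i j : 'I_2,
               cochain_iso (hom_complex C i j)
                 (if (i < j)%N then cdsum cochainZ (cshift cochainZ (- 1))
                  else if i == j then cochainZ else cochain0)) /\
            (forall s c, mu s c != 0 ->
               exists i e x, strict_unit (C := C) i e /\
                 (s = [:: e; x] \/ s = [:: x; e]))].

Proof.
have [m [n [mn [Ds Dp D'0 [Dm Dn]] [D'm D'n] Dpos Dneg]]] := morse_min_max hh.
pose D (x : R) : R := - derive1 h x.
pose J := logJ (Jk D m n) (Jp D m n).
pose ph (i : 'I_2) := if i == 0 then (fun=> 2^-1) else graph_phase D.
have cyc i : perturbed_cycle h i = if i == 0 then flat_cycle else graph_cycle D.
  exact: perturbed_cycleE.
exists J, ph; split.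
- exact: compatible_J.
- move=> i; rewrite cyc /ph; case: ifP => _; first exact: flat_grading.
  exact: graph_grading.
move=> L LP.
have [L0E p0 mk0] := LP 0; have [L1E p1 mk1] := LP 1.
rewrite cyc /= in L0E; rewrite cyc /= in L1E; rewrite L0E L1E in mk0 mk1.
split.
- exists lg2_cat; split.
  + exact: apex_critical.
  + exact: thimble_apex.
  + by move=> i; exists (true, i == 1); [exact: lg2_cat_unit|move=> g; exact: lg2_cat_endo].
  + exact: lg2_cat_directed.
  + move=> i j; case: (ord2P i) (ord2P j) => -> [] -> // _.
    exact: lg2_floer_hom.
move=> C [_ _ units dir fl].
have [x [y [xP yP xy mu1]]] := floer_hom_gens mn Ds Dp D'0 Dm Dn D'm D'n Dpos Dneg L0E L1E p0 p1 mk0 mk1 (fl 0 1 isT).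
have [e0 U0 only0] := units 0; have [e1 U1 only1] := units 1.
pose e (i : 'I_2) := if i == 0 then e0 else e1.
have eU i : strict_unit i (e i) by case: (ord2P i) => ->.
have eo i (g : gen C) : src g = i -> tgt g = i -> g = e i.
  by case: (ord2P i) => ->; [exact: only0|exact: only1].
split; first by move=> i j; exact: hom_complex_iso xP yP xy mu1 i j.
exact: mu_unit eU eo dir mu1.
Qed.
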